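(* Let $D_k\sim\operatorname{GUE}_p$ for $k=1,\dots,n$, and for $k=1,\dots,n-1$ let $C_k$ be random Hermitian nonnegative definite $p\times p$ matrices such that $C_k^2\sim\operatorname{LUE}_p(p(n-k))$, and let all these matrices be independent. Then the $p\times p$ spectral matrix measure of the block-tridiagonal matrix $$\mathcal G_n=\begin{pmatrix}D_1&C_1&&\\C_1&D_2&\ddots&\\&\ddots&\ddots&C_{n-1}\\&&C_{n-1}&D_n\end{pmatrix}$$ has the same distribution as the ($p\times p$) spectral matrix measure of a random matrix with distribution $\operatorname{GUE}_{pn}$.
   Context: $\operatorname{GUE}_N$: law of an $N\times N$ Hermitian matrix whose entries are independent up to symmetry and conjugation, with diagonal entries $\mathcal N(0,1)$ and off-diagonal entries having independent real and imaginary parts with law $\mathcal N(0,1/2)$ (complex standard normal). $\operatorname{LUE}_N(\gamma)$: law of $GG^*$, where $G$ is an $N\times\gamma$ matrix with independent complex standard normal entries. Spectral matrix measure of a Hermitian $N\times N$ matrix $X$ ($N\ge p$): the unique nonnegative $p\times p$ matrix measure $\Sigma^X$ supported on the spectrum of $X$ with $(X^k)_{i,j}=\int x^kd\Sigma^X_{i,j}(x)$ for $k\ge0$, $1\le i,j\le p$. *)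

(* Defs.v *)
From HB Require Import structures.
From mathcomp Require Import all_boot all_order all_algebra.
From mathcomp Require Import all_classical all_reals all_analysis.
From mathcomp Require Import complex.
From mathcomp Require Import measurable_realfun measurable_fun_approximation.
From mathcomp Require Import lebesgue_integral_nonneg lebesgue_integrable.

Set Implicit Arguments.
Unset Strict Implicit.
Unset Printing Implicit Defensive.

Import Order.TTheory GRing.Theory Num.Theory.
Import numFieldNormedType.Exports.

Local Open Scope classical_set_scope.
Local Open Scope ring_scope.
Local Open Scope complex_scope.
Local Open Scope sesquilinear_scope.

(* Sigma-algebras are carried as explicit [set (set S)], because matrices and
   matrix measures have no canonical measurable structure.
   [initial_sigma K F f] is the smallest sigma-algebra on [S] making [f k]
   measurable into [(S', F)] for every [k] in [K]. *)
Definition initial_sigma (I S S' : Type) (K : set I) (F : set (set S'))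
    (f : I -> S -> S') : set (set S) :=
  <<s [set A | exists k B, [/\ K k, F B & A = f k @^-1` B]] >>.

Definition random_element (d : measure_display) (T : measurableType d)
    (S : Type) (F : set (set S)) (X : T -> S) : Prop :=
  forall A, F A -> measurable (X @^-1` A).

Definition same_law (R : realType) (d d' : measure_display)
    (T : measurableType d) (T' : measurableType d')
    (P : probability T R) (P' : probability T' R)
    (S : Type) (F : set (set S)) (X : T -> S) (X' : T' -> S) : Prop :=
  [/\ random_element F X, random_element F X' &
      forall A, F A -> P (X @^-1` A) = P' (X' @^-1` A)].

Definition independent (R : realType) (d : measure_display)
    (T : measurableType d) (P : probability T R) (I : finType)
    (S : Type) (F : set (set S)) (X : I -> T -> S) : Prop :=
  forall (J : {set I}) (A : I -> set S), (forall i, i \in J -> F (A i)) ->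
    P (\bigcap_(i in [set` J]) (X i @^-1` A i)) =
    (\prod_(i in J) P (X i @^-1` A i))%E.

(* [normal_prob] takes the standard deviation, [v] is the variance. *)
Definition has_normal_law (R : realType) (d : measure_display)
    (T : measurableType d) (P : probability T R) (X : T -> R) (m v : R) : Prop :=
  random_element measurable X /\
  forall A, measurable A -> P (X @^-1` A) = normal_prob m (Num.sqrt v) A.

Definition re_im (R : realType) (b : bool) (z : R[i]) : R :=
  if b then complex.Re z else complex.Im z.

Definition complex_borel (R : realType) : set (set R[i]) :=
  initial_sigma [set: bool] measurable (@re_im R).

Definition mx_borel (R : realType) (m n : nat) : set (set 'M[R[i]]_(m, n)) :=
  initial_sigma [set: 'I_m * 'I_n] (@complex_borel R)
    (fun ij (A : 'M[R[i]]_(m, n)) => A ij.1 ij.2).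

Definition psdmx (R : realType) (n : nat) (A : 'M[R[i]]_n) : Prop :=
  A \is hermsymmx /\ forall u : 'rV[R[i]]_n, 0 <= (u *m A *m u^t*) 0 0.

Definition std_complex_normal (R : realType) (d : measure_display)
    (T : measurableType d) (P : probability T R) (Z : T -> R[i]) : Prop :=
  independent P measurable (fun b w => re_im b (Z w)) /\
  forall b, has_normal_law P (fun w => re_im b (Z w)) 0 2^-1.

Definition is_GUE (R : realType) (d : measure_display) (T : measurableType d)
    (P : probability T R) (N : nat) (X : T -> 'M[R[i]]_N) : Prop :=
  [/\ random_element (@mx_borel R N N) X,
      forall w, X w \is hermsymmx,
      independent P (@complex_borel R)
        (fun (ij : {ij : 'I_N * 'I_N | (ij.1 <= ij.2)%N}) w =>
           X w (val ij).1 (val ij).2),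
      forall i, has_normal_law P (fun w => complex.Re (X w i i)) 0 1 &
      forall i j : 'I_N, (i < j)%N -> std_complex_normal P (fun w => X w i j)].

Definition is_ginibre (R : realType) (d : measure_display)
    (T : measurableType d) (P : probability T R) (m n : nat)
    (G : T -> 'M[R[i]]_(m, n)) : Prop :=
  [/\ random_element (@mx_borel R m n) G,
      independent P (@complex_borel R)
        (fun (ij : 'I_m * 'I_n) w => G w ij.1 ij.2) &
      forall i j, std_complex_normal P (fun w => G w i j)].

Definition is_LUE (R : realType) (d : measure_display) (T : measurableType d)
    (P : probability T R) (N gamma : nat) (Y : T -> 'M[R[i]]_N) : Prop :=
  exists (d' : measure_display) (T' : measurableType d')
         (P' : probability T' R) (G : T' -> 'M[R[i]]_(N, gamma)),
    is_ginibre P' G /\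
    same_law P P' (@mx_borel R N N) Y (fun w => G w *m (G w)^t*).

(* The integral of [f] against a signed measure, through the Jordan
   decomposition; meaningful when [f] is integrable against both parts. *)
Definition charge_integral (R : realType)
    (nu : {charge set (measurableTypeR R) -> \bar R}) (f : R -> R) : R :=
  let: exist P exN := cid (Hahn_decomposition nu) in
  let: exist N nuPN := cid exN in
  fine (\int[jordan_pos nuPN]_x (f x)%:E) -
  fine (\int[jordan_neg nuPN]_x (f x)%:E).

(* A [p x p] matrix of complex measures on the line, stored through the real
   and imaginary parts of its entries. *)
Record mxmeasure (R : realType) (p : nat) := MxMeasure {
  mxm_re : 'I_p -> 'I_p -> {charge set (measurableTypeR R) -> \bar R} ;
  mxm_im : 'I_p -> 'I_p -> {charge set (measurableTypeR R) -> \bar R} }.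

HB.instance Definition _ (R : realType) (p : nat) := gen_eqMixin (mxmeasure R p).
HB.instance Definition _ (R : realType) (p : nat) :=
  gen_choiceMixin (mxmeasure R p).
HB.instance Definition _ (R : realType) (p : nat) :=
  isPointed.Build (mxmeasure R p) (MxMeasure (fun _ _ => czero) (fun _ _ => czero)).

Definition mxm_val (R : realType) (p : nat) (B : set R) (Sigma : mxmeasure R p) :
    'M[R[i]]_p :=
  \matrix_(i, j) (fine (mxm_re Sigma i j B) +i* fine (mxm_im Sigma i j B)).

Definition mxm_integral (R : realType) (p : nat) (f : R -> R)
    (Sigma : mxmeasure R p) : 'M[R[i]]_p :=
  \matrix_(i, j) (charge_integral (mxm_re Sigma i j) f +i*
                  charge_integral (mxm_im Sigma i j) f).

(* On nonnegative matrix measures this is the Borel sigma-algebra of the topology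
   of weak convergence. *)
Definition mxm_sigma (R : realType) (p : nat) : set (set (mxmeasure R p)) :=
  initial_sigma [set B : set (measurableTypeR R) | measurable B]
    (@mx_borel R p p) (@mxm_val R p).

Definition is_spectral_measure (R : realType) (p N : nat) (le_pN : (p <= N)%N)
    (X : 'M[R[i]]_N) (Sigma : mxmeasure R p) : Prop :=
  [/\ forall B : set (measurableTypeR R), measurable B -> psdmx (mxm_val B Sigma),
      forall B : set (measurableTypeR R), measurable B ->
        (forall x, B x -> ~~ eigenvalue X x%:C) -> mxm_val B Sigma = 0 &
      forall k i j, (X ^+ k) (widen_ord le_pN i) (widen_ord le_pN j) =
        mxm_integral (fun x => x ^+ k) Sigma i j].

Definition spectral_measure (R : realType) (p N : nat) (le_pN : (p <= N)%N)
    (X : 'M[R[i]]_N) : mxmeasure R p :=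
  get [set Sigma | is_spectral_measure le_pN X Sigma].

Section spectral_measure_theory.
Variable R : realType.
Notation TR := (measurableTypeR R).

Lemma integral_finsupp (mu : {finite_measure set TR -> \bar R}) (s : seq R)
  (f : R -> R) : uniq s -> measurable_fun setT f -> mu (~` [set` s]) = 0%E ->
  (\int[mu]_x (f x)%:E = \sum_(x <- s) (f x)%:E * mu [set x])%E.
Proof.
move=> us mf mu0.
have ms : measurable ([set` s] : set TR).
  by apply: countable_measurable => //; apply: finite_set_countable; exact: finite_seq.
have m1 (x : R) : measurable ([set x] : set TR) by exact: measurable_set1.
rewrite (@ae_eq_integral _ _ _ mu _ (fun x => \sum_(y <- s) (f y)%:E * (\1_[set y] x)%:E)%E)//; first last.
- exists (~` [set` s]); split=> //; first exact: measurableC.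
  move=> x /= H; apply: contra_not H => xs _.
  rewrite (bigD1_seq x)//= indicE mem_set// mule1 big1 ?adde0// => y /negPf yx.
  by rewrite indicE memNset ?mule0//= => xy; rewrite xy eqxx in yx.
- apply: emeasurable_sum => y; apply/measurable_EFinP; apply: measurable_funM => //.
- exact/measurable_EFinP.
rewrite integral_sum//.
  apply: eq_bigr => y _; rewrite integralZl//; last first.
    exact: integrable_indic.
  by rewrite integral_indic// setIT.
move=> y; apply: integrableZl => //; exact: integrable_indic.
Qed.

Lemma charge_integral_finsupp (nu : {charge set TR -> \bar R}) (s : seq R) (f : R -> R) :
  uniq s -> measurable_fun setT f ->
  (forall B : set TR, measurable B -> (forall x, B x -> x \notin s) -> nu B = 0%E) ->
  charge_integral nu f = \sum_(x <- s) f x * fine (nu [set x]).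
Proof.
move=> us mf H; rewrite /charge_integral.
case: cid => P exN; case: cid => N nuPN.
have [[mP _] [mN _] _ _] := nuPN.
have ms : measurable ([set` s] : set TR).
  by apply: countable_measurable => //; apply: finite_set_countable; exact: finite_seq.
have m1 (x : R) : measurable ([set x] : set TR) by exact: measurable_set1.
have hp : jordan_pos nuPN (~` [set` s]) = 0%E.
  rewrite jordan_posE cjordan_posE /crestr0 mem_set ?/crestr; last exact: measurableC.
  by rewrite H//; [apply: measurableI => //; exact: measurableC|move=> x [] /= /negP].
have hn : jordan_neg nuPN (~` [set` s]) = 0%E.
  rewrite jordan_negE cjordan_negE /crestr0 mem_set ?/crestr; last exact: measurableC.
  by rewrite H ?oppe0//; [apply: measurableI => //; exact: measurableC|move=> x [] /= /negP].
rewrite (integral_finsupp us mf hp) (integral_finsupp us mf hn).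
rewrite -!sum_fine; try by move=> x _; rewrite fin_numM// fin_num_measure.
rewrite -sumrB; apply: eq_bigr => x _.
have F (m : {finite_measure set TR -> \bar R}) : m [set x] \is a fin_num by exact: fin_num_measure.
rewrite (jordan_decomp nuPN)//.
have -> : cadd (jordan_pos nuPN) (cscale (-1) (jordan_neg nuPN)) [set x] =
   (jordan_pos nuPN [set x] - jordan_neg nuPN [set x])%E by congr (_ + _)%E; exact: mulN1e.
have f0 : (f x)%:E \is a fin_num by [].
rewrite (fineM f0 (F (jordan_pos nuPN))) (fineM f0 (F (jordan_neg nuPN))).
by rewrite -mulrBr (fineB (F (jordan_pos nuPN)) (F (jordan_neg nuPN))).
Qed.

Lemma mxm_re0 p (Sigma : mxmeasure R p) (B : set TR) i j : measurable B -> mxm_val B Sigma = 0 ->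
  mxm_re Sigma i j B = 0%E /\ mxm_im Sigma i j B = 0%E.
Proof.
move=> mB /matrixP /(_ i j); rewrite !mxE => -[r0 i0].
by split; [rewrite -[LHS]fineK ?r0//|rewrite -[LHS]fineK ?i0//]; apply: fin_num_measure.
Qed.

Variables (p N : nat) (le_pN : (p <= N)%N) (X : 'M[R[i]]_N).

Lemma spectrum_seq : exists2 s : seq R, uniq s & forall x, (x \in s) = eigenvalue X x%:C.
Proof.
have [rs H] := closed_field_poly_normal (char_poly X).
exists (undup (map (@complex.Re R) [seq z <- rs | complex.Im z == 0])); first exact: undup_uniq.
move=> x; rewrite mem_undup eigenvalue_root_char H.
rewrite rootZ ?lead_coef_eq0 ?monic_neq0 ?char_poly_monic//.
  rewrite root_prod_XsubC; apply/mapP/idP => [[[a b]]|xrs].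
    by rewrite mem_filter /= => /andP[/eqP -> ars] ->.
  by exists x%:C => //; rewrite mem_filter /= eqxx.
Qed.

Lemma charge_uniq (nu nu' : {charge set TR -> \bar R}) (s : seq R) : uniq s ->
  (forall B : set TR, measurable B -> (forall x, B x -> x \notin s) -> nu B = 0%E) ->
  (forall B : set TR, measurable B -> (forall x, B x -> x \notin s) -> nu' B = 0%E) ->
  (forall k, charge_integral nu (fun x => x ^+ k) = charge_integral nu' (fun x => x ^+ k)) ->
  forall x, x \in s -> nu [set x] = nu' [set x].
Proof.
move=> us H H' E x xs.
have m1 (z : R) : measurable ([set z] : set TR) by exact: measurable_set1.
have mX k : measurable_fun [set: R] (fun x : R => x ^+ k) by exact: measurable_funX.
pose q := \prod_(y <- s | y != x) ('X - y%:P).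
have Eq (r : {poly R}) : \sum_(y <- s) r.[y] * fine (nu [set y]) = \sum_(y <- s) r.[y] * fine (nu' [set y]).
  under eq_bigr do rewrite horner_coef mulr_suml.
  under [RHS]eq_bigr do rewrite horner_coef mulr_suml.
  rewrite exchange_big [RHS]exchange_big /=; apply: eq_bigr => k _.
  have e := E k; rewrite !(charge_integral_finsupp us (mX k))// in e.
  transitivity (r`_k * \sum_(y <- s) y ^+ k * fine (nu [set y])).
    by rewrite mulr_sumr; apply: eq_bigr => y _; rewrite mulrA.
  by rewrite e mulr_sumr; apply: eq_bigr => y _; rewrite mulrA.
have qy y : y \in s -> y != x -> q.[y] = 0.
  move=> ys yx; rewrite /q horner_prod; apply/eqP; rewrite prodf_seq_eq0; apply/hasP; exists y => //.
  by rewrite yx hornerXsubC subrr eqxx.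
have qx : q.[x] != 0.
  rewrite /q horner_prod prodf_seq_neq0; apply/allP => y ys; apply/implyP => yx.
  by rewrite hornerXsubC subr_eq0 eq_sym.
have Q (m : R -> R) : \sum_(y <- s) q.[y] * m y = q.[x] * m x.
  rewrite (bigD1_seq x)//= big_seq_cond big1 ?addr0// => y /andP[ys yx].
  by rewrite qy// mul0r.
have := Eq q; rewrite (Q (fun y => fine (nu [set y]))) (Q (fun y => fine (nu' [set y]))).
move=> /(mulfI qx) e.
have F (m : {charge set TR -> \bar R}) : m [set x] \is a fin_num by apply: fin_num_measure; exact: m1.
by rewrite -(fineK (F nu)) -(fineK (F nu')) e.
Qed.

Lemma charge_uniqB (nu nu' : {charge set TR -> \bar R}) (s : seq R) : uniq s ->
  (forall B : set TR, measurable B -> (forall x, B x -> x \notin s) -> nu B = 0%E) ->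
  (forall B : set TR, measurable B -> (forall x, B x -> x \notin s) -> nu' B = 0%E) ->
  (forall x, x \in s -> nu [set x] = nu' [set x]) ->
  forall B : set TR, measurable B -> nu B = nu' B.
Proof.
move=> us H H' E B mB.
have m1 (z : R) : measurable ([set z] : set TR) by exact: measurable_set1.
suff main (t : seq R) : {subset t <= s} -> forall B : set TR, measurable B ->
    (forall x, B x -> x \in s -> x \in t) -> nu B = nu' B.
  by apply: (main s) => // x.
elim: t => [_ A mA HA|a t IH ts A mA HA].
  rewrite H ?H'// => x /HA; case: (x \in s) => // /(_ isT) //.
have ts' : {subset t <= s} by move=> x xt; apply: ts; rewrite inE xt orbT.
have [aA|aA] := pselect (A a); last first.
  apply: IH => // x Ax xs; have := HA x Ax xs; rewrite inE => /predU1P[xa|//].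
  by rewrite xa in Ax.
have mD : measurable (A `\` [set a] : set TR) by exact: measurableD.
have Ae : A = [set a] `|` (A `\` [set a]) by rewrite setUC setDKU// => x ->.
have d0 : [set a] `&` (A `\` [set a]) = set0 by apply/seteqP; split => x //= [-> [_]]; apply.
rewrite Ae !chargeU// E; last by apply: ts; rewrite inE eqxx.
congr (_ + _)%E; apply: IH => // x [Ax xa] xs.
by have := HA x Ax xs; rewrite inE => /predU1P[].
Qed.

Lemma spectral_measure_uniq (S S' : mxmeasure R p) :
  is_spectral_measure le_pN X S -> is_spectral_measure le_pN X S' ->
  forall B : set TR, measurable B -> mxm_val B S = mxm_val B S'.
Proof.
move=> [_ s1 m1] [_ s2 m2] B mB.
have [s us sE] := spectrum_seq.
have K (S0 : mxmeasure R p) : (forall B : set (measurableTypeR R), measurable B ->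
    (forall x, B x -> ~~ eigenvalue X x%:C) -> mxm_val B S0 = 0) -> forall i j (B : set TR), measurable B -> (forall x, B x -> x \notin s) -> mxm_re S0 i j B = 0%E /\ mxm_im S0 i j B = 0%E.
  by move=> h i j A mA As; apply: mxm_re0 => //; apply: h => // x /As; rewrite sE.
apply/matrixP => i j; rewrite !mxE; congr (fine _ +i* fine _).
  apply: (charge_uniqB us) mB.
  - by move=> A mA /(K _ s1 i j _ mA)[].
  - by move=> A mA /(K _ s2 i j _ mA)[].
  - apply: (charge_uniq us).
    - by move=> A mA /(K _ s1 i j _ mA)[].
    - by move=> A mA /(K _ s2 i j _ mA)[].
    - by move=> k; have := m2 k i j; rewrite m1 !mxE => -[].
apply: (charge_uniqB us) mB.
- by move=> A mA /(K _ s1 i j _ mA)[].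
- by move=> A mA /(K _ s2 i j _ mA)[].
- apply: (charge_uniq us).
  - by move=> A mA /(K _ s1 i j _ mA)[].
  - by move=> A mA /(K _ s2 i j _ mA)[].
  - by move=> k; have := m2 k i j; rewrite m1 !mxE => -[].
Qed.

Lemma discrete_charge (I : Type) (r : seq I) (c x : I -> R) :
  exists nu : {charge set TR -> \bar R}, forall B : set TR, measurable B ->
    nu B = (\sum_(l <- r) c l * \1_B (x l))%:E.
Proof.
elim: r => [|a r [nu nuE]]; first by exists czero => B _; rewrite big_nil.
exists (cadd (cscale (c a) (charge_of_finite_measure (dirac (x a : TR)))) nu) => B mB.
rewrite big_cons EFinD -nuE//.
Qed.

Lemma spectral_measure_exists : X \is hermsymmx ->
  exists S : mxmeasure R p, is_spectral_measure le_pN X S.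
Proof.
move=> hX.
pose U := spectralmx X; pose la := spectral_diag X.
have uU : U \is unitarymx := spectral_unitarymx X.
have XE : X = U^t* *m diag_mx la *m U.
  by rewrite -invmx_unitary//; apply/orthomx_spectralP/hermitian_normalmx.
have laR l : la 0 l = (complex.Re (la 0 l))%:C.
  have /mxOverP /(_ 0 l) := hermitian_spectral_diag_real hX.
  by move=> h; rewrite RRe_real.
pose x l := complex.Re (la 0 l).
pose c i j l := (U^t* (widen_ord le_pN i) l * U l (widen_ord le_pN j)).
have [re reE] := choice (fun ij : 'I_p * 'I_p => discrete_charge (index_enum 'I_N) (fun l => complex.Re (c ij.1 ij.2 l)) x).
have [im imE] := choice (fun ij : 'I_p * 'I_p => discrete_charge (index_enum 'I_N) (fun l => complex.Im (c ij.1 ij.2 l)) x).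
pose S := MxMeasure (fun i j => re (i, j)) (fun i j => im (i, j)).
have UX : U *m X = diag_mx la *m U by rewrite XE !mulmxA (unitarymxP uU) mul1mx.
have eig l : eigenvalue X (x l)%:C.
  apply/eigenvalueP; exists (row l U).
    rewrite -row_mul UX; apply/rowP => j; rewrite !mxE (bigD1 l)//= !mxE eqxx mulr1n big1 ?addr0 -?laR//.
    by move=> m /negPf ml; rewrite !mxE eq_sym ml mulr0n mul0r.
  apply/negP => /eqP r0; have := unitarymxP uU => /matrixP /(_ l l); rewrite !mxE eqxx.
  rewrite big1 => [/eqP|j _]; first by rewrite eq_sym oner_eq0.
  by move/rowP: r0 => /(_ j); rewrite !mxE => ->; rewrite mul0r.
have SE (B : set TR) i j : measurable B -> mxm_val B S i j = \sum_l c i j l * (\1_B (x l))%:C.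
  move=> mB; rewrite mxE /= reE// imE//=.
  apply/eqP; rewrite eq_complex /= !raddf_sum/=; apply/andP; split; apply/eqP; apply: eq_bigr => l _.
    by case: (c i j l) => a b /=; rewrite mulr0 subr0.
  by case: (c i j l) => a b /=; rewrite mulr0 add0r mulrC.
have XkE k : X ^+ k = U^t* *m diag_mx (\row_l (la 0 l) ^+ k) *m U.
  elim: k => [|k IH].
    rewrite expr0 (_ : diag_mx _ = 1%:M) ?mulmx1 -?invmx_unitary ?mulVmx ?unitarymx_unit//.
    by apply/matrixP => i j; rewrite !mxE expr0.
  rewrite exprSr IH -[LHS]/(_ *m X) [in LHS]XE -!mulmxA (mulmxA U) (unitarymxP uU) mul1mx; congr (_ *m _).
  rewrite !mulmxA; congr (_ *m _); apply/matrixP => i j.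
  by rewrite mul_diag_mx !mxE mulrnAr exprSr; case: eqP => [->|_]; rewrite ?mulr0n ?mulr1n.
exists S; split.
- move=> B mB.
  pose W : 'M[R[i]]_(p, N) := \matrix_(i, l) U^t* (widen_ord le_pN i) l.
  pose w : 'rV[R[i]]_N := \row_l (\1_B (x l))%:C.
  have SW : mxm_val B S = W *m diag_mx w *m W^t*.
    apply/matrixP => i j; rewrite SE// mxE; apply: eq_bigr => l _.
    by rewrite mul_mx_diag !mxE /c conjCK !mxE mulrAC.
  split; first apply/is_hermitianmxP; rewrite ?expr0 ?scale1r SW.
    rewrite !trmx_mul !map_mxM trmxCK tr_diag_mx map_diag_mx !mulmxA.
    congr (_ *m diag_mx _ *m _); apply/rowP => l; rewrite !mxE.
    by apply/esym/CrealP; rewrite complex_real.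
  move=> u; have -> : u *m (W *m diag_mx w *m W^t*) *m u^t* = (u *m W) *m diag_mx w *m (u *m W)^t*.
    by rewrite trmx_mul map_mxM !mulmxA.
  rewrite mxE sumr_ge0// => l _; rewrite mul_mx_diag !mxE mulrAC mulr_ge0//.
    exact: mul_conjC_ge0.
  by rewrite lecR.
- move=> B mB Bs; apply/matrixP => i j; rewrite SE// mxE big1// => l _.
  by rewrite indicE memNset ?mulr0// => /Bs /negP; apply.
- move=> k i j.
  have [s us sE] := spectrum_seq.
  have xs l : x l \in s by rewrite sE.
  have supp (nu : {charge set TR -> \bar R}) (a : 'I_N -> R) : (forall B : set TR, measurable B ->
    nu B = (\sum_l a l * \1_B (x l))%:E) -> charge_integral nu (fun z => z ^+ k) = \sum_l a l * x l ^+ k.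
    move=> nuE; rewrite (charge_integral_finsupp us); first last.
    + move=> B mB Bs; rewrite nuE// big1// => l _; rewrite indicE memNset ?mulr0//.
      by move=> /Bs; rewrite xs.
    + exact: measurable_funX.
    under eq_bigr => z _ do rewrite nuE ?mulr_sumr//=.
    rewrite exchange_big; apply: eq_bigr => l _ /=.
    rewrite (bigD1_seq (x l))//= indicE mem_set// mulr1 mulrC big1 ?addr0// => z /negPf zx.
    by rewrite indicE memNset ?mulr0// => /= e; rewrite e eqxx in zx.
  rewrite mxE /= (supp _ _ (reE _)) (supp _ _ (imE _)) XkE mxE.
  transitivity (\sum_l c i j l * (x l ^+ k)%:C).
    by apply: eq_bigr => l _; rewrite mul_mx_diag !mxE laR -rmorphXn /= /c !mxE mulrAC.
  apply/eqP; rewrite eq_complex /= !raddf_sum/=; apply/andP; split; apply/eqP; apply: eq_bigr => l _.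
    by case: (c i j l) => a b /=; rewrite mulr0 subr0.
  by case: (c i j l) => a b /=; rewrite mulr0 add0r mulrC.
Qed.

Lemma spectral_measureP : X \is hermsymmx ->
  is_spectral_measure le_pN X (spectral_measure le_pN X).
Proof. by move=> /spectral_measure_exists; exact: getPex. Qed.

End spectral_measure_theory.

(* Indices start at 0: the diagonal blocks are [D 0, ..., D n.-1] and the
   off-diagonal ones [C 0, ..., C n.-2]. *)
Definition block_jacobi (R : realType) (n p : nat) (D C : nat -> 'M[R[i]]_p) :
    'M[R[i]]_(\sum_(i < n) p) :=
  \mxblock_(i < n, j < n)
    (if i == j then D i
     else if j == i.+1 :> nat then C i
     else if i == j.+1 :> nat then C j
     else 0).

Lemma leq_block_dim (n p : nat) : (0 < n)%N -> (p <= \sum_(i < n) p)%N.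
Proof. by move=> n_gt0; rewrite sum_nat_const card_ord leq_pmull. Qed.

(* Main.v *)
From HB Require Import structures.
Require Import Defs.
From mathcomp Require Import all_boot all_order all_algebra.
From mathcomp Require Import all_classical all_reals all_analysis.
From mathcomp Require Import complex ring lra.
From mathcomp Require Import measurable_realfun.

(** Write a GUE matrix X of size p n in p x p blocks: D is its first diagonal
    block, b the rest of its first block row and Z the complementary corner.
    Let S = (b b^H)^(1/2). The rows of b and of (S, 0, ..., 0) have the same
    Gram matrix, so some unitary W satisfies b W = (S, 0, ..., 0)
    ([witt_extension]). Conjugating X by the block diagonal matrix with blocks
    1 and W fixes the first p basis vectors, hence leaves the spectral measure
    unchanged ([spectral_measure_unitary]); the first block row becomes
    (D, S, 0, ...), and Z becomes W^H Z W. Here D is GUE and S^2 = b b^H is LUE.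
    Since W depends only on b, which is independent of Z, and since the law of
    Z is unitarily invariant ([gue_unitary]), the new corner is again GUE and
    independent of D and S. Repeating this with the corner produces the
    block-tridiagonal matrix.

    The repetition is carried out on [hybrid k], which has the blocks of the
    block-tridiagonal matrix for indices below k and those of a GUE matrix
    beyond. It is shown that, for an event invariant under changes of basis
    fixing the first block, the hybrids k and k + 1 have the same probability
    ([hybrid_probability_step]). A measurable choice of W is never made: the
    corner is first resampled from an independent copy, so that X and hence W
    can be frozen, unitary invariance is applied for each frozen value, and
    Fubini integrates the equality of the slices.

    Three ingredients carry the argument. Laws of independent families are
    determined by their marginals and coordinates may be resampled on a product
    space ([product_law_unique], [product_law_replace]). Standard Gaussian
    families are invariant under orthogonal matrices
    ([orthogonal_normal_invariant]), because plane reflections preserve the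
    Gaussian measure of the plane and generate the orthogonal group; read in
    real coordinates for which the trace inner product is Euclidean, this gives
    [gue_unitary]. Finally the entries of the spectral measure of a Borel set
    are entries of a functional calculus ([spectral_measure_indic]), and the
    functions whose functional calculus is measurable form a class stable under
    sums, products and pointwise limits, which contains the Borel indicators
    and the square root ([fmeasurable_indic], [fmeasurable_ge0]); this makes
    the spectral measure and S measurable functions of the matrix. *)

Set Implicit Arguments.
Unset Strict Implicit.
Unset Printing Implicit Defensive.

Import Order.TTheory GRing.Theory Num.Theory.
Import numFieldNormedType.Exports.

Local Open Scope classical_set_scope.
Local Open Scope ring_scope.
Local Open Scope complex_scope.
Local Open Scope sesquilinear_scope.

(** * Laws of independent families *)

Lemma same_law_comp (R : realType) d d' (T : measurableType d)
  (T' : measurableType d') (P : probability T R) (P' : probability T' R)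
  (S S' : Type) (F : set (set S)) (F' : set (set S')) (X : T -> S) (X' : T' -> S)
  (g : S -> S') :
  same_law P P' F X X' -> (forall B, F' B -> F (g @^-1` B)) ->
  same_law P P' F' (g \o X) (g \o X').
Proof.
move=> [rX rX' E] mg; split.
- by move=> A /mg /rX.
- by move=> A /mg /rX'.
- by move=> A /mg /E.
Qed.

Lemma initial_sigma_algebra (I S S' : Type) (K : set I) (F : set (set S'))
  (f : I -> S -> S') : sigma_algebra setT (initial_sigma K F f).
Proof. exact: smallest_sigma_algebra. Qed.

Lemma random_element_initial d (T : measurableType d)
  (I S S' : Type) (K : set I) (F : set (set S')) (f : I -> S -> S') (X : T -> S) :
  random_element (initial_sigma K F f) X <->
  forall k, K k -> random_element F (f k \o X).
Proof.
split=> [rX k Kk A FA|rX].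
  by apply: (rX (f k @^-1` A)); apply: sub_sigma_algebra; exists k, A.
suff: initial_sigma K F f `<=` [set A | measurable (X @^-1` A)] by [].
apply: smallest_sub => [|_ [k [B [Kk FB ->]]]]; last exact: rX.
split=> /= [|A mA|A mA]; first by rewrite preimage_set0.
  by rewrite setTD preimage_setC; exact: measurableC.
by rewrite preimage_bigcup; exact: bigcup_measurable.
Qed.

Section product_laws.
Variables (R : realType) (S : pointedType) (F : set (set S)).
Hypothesis sF : sigma_algebra setT F.

Let F0 : F set0. Proof. by case: sF. Qed.
Let FT : F setT. Proof. by case: sF => ? H _; rewrite -(setD0 setT); exact: H. Qed.
Let FC A : F A -> F (~` A).
Proof. by case: sF => ? H _ FA; rewrite -setTD; exact: H. Qed.
Let FI A B : F A -> F B -> F (A `&` B).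
Proof.
move=> FA FB; rewrite -[_ `&` _]setCK setCI; apply: FC.
by rewrite -bigcup2E; case: sF => _ _; apply=> -[|[|k]]//=; exact: FC.
Qed.

(** Independence with prescribed marginals, tested on events that constrain
    every coordinate: a subfamily is reached by leaving the other coordinates
    in the whole space. *)
Definition has_product_law d (T : measurableType d) (P : probability T R)
  (I : finType) (mu : I -> set S -> \bar R) (X : T -> I -> S) : Prop :=
  (forall i, random_element F (X ^~ i)) /\
  forall B : I -> set S, (forall i, F (B i)) ->
    P [set w | forall i, B i (X w i)] = (\prod_i mu i (B i))%E.

Definition family_sigma (I : finType) : set (set (I -> S)) :=
  initial_sigma [set: I] F (fun i f => f i).

Lemma cylinder_family_sigma (I : finType) (B : I -> set S) :
  (forall i, F (B i)) -> @family_sigma I [set f | forall i, B i (f i)].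
Proof.
move=> FB.
have -> : [set f | forall i, B i (f i)] =
    \bigcap_(i in [set: I]) ((fun f : I -> S => f i) @^-1` B i).
  by apply/seteqP; split=> f /= h i //=; exact: h.
apply: (@fin_bigcap_measurable _ (g_sigma_algebraType [set A | exists k B0,
  [/\ setT k, F B0 & A = (fun f : I -> S => f k) @^-1` B0]])).
  exact: finite_finset.
by move=> i _; apply: sub_sigma_algebra; exists i, (B i).
Qed.

(** The events constraining every coordinate are stable under intersection and
    generate the sigma-algebra of families, so Dynkin's lemma applies. *)
Lemma product_law_unique d d' (T : measurableType d) (T' : measurableType d')
  (P : probability T R) (P' : probability T' R) (I : finType)
  (mu : I -> set S -> \bar R) (X : T -> I -> S) (X' : T' -> I -> S) :
  has_product_law P mu X -> has_product_law P' mu X' ->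
  same_law P P' (@family_sigma I) X X'.
Proof.
move=> [rX PX] [rX' PX'].
have RX : random_element (@family_sigma I) X.
  by apply/random_element_initial => i _; exact: rX.
have RX' : random_element (@family_sigma I) X'.
  by apply/random_element_initial => i _; exact: rX'.
split=> //.
pose G := [set A : set (I -> S) | exists2 B : I -> set S, (forall i, F (B i)) &
  A = [set f | forall i, B i (f i)]].
have GI : setI_closed G.
  move=> _ _ [B FB ->] [B' FB' ->]; exists (fun i => B i `&` B' i).
    by move=> i; exact: FI.
  by apply/seteqP; split=> f /= => [[h h'] i|h]; [split|split=> i; have [] := h i].
have GF : <<s G >> `<=` @family_sigma I.
  apply: smallest_sub; first exact: initial_sigma_algebra.
  by move=> _ [B FB ->]; exact: cylinder_family_sigma.
have FG : @family_sigma I `<=` <<s G >>.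
  apply: smallest_sub; first exact: smallest_sigma_algebra.
  move=> _ [i [B [_ FB ->]]]; apply: sub_sigma_algebra.
  exists (fun j => if j == i then B else setT).
    by move=> j; case: ifP => _; [exact: FB|exact: FT].
  apply/seteqP; split => f /= => [Bf j|/(_ i)]; last by rewrite eqxx.
  by case: eqP => // ->.
move=> A /FG; move: A.
apply: (@dynkin_induction _ (g_sigma_algebraType G) G) => //.
- by rewrite !preimage_setT !probability_setT.
- by move=> _ [B FB ->]; rewrite -[LHS]/(P [set w | forall i, B i (X w i)]) PX// -PX'.
- move=> A /GF mA E; have mXA := RX _ mA; have mXA' := RX' _ mA.
  change (P (~` (X @^-1` A)) = P' (~` (X' @^-1` A))).
  by rewrite (probability_setC P mXA) (probability_setC P' mXA') E.
- move=> A mA tA E; rewrite (preimage_bigcup setT X) (preimage_bigcup setT X').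
  have mXA k : measurable (X @^-1` A k) by apply: RX; apply: GF; exact: mA.
  have mXA' k : measurable (X' @^-1` A k) by apply: RX'; apply: GF; exact: mA.
  have tp U (f : U -> I -> S) : trivIset setT (fun k => f @^-1` A k).
    apply/trivIsetP => i j _ _ ij; have /trivIsetP/(_ i j Logic.I Logic.I ij) e := tA.
    by rewrite -(preimage_setI f) e preimage_set0.
  have tXA := tp _ X; have tXA' := tp _ X'.
  rewrite (measure_bigcup P setT _ (fun k _ => mXA k) tXA).
  rewrite (measure_bigcup P' setT _ (fun k _ => mXA' k) tXA').
  by apply: eq_eseriesr => k _; exact: E.
Qed.

Lemma product_law_transfer d d' (T : measurableType d)
  (T' : measurableType d') (P : probability T R) (Q : probability T' R)
  (I : finType) (mu : I -> set S -> \bar R) (X : T -> I -> S) (Y : T' -> I -> S) :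
  same_law P Q (@family_sigma I) X Y -> has_product_law Q mu Y ->
  has_product_law P mu X.
Proof.
move=> [rX _ E] [rY YE]; split.
  by move=> i; move/random_element_initial : rX; apply.
move=> B FB; rewrite -YE//.
exact: (E _ (cylinder_family_sigma FB)).
Qed.

Lemma measurable_cylinder d (T : measurableType d) (I : finType)
  (X : T -> I -> S) (B : I -> set S) : (forall i, random_element F (X ^~ i)) ->
  (forall i, F (B i)) -> measurable [set w | forall i, B i (X w i)].
Proof.
move=> rX FB.
have -> : [set w | forall i, B i (X w i)] =
    \bigcap_(i in [set: I]) ((X ^~ i) @^-1` B i).
  by apply/seteqP; split=> f /= h i //=; exact: h.
by apply: fin_bigcap_measurable => [|i _]; [exact: finite_finset|exact: rX].
Qed.

(** Resampling the coordinates outside [E] on an independent factor: an event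
    constraining every coordinate becomes a rectangle of the product space. *)
Lemma product_law_replace d d' (T : measurableType d) (T' : measurableType d')
  (P : probability T R) (P' : probability T' R) (I : finType) (E : pred I)
  (mu : I -> set S -> \bar R) (X : T -> I -> S) (Z : T' -> I -> S) :
  (forall i, mu i setT = 1%E) -> has_product_law P mu X ->
  (forall i, ~~ E i -> random_element F (Z ^~ i)) ->
  (forall B : I -> set S, (forall i, F (B i)) ->
    P' [set w | forall i, ~~ E i -> B i (Z w i)] = (\prod_(i | ~~ E i) mu i (B i))%E) ->
  has_product_law (P \x P')%E mu (fun w i => if E i then X w.1 i else Z w.2 i).
Proof.
move=> mu1 [rX PX] rZ PZ; split.
  move=> i B FB; case: (boolP (E i)) => Ei.
    by rewrite -[X in measurable X]/(fst @^-1` ((X ^~ i) @^-1` B)) -[X in measurable X]setTI;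
      apply: measurable_fst => //; exact: rX.
  by rewrite -[X in measurable X]/(snd @^-1` ((Z ^~ i) @^-1` B)) -[X in measurable X]setTI;
    apply: measurable_snd => //; exact: rZ.
move=> B FB.
pose B1 i := if E i then B i else setT.
have FB1 i : F (B1 i) by rewrite /B1; case: ifP.
have mZ : measurable [set w | forall i, ~~ E i -> B i (Z w i)].
  have -> : [set w | forall i, ~~ E i -> B i (Z w i)] =
      \bigcap_(i in [set i | ~~ E i]) ((Z ^~ i) @^-1` B i).
    by apply/seteqP; split=> f /= h i //=; exact: h.
  by apply: fin_bigcap_measurable => [|i Ei]; [exact: finite_finset|exact: rZ].
rewrite (_ : [set w | _] = [set w | forall i, B1 i (X w i)] `*`
    [set w | forall i, ~~ E i -> B i (Z w i)]); last first.
  apply/seteqP; split=> -[w w'] /=.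
    by move=> h; split=> i; have := h i; rewrite /B1; case: (E i).
  by move=> [h h'] i; have := h i; have := h' i; rewrite /B1; case: (E i) => // /(_ isT).
transitivity (P [set w | forall i, B1 i (X w i)] *
    P' [set w | forall i, ~~ E i -> B i (Z w i)])%E.
  by apply: product_measure1E => //; exact: measurable_cylinder.
rewrite PX// PZ// [X in (X * _)%E](bigID E)/= [RHS](bigID E)/=.
rewrite [X in (_ * X * _)%E]big1 ?mule1; last first.
  by move=> i /negPf Ei; rewrite /B1 Ei mu1.
by congr (_ * _)%E; apply: eq_bigr => i Ei; rewrite /B1 Ei.
Qed.

Lemma product_law_mix d d' (T : measurableType d) (T' : measurableType d')
  (P : probability T R) (P' : probability T' R) (I : finType) (E : pred I)
  (mu : I -> set S -> \bar R) (X : T -> I -> S) (X' : T' -> I -> S) :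
  (forall i, mu i setT = 1%E) ->
  has_product_law P mu X -> has_product_law P' mu X' ->
  has_product_law (P \x P')%E mu
    (fun w i => if E i then X w.1 i else X' w.2 i).
Proof.
move=> mu1 lX [rX' PX']; apply: product_law_replace => //.
move=> B FB; pose B' i := if E i then setT else B i.
transitivity (P' [set w | forall i, B' i (X' w i)]).
  congr (P' _); apply/seteqP; split=> w /= h i; have := h i; rewrite /B'.
    by case: (E i) => // /(_ isT).
  by case: (E i).
rewrite PX'; last by move=> i; rewrite /B'; case: ifP.
rewrite (bigID E)/= big1 ?mul1e; last by move=> i Ei; rewrite /B' Ei mu1.
by apply: eq_bigr => i /negPf Ei; rewrite /B' Ei.
Qed.

(** The coordinates outside the range of [h] are left in the whole space, where
    they contribute factors 1. *)
Lemma product_law_sub d (T : measurableType d)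
  (P : probability T R) (I J : finType) (h : J -> I)
  (mu : I -> set S -> \bar R) (X : T -> I -> S) :
  injective h -> (forall i, mu i setT = 1%E) -> has_product_law P mu X ->
  has_product_law P (mu \o h) (fun w j => X w (h j)).
Proof.
move=> ih mu1 [rX PX]; split=> [j|B FB]; first exact: rX.
pose B' i := if [pick j | h j == i] is Some j then B j else setT.
have B'h j : B' (h j) = B j.
  by rewrite /B'; case: pickP => [k /eqP/ih ->//|/(_ j)]; rewrite eqxx.
have B'n i : i \notin codom h -> B' i = setT.
  rewrite /B'; case: pickP => // j /eqP <- /negP[]; exact: codom_f.
have FB' i : F (B' i) by rewrite /B'; case: pickP.
transitivity (P [set w | forall i, B' i (X w i)]).
  congr (P _); apply/seteqP; split=> w /= H.
    move=> i; have [/codomP[j ->]|/B'n ->//] := boolP (i \in codom h).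
    by rewrite B'h; exact: H.
  by move=> j; rewrite -B'h; exact: H.
rewrite PX// (bigID (mem (codom h)))/= [X in (_ * X)%E]big1 ?mule1; last first.
  by move=> i /B'n ->; exact: mu1.
transitivity (\prod_(i <- codom h) mu i (B' i))%E.
  by rewrite [RHS]big_uniq//= map_inj_uniq ?enum_uniq.
rewrite big_image/=.
by apply: eq_bigr => j _; rewrite B'h.
Qed.

End product_laws.

Section fubini_slices.
Context d1 d2 d3 (T1 : measurableType d1) (T2 : measurableType d2)
  (T3 : measurableType d3) (R : realType).
Variables (P1 : probability T1 R) (P2 : probability T2 R) (P3 : probability T3 R).
Local Open Scope ereal_scope.

(** Comparing slices one by one allows the equality for [x] to come from objects
    chosen depending on [x] in a non-measurable way, such as a unitary matrix. *)
Lemma prod_probability_eq1 (A : set (T1 * T2)) (B : set (T1 * T3)) :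
  (forall x, P2 (xsection A x) = P3 (xsection B x)) ->
  (P1 \x P2) A = (P1 \x P3) B.
Proof. by move=> E; apply: eq_integral => x _; exact: E. Qed.

Lemma prod_probability_swap (A : set (T1 * T2)) : measurable A ->
  (P1 \x P2) A = (P1 \x^ P2) A.
Proof.
by move=> mA; apply: product_measure_unique => // ? ? ? ?; exact: product_measure2E.
Qed.

Lemma prod_probabilityA (B : set (T1 * (T2 * T3))) : measurable B ->
  (P1 \x (P2 \x P3)) B =
  ((P1 \x P2) \x P3) [set w | B (w.1.1, (w.1.2, w.2))].
Proof.
move=> mB; set B' := [set w | _].
have mB' : measurable B'.
  rewrite -[B']setTI; apply: (_ : measurable_fun setT
    (fun w : T1 * T2 * T3 => (w.1.1, (w.1.2, w.2)))) => //.
  apply/measurable_fun_pairP; split => /=.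
    exact: (measurableT_comp measurable_fst measurable_fst).
  apply/measurable_fun_pairP; split; last exact: measurable_snd.
  exact: (measurableT_comp measurable_snd measurable_fst).
transitivity (\int[P1 \x P2]_z (P3 \o xsection B') z); last by [].
have mf := measurable_fun_xsection P3 mB'.
rewrite (@fubini_tonelli1 _ _ T1 T2 R P1 P2 _ mf (fun z => measure_ge0 P3 _)).
apply: eq_integral => x _; rewrite /fubini_F /=.
apply: eq_integral => y _ /=; congr (P3 _).
by apply/seteqP; split => z; rewrite !xsectionE.
Qed.

End fubini_slices.

Lemma prod_probability_eq2 (R : realType) d1 d2 d3 (T1 : measurableType d1)
  (T2 : measurableType d2) (T3 : measurableType d3)
  (P1 : probability T1 R) (P2 : probability T2 R) (P3 : probability T3 R)
  (A : set (T1 * T3)) (B : set (T2 * T3)) : measurable A -> measurable B ->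
  (forall y, P1 (ysection A y) = P2 (ysection B y)) ->
  (P1 \x P3)%E A = (P2 \x P3)%E B.
Proof.
move=> mA mB E; rewrite !prod_probability_swap//.
by apply: eq_integral => x _; exact: E.
Qed.

(** * The Gaussian measure of the plane *)

Section affine_substitution.
Variable R : realType.
Local Notation mu := (@lebesgue_measure R).
Local Open Scope ereal_scope.

Lemma affine_preimage_itv (a b x y : R) : a != 0%R ->
  mu ((fun z : R => a * z + b)%R @^-1` `]x, y]%classic) =
  (`|a|^-1)%:E * mu `]x, y]%classic.
Proof.
move=> a0.
have key (u v : R) : (u < v)%R = (x < y)%R -> (v - u = (y - x) / `|a|)%R ->
    forall l r, mu [set` Interval (BSide l u) (BSide r v)] =
    (`|a|^-1)%:E * mu `]x, y]%classic.
  move=> uv E l r; rewrite !lebesgue_measure_itv/= !lte_fin uv.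
  by case: ifP => _; [rewrite -!EFinB E -EFinM mulrC|rewrite mule0].
have aux z : (a * ((z - b) / a) + b)%R = z by rewrite mulrC divfK// subrK.
have [a_lt0|a_gt0|/eqP] := ltgtP a 0%R; last by rewrite (negPf a0).
- rewrite (_ : _ @^-1` _ = [set` `[((y - b) / a)%R, ((x - b) / a)%R[%R]).
    apply: key; first by rewrite ltr_nM2r ?invr_lt0// ltrD2r.
    by rewrite -mulrBl ltr0_norm// invrN mulrN -mulNr; congr (_ * _)%R; ring.
  apply/funext => z; apply/propext; rewrite /= !in_itv/=.
  rewrite -{1}(aux x) -{1}(aux y) ltrD2r lerD2r.
  by rewrite ltr_nM2l// ler_nM2l// andbC.
- rewrite (_ : _ @^-1` _ = [set` `]((x - b) / a)%R, ((y - b) / a)%R]%R]).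
    apply: key; first by rewrite ltr_pM2r ?invr_gt0// ltrD2r.
    by rewrite -mulrBl gtr0_norm//; congr (_ * _)%R; ring.
  apply/funext => z; apply/propext; rewrite /= !in_itv/=.
  rewrite -{1}(aux x) -{1}(aux y) ltrD2r lerD2r.
  by rewrite ltr_pM2l// ler_pM2l.
Qed.

(** Lebesgue measure is characterised by its values on the intervals ]u, v], and
    [`|a|] times its image under the affine map has these values. *)
Lemma ge0_integral_affine (a b : R) (f : R -> \bar R) : a != 0%R ->
  measurable_fun [set: R] f -> (forall x, 0 <= f x) ->
  \int[mu]_x f (a * x + b)%R = (`|a|^-1)%:E * \int[mu]_x f x.
Proof.
move=> a0 mf f0.
pose aff : measurableTypeR R -> measurableTypeR R := (fun z => a * z + b)%R.
have maff : measurable_fun setT aff.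
  by apply: measurable_funD => //; exact: measurable_funM.
have na0 : (0 <= `|a|)%R by [].
pose k := NngNum na0.
pose m0 := mscale k (pushforward mu aff).
pose m1 := m0 maff.
have E (A : set R) : measurable A -> A `<=` setT -> mu A = m1 A.
  move=> mA _; apply: lebesgue_measure_unique => // _ [[u v]] _ <-.
  transitivity (`|a|%:E * mu ((fun z : R => a * z + b)%R @^-1` `]u, v]%classic)) => //.
  rewrite affine_preimage_itv// muleA -EFinM.
  by rewrite divff ?normr_eq0// mul1e.
rewrite [in RHS](eq_measure_integral m1 E) ge0_integral_mscale//.
rewrite muleA -EFinM mulVf ?normr_eq0// mul1e; apply/esym.
exact: (ge0_integral_pushforward maff lebesgue_measure measurableT mf (fun x _ => f0 x)).
Qed.

(** Both functions have the normal law as indefinite integral. *)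
Lemma normal_density_ae (m s : R) :
  ae_eq mu setT (Radon_Nikodym (charge_of_finite_measure (normal_prob m s)) mu) (fun x => (normal_pdf m s x)%:E).
Proof.
have dom := normal_prob_dominates m s.
apply: integral_ae_eq => //.
- exact: Radon_Nikodym_integrable.
- by apply/measurable_EFinP; exact: measurable_normal_pdf.
- by move=> A _ mA; rewrite -Radon_Nikodym_integral.
Qed.

Lemma integral_normal_density (m s : R) (f : R -> \bar R) :
  (normal_prob m s).-integrable setT f ->
  \int[normal_prob m s]_x f x = \int[mu]_x (f x * (normal_pdf m s x)%:E).
Proof.
move=> intf; have mf := measurable_int _ intf.
have dom := normal_prob_dominates m s.
rewrite -(Radon_Nikodym_change_of_variables dom measurableT intf).
apply: ae_eq_integral => //; last exact/ae_eqe_mul2l/normal_density_ae.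
- by apply: emeasurable_funM => //; exact/measurable_int/Radon_Nikodym_integrable.
- by apply: emeasurable_funM => //; apply/measurable_EFinP; exact: measurable_normal_pdf.
Qed.

(** If [c != 0], Tonelli's theorem allows the substitution u = c x + s y in the
    first variable and then an affine one in the second, whose Jacobians
    cancel; if [c = 0], the reflection exchanges the axes up to signs. *)
Lemma ge0_integral_reflection (c s : R) (F : R * R -> \bar R) :
  (c ^+ 2 + s ^+ 2 = 1)%R -> measurable_fun setT F -> (forall z, 0 <= F z) ->
  \int[mu]_x \int[mu]_y F (c * x + s * y, s * x - c * y)%R =
  \int[mu]_x \int[mu]_y F (x, y).
Proof.
move=> cs mF F0.
have mF1 x : measurable_fun setT (fun y => F (x, y)) by exact: measurableT_comp.
have mF2 y : measurable_fun setT (fun x => F (x, y)) by exact: measurableT_comp.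
have mL (a b a' b' : R) : measurable_fun setT
    (fun z : R * R => (a * z.1 + b * z.2, a' * z.1 + b' * z.2)%R).
  by apply/measurable_fun_pairP; split=> /=; apply: measurable_funD; apply: measurable_funM.
have mG (a b a' b' : R) : measurable_fun setT
    (fun z : R * R => F (a * z.1 + b * z.2, a' * z.1 + b' * z.2)%R).
  by apply: (measurableT_comp mF); exact: mL.
pose G (z : R * R) := F (c * z.1 + s * z.2, s * z.1 - c * z.2)%R.
have mGG : measurable_fun setT G.
  by have := mG c s s (- c)%R; apply: eq_measurable_fun => z _; rewrite /G mulNr.
transitivity (\int[mu]_y \int[mu]_x G (x, y)).
  exact: (@fubini_tonelli _ _ (measurableTypeR R) (measurableTypeR R) R mu mu G mGG (fun z => F0 _)).
(* In terms of u = c x + s y the second coordinate s x - c y of the reflected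
   point is (s u - y) / c, because c^2 + s^2 = 1. *)
pose H (z : R * R) := F (z.1, (s * z.1 - z.2) / c)%R.
have mH : measurable_fun setT H.
  have := mG 1%R 0%R (s / c)%R (- c^-1)%R; apply: eq_measurable_fun => z _.
  by rewrite /H mul1r mul0r addr0 mulNr; congr (F (_, _)); rewrite mulrBl; congr (_ - _)%R; ring.
have [c0|c0] := eqVneq c 0%R.
  have s0 : s != 0%R by apply: contra_eq_neq cs => ->; rewrite c0 !expr0n addr0 eq_sym oner_eq0.
  have s1 : (`|s|^-1 = 1)%R.
    have : (`|s| ^+ 2 = 1)%R by rewrite -normrX -cs c0 expr0n add0r ger0_norm// sqr_ge0.
    by move/eqP; rewrite sqrp_eq1// => /eqP ->; rewrite invr1.
  under eq_integral => y _.
    rewrite (_ : (fun x => G (x, y)) = (fun x => F (s * y, s * x + 0))%R); last first.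
      by apply/funext => x; rewrite /G c0; congr (F (_, _)) => /=; ring.
    rewrite (@ge0_integral_affine s 0 (fun x => F (s * y, x))%R)// s1 mul1e.
    over.
  have E := @ge0_integral_affine s 0%R (fun u => \int[mu]_x F (u, x)) s0
    (@measurable_fun_fubini_tonelli_F _ _ (measurableTypeR R) (measurableTypeR R) R mu F mF F0)
    (fun x => integral_ge0 _ (fun y _ => F0 _)).
  rewrite s1 mul1e in E; rewrite -E.
  by apply: eq_integral => y _; rewrite addr0.
under eq_integral => y _.
  rewrite (_ : (fun x => G (x, y)) = (fun x => F (c * x + s * y, (s * (c * x + s * y) - y) / c))%R); last first.
    apply/funext => x; rewrite /G /=; congr (F (_, _)).
    apply: (mulIf c0); rewrite divfK//.
    by rewrite -[X in _ = (_ - X)%R]mul1r -cs; ring.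
  rewrite (@ge0_integral_affine c (s * y) (fun u => F (u, (s * u - y) / c))%R)//; last first.
    exact: (measurableT_comp mH (measurable_pair2 y)).
  over.
rewrite ge0_integralZl//=; first last.
- by move=> y _; exact: integral_ge0.
- exact: (@measurable_fun_fubini_tonelli_G _ _ (measurableTypeR R) (measurableTypeR R) R mu H mH (fun z => F0 _)).
rewrite -(@fubini_tonelli _ _ (measurableTypeR R) (measurableTypeR R) R mu mu H mH (fun z => F0 _)).
transitivity (\int[mu]_x ((`|c|^-1)%:E * \int[mu]_y H (x, y))).
  rewrite ge0_integralZl//=.
    exact: (@measurable_fun_fubini_tonelli_F _ _ (measurableTypeR R) (measurableTypeR R) R mu H mH (fun z => F0 _)).
  by move=> y _; apply: integral_ge0 => x _; exact: F0.
apply: eq_integral => x _.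
have c1 : (- c^-1)%R != 0%R by rewrite oppr_eq0 invr_eq0.
have := @ge0_integral_affine (- c^-1)%R (s * x / c)%R (fun v => F (x, v)) c1 (mF1 x) (fun v => F0 _).
rewrite normrN normfV invrK => E.
transitivity (`|c|^-1%:E * (`|c|%:E * \int[mu]_y F (x, y))).
  rewrite -E; congr (_ * _); apply: eq_integral => y _; rewrite /H/=.
  by congr (F (_, _)); field.
by rewrite muleA -EFinM mulVf ?normr_eq0// mul1e.
Qed.
End affine_substitution.

Section normal_reflection.
Variable R : realType.
Local Notation mu := (@lebesgue_measure R).
Local Notation nu := (@normal_prob R 0%R 1%R).
Local Notation phi := (@normal_pdf R 0%R 1%R).
Local Open Scope ereal_scope.

Lemma normal_prod_density (A : set (R * R)) : measurable A ->
  (nu \x nu) A = \int[mu]_x \int[mu]_y (\1_A (x, y) * (phi x * phi y))%:E.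
Proof.
move=> mA.
have mphi : measurable_fun [set: R] phi by exact: measurable_normal_pdf.
have mnu : measurable_fun setT (nu \o xsection A) by exact: measurable_fun_xsection.
have inu : nu.-integrable setT (nu \o xsection A).
  apply/integrableP; split=> //; apply: (@le_lt_trans _ _ (\int[nu]_x cst 1 x)).
    apply: ge0_le_integral => //=; first exact: measurableT_comp.
    move=> x _; rewrite gee0_abs//; apply: probability_le1.
    exact: measurable_xsection.
  by rewrite integral_cst//= mul1e probability_setT ltry.
rewrite /product_measure1 (integral_normal_density inu).
apply: eq_integral => x _ /=.
rewrite {1}/normal_prob integral_mkcond/= -ge0_integralZr//=; first last.
- by rewrite lee_fin normal_pdf_ge0.
- by move=> y _; rewrite patchE; case: ifP => // _; rewrite lee_fin normal_pdf_ge0.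
- apply/(measurable_restrictT _ _).1; first exact: measurable_xsection.
  by apply/measurable_EFinP; exact: measurable_funTS.
apply: eq_integral => y _; rewrite patchE mem_xsection indicE.
by case: ifP => _; rewrite ?mul0e ?mul0r// mul1r mulrC.
Qed.

(** The product density only depends on x^2 + y^2. *)
Lemma normal_pdf_reflection (c s x y : R) : (c ^+ 2 + s ^+ 2 = 1)%R ->
  (phi (c * x + s * y) * phi (s * x - c * y) = phi x * phi y)%R.
Proof.
move=> cs; rewrite normal_pdfE ?oner_eq0// /normal_fun !subr0.
rewrite [LHS]mulrACA [RHS]mulrACA; congr (_ * _)%R; rewrite -!expRD; congr expR.
rewrite -!mulrDl; congr (_ / _)%R.
rewrite -[X in (_ = - X - _)%R]mul1r -[X in (_ = _ - X)%R]mul1r -cs; ring.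
Qed.

(** The substitution of [ge0_integral_reflection] leaves the density unchanged. *)
Lemma normal_prod_reflection (c s : R) (A : set (R * R)) :
  (c ^+ 2 + s ^+ 2 = 1)%R -> measurable A ->
  (nu \x nu) ((fun z => (c * z.1 + s * z.2, s * z.1 - c * z.2))%R @^-1` A) =
  (nu \x nu) A.
Proof.
move=> cs mA.
pose rho (z : R * R) := (c * z.1 + s * z.2, s * z.1 - c * z.2)%R.
have mrho : measurable_fun setT rho.
  apply/measurable_fun_pairP; split => /=.
    by apply: measurable_funD; apply: measurable_funM.
  by apply: measurable_funB; apply: measurable_funM.
have mphi : measurable_fun [set: R] phi by exact: measurable_normal_pdf.
have mA' : measurable (rho @^-1` A) by rewrite -[X in measurable X]setTI; exact: mrho.
rewrite (normal_prod_density mA') (normal_prod_density mA).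
rewrite -[RHS](ge0_integral_reflection cs (F := fun z => (\1_A z * (phi z.1 * phi z.2))%:E)).
- apply: eq_integral => x _; apply: eq_integral => y _ /=.
  by rewrite normal_pdf_reflection// !indicE mem_preimage.
- apply/measurable_EFinP; apply: measurable_funM => //.
  by apply: measurable_funM; exact: measurableT_comp.
- by move=> z; rewrite lee_fin !mulr_ge0// normal_pdf_ge0.
Qed.

(** The reflection with c = 1 and s = 0 changes the sign of the second
    coordinate. *)
Lemma normal_prob_opp (A : set R) : measurable A ->
  nu [set x | A (- x)%R] = nu A.
Proof.
move=> mA.
have mNA : measurable [set x : R | A (- x)%R].
  by rewrite -[X in measurable X]setTI; exact: (measurableT_comp (@oppr_measurable R setT) (@measurable_id _ R setT)).
have cs : (1 ^+ 2 + 0 ^+ 2 = 1 :> R)%R by rewrite expr1n expr0n addr0.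
have := normal_prod_reflection cs (measurableX (measurableT : measurable [set: R]) mA).
rewrite (_ : _ @^-1` _ = [set: R] `*` [set x | A (- x)%R]).
  have nuT : nu [set: R] = 1 by exact: probability_setT.
  have pE B : measurable B -> (nu \x nu) ([set: R] `*` B) = nu B.
    move=> mB; transitivity (nu [set: R] * nu B); first exact: product_measure1E.
    by rewrite nuT mul1e.
  by rewrite !pE.
by apply/seteqP; split=> -[x y] /=; rewrite mul0r mul1r sub0r => -[].
Qed.

End normal_reflection.

(** * Standard Gaussian families and orthogonal matrices *)

(** Families with their product sigma-algebra as a measurable type, so that maps
    between families fall under the general theory of measurable functions. *)
Definition family_space (S : pointedType) (F : set (set S)) (I : finType) :=
  g_sigma_algebraType [set A | exists (i : I) B,
    [/\ [set: I] i, F B & A = (fun f : I -> S => f i) @^-1` B]].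
HB.instance Definition _ (S : pointedType) (F : set (set S)) (I : finType) :=
  Measurable.on (family_space F I).

Section standard_normal_families.
Variable R : realType.

Definition rfamily (I : finType) := family_space (@measurable _ R) I.
HB.instance Definition _ (I : finType) := Measurable.on (rfamily I).

Lemma measurable_coord (I : finType) (i : I) :
  measurable_fun [set: rfamily I] (fun f => f i : R).
Proof.
by move=> _ B mB; rewrite setTI; apply: sub_sigma_algebra; exists i, B.
Qed.

Definition std_normal_family d (T : measurableType d) (P : probability T R)
  (I : finType) (X : T -> I -> R) : Prop :=
  has_product_law measurable P (fun=> normal_prob 0 1) X.

Lemma std_normal_unique d d' (T : measurableType d) (T' : measurableType d')
  (P : probability T R) (P' : probability T' R) (I : finType)
  (X : T -> I -> R) (X' : T' -> I -> R) :
  std_normal_family P X -> std_normal_family P' X' ->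
  same_law P P' (@family_sigma R measurable I) X X'.
Proof. by apply: product_law_unique; exact: sigma_algebra_measurable. Qed.

Lemma family_map_measurable (I J : finType) (g : (I -> R) -> (J -> R)) :
  (forall j, measurable_fun [set: rfamily I] (fun f => g f j)) ->
  forall B, @family_sigma R measurable J B ->
  @family_sigma R measurable I (g @^-1` B).
Proof.
move=> mg; apply: (random_element_initial (T := rfamily I) _ _ _ g).2 => j _ B mB.
by rewrite -[X in measurable X]setTI; exact: mg.
Qed.

Lemma std_normal_sub d (T : measurableType d) (P : probability T R)
  (I J : finType) (h : J -> I) (X : T -> I -> R) : injective h ->
  std_normal_family P X -> std_normal_family P (fun w j => X w (h j)).
Proof.
move=> ih; apply: (product_law_sub (sigma_algebra_measurable _) ih) => _.
exact: probability_setT.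
Qed.

Lemma std_normal_mix d d' (T : measurableType d) (T' : measurableType d')
  (P : probability T R) (P' : probability T' R) (I : finType) (E : pred I)
  (X : T -> I -> R) (X' : T' -> I -> R) :
  std_normal_family P X -> std_normal_family P' X' ->
  std_normal_family (P \x P')%E (fun w i => if E i then X w.1 i else X' w.2 i).
Proof.
apply: (product_law_mix (sigma_algebra_measurable _)) => _.
exact: probability_setT.
Qed.

Lemma std_normal_opp d (T : measurableType d) (P : probability T R)
  (I : finType) (a : I) (X : T -> I -> R) : std_normal_family P X ->
  std_normal_family P (fun w i => if i == a then - X w i else X w i).
Proof.
move=> [mX PX]; split.
  move=> i; case: (i == a) => // B mB.
  have mNB : measurable [set x : R | B (- x)].
    by rewrite -[X in measurable X]setTI; exact: (@oppr_measurable R setT measurableT _ mB).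
  exact: (mX i _ mNB).
move=> B mB.
pose B' i := if i == a then [set x | B i (- x)] else B i.
have mB' i : measurable (B' i).
  rewrite /B'; case: ifP => _; last exact: mB.
  by rewrite -[X in measurable X]setTI; exact: (@oppr_measurable R setT measurableT _ (mB _)).
transitivity (P [set w | forall i, B' i (X w i)]).
  by congr (P _); apply/seteqP; split=> w /= h i; have := h i; rewrite /B'; case: ifP.
rewrite PX//; apply: eq_bigr => i _; rewrite /B'; case: ifP => // _.
by apply: normal_prob_opp; exact: mB.
Qed.

(** The coordinates [a] and [b] can be realised on a separate plane, where a map
    preserving the Gaussian measure acts on these two coordinates only. *)
Lemma std_normal_pair d (T : measurableType d) (P : probability T R)
  (I : finType) (a b : I) (rho : R * R -> R * R) (X : T -> I -> R) : a != b ->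
  measurable_fun setT rho ->
  (forall A, measurable A -> (normal_prob 0 1 \x normal_prob 0 1)%E (rho @^-1` A) =
    (normal_prob 0 1 \x normal_prob 0 1)%E A) ->
  std_normal_family P X ->
  std_normal_family (P \x (normal_prob 0 1 \x normal_prob 0 1))%E
    (fun z i => if (i != a) && (i != b) then X z.1 i else
                if i == a then (rho z.2).1 else (rho z.2).2).
Proof.
move=> ab mrho rhoE nX.
pose E i := (i != a) && (i != b).
pose Z (z : R * R) i : R := if i == a then (rho z).1 else (rho z).2.
apply: (product_law_replace (sigma_algebra_measurable _) (E := E)
  (P' := (normal_prob 0 1 \x normal_prob 0 1)%E) (Z := Z) _ nX).
- by move=> _; exact: probability_setT.
- move=> i _ B mB; rewrite /Z -[X in measurable X]setTI; case: (i == a).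
    by apply: (measurableT_comp measurable_fst mrho).
  by apply: (measurableT_comp measurable_snd mrho).
move=> B mB.
transitivity ((normal_prob 0 1 \x normal_prob 0 1)%E (rho @^-1` (B a `*` B b))).
  congr (_ _); apply/seteqP; split=> z /=.
    move=> h; split; first by have := h a; rewrite /E /Z eqxx; exact.
    by have := h b; rewrite /E /Z eqxx andbF eq_sym (negPf ab); exact.
  move=> [Ba Bb] i; rewrite /E /Z negb_and !negbK => /orP[/eqP ->|/eqP ->].
    by rewrite eqxx.
  by rewrite eq_sym (negPf ab).
rewrite rhoE; last by apply: measurableX; exact: mB.
transitivity (normal_prob 0 1 (B a) * normal_prob 0 1 (B b))%E.
  by apply: product_measure1E; exact: mB.
rewrite (bigD1 a)/=; last by rewrite /E eqxx.
rewrite (big_pred1 b)// => i /=; rewrite /E negb_and !negbK.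
by case: (eqVneq i a) => [->|]; rewrite ?(negPf ab)//= andbT.
Qed.

(** Realising the coordinates [a] and [b] on a separate plane gives a family
    with the law of [X]; the reflection acts there on the plane alone and
    preserves its measure. *)
Lemma std_normal_reflection d (T : measurableType d) (P : probability T R)
  (I : finType) (a b : I) (c s : R) (X : T -> I -> R) : a != b ->
  c ^+ 2 + s ^+ 2 = 1 -> std_normal_family P X ->
  std_normal_family P (fun w i =>
    if i == a then c * X w a + s * X w b else
    if i == b then s * X w a - c * X w b else X w i).
Proof.
move=> ab cs nX.
pose rho (z : R * R) := (c * z.1 + s * z.2, s * z.1 - c * z.2)%R.
have mrho : measurable_fun setT rho.
  apply/measurable_fun_pairP; split => /=.
    by apply: measurable_funD; apply: measurable_funM.
  by apply: measurable_funB; apply: measurable_funM.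
pose g (f : I -> R) i := if i == a then c * f a + s * f b else
    if i == b then s * f a - c * f b else f i.
have mg i : measurable_fun [set: rfamily I] (fun f => g f i).
  have m := @measurable_coord I; rewrite /g.
  case: (i == a); first by apply: measurable_funD; apply: measurable_funM.
  by case: (i == b); first by apply: measurable_funB; apply: measurable_funM.
have n1 := std_normal_pair ab (@measurable_id _ _ _) (fun _ _ => erefl) nX.
have n2 := std_normal_pair ab mrho (fun A mA => normal_prod_reflection cs mA) nX.
have L := same_law_comp (std_normal_unique nX n1) (family_map_measurable mg).
apply: product_law_transfer n2.
rewrite (_ : (fun z i => _) = g \o (fun (z : T * (R * R)) i => if (i != a) && (i != b) then X z.1 i
                else if i == a then z.2.1 else z.2.2)) //.
apply/funext => z; apply/funext => i; rewrite /g /rho/= !eqxx andbF/=.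
have /negPf -> : b != a by rewrite eq_sym.
by case: (i == a); case: (i == b).
Qed.

End standard_normal_families.

Section orthogonal_group.
Variables (R : realType) (m : nat).
Implicit Types M : 'M[R]_m.

(** Reflections rather than rotations: being symmetric involutions, they allow
    the factorisation M = (M S) S without inverses or transposes. *)
Definition reflmx (a b : 'I_m) (c s : R) : 'M[R]_m :=
  \matrix_(i, j) if j == a then c *+ (i == a) + s *+ (i == b) else
                 if j == b then s *+ (i == a) - c *+ (i == b) else (i == j)%:R.

Definition flipmx (a : 'I_m) : 'M[R]_m :=
  \matrix_(i, j) if j == a then - (i == j)%:R else (i == j)%:R.

Lemma sum_reflmx (a b : 'I_m) (c s : R) (g : 'I_m -> R) j :
  \sum_l g l * reflmx a b c s l j =
  if j == a then c * g a + s * g b else if j == b then s * g a - c * g b else g j.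
Proof.
have S (u : R) i : \sum_l g l * (u *+ (l == i)) = u * g i.
  rewrite (bigD1 i)//= eqxx mulr1n big1 ?addr0 1?mulrC// => l /negPf ->.
  by rewrite mulr0n mulr0.
under eq_bigr do rewrite mxE.
case: (j == a).
  by under eq_bigr do rewrite mulrDr; rewrite big_split/= !S.
case: (j == b).
  by under eq_bigr do rewrite mulrBr; rewrite sumrB !S.
by rewrite S mul1r.
Qed.

Lemma reflmx_sym a b c s : a != b -> (reflmx a b c s)^T = reflmx a b c s.
Proof.
move=> ab; have /negPf ba : b != a by rewrite eq_sym.
apply/matrixP => i j; rewrite !mxE.
case: (eqVneq i a) => [->|ia]; case: (eqVneq j a) => [->|ja];
  rewrite ?eqxx ?(negPf ab) ?ba ?(negPf ia) ?(negPf ja) //=.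
- by case: (j == b); rewrite ?mulr0n ?mulr1n ?addr0 ?add0r ?subr0.
- by rewrite [a == i]eq_sym (negPf ia); case: (i == b); rewrite ?mulr0n ?mulr1n ?addr0 ?add0r ?subr0.
- case: (eqVneq i b) => ib; case: (eqVneq j b) => jb; rewrite ?mulr0n ?mulr1n ?subrr ?subr0//.
  + by rewrite ib eq_sym (negPf jb).
  + by rewrite jb eq_sym (negPf ib).
  + by rewrite eq_sym.
Qed.

Lemma reflmxK a b c s : a != b -> c ^+ 2 + s ^+ 2 = 1 ->
  reflmx a b c s *m reflmx a b c s = 1%:M.
Proof.
move=> ab cs; have /negPf ba : b != a by rewrite eq_sym.
apply/matrixP => i j; rewrite mxE sum_reflmx !mxE.
rewrite !eqxx ba.
case: (eqVneq j a) => [->|ja].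
  case: (eqVneq i a) => [->|ia]; rewrite ?(negPf ab) /=.
    by rewrite -cs !expr2 !mulr0n !mulr1n; ring.
  by case: (eqVneq i b) => _; rewrite ?mulr0n ?mulr1n; ring.
case: (eqVneq j b) => [->|jb].
  case: (eqVneq i a) => [->|ia]; rewrite ?(negPf ab) /=.
    by rewrite ?mulr0n ?mulr1n; ring.
  by case: (eqVneq i b) => _; rewrite ?mulr0n ?mulr1n -?cs; ring.
by [].
Qed.

Lemma flipmx_sym a : (flipmx a)^T = flipmx a.
Proof.
apply/matrixP => i j; rewrite !mxE [j == i]eq_sym.
by case: (eqVneq i j) => [->//|]; rewrite oppr0 !if_same.
Qed.

Lemma sum_flipmx a (g : 'I_m -> R) j :
  \sum_l g l * flipmx a l j = if j == a then - g j else g j.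
Proof.
rewrite (bigD1 j)//= big1 ?addr0; first by rewrite mxE eqxx; case: ifP => _; rewrite ?mulrN mulr1.
by move=> l /negPf lj; rewrite mxE lj oppr0 if_same mulr0.
Qed.

Lemma flipmxK a : flipmx a *m flipmx a = 1%:M.
Proof.
apply/matrixP => i j; rewrite mxE sum_flipmx !mxE.
by case: (j == a); rewrite ?opprK.
Qed.

Definition normal_invariant M := forall d (T : measurableType d)
  (P : probability T R) (X : T -> 'I_m -> R), std_normal_family P X ->
  std_normal_family P (fun w i => \sum_j M i j * X w j).

Lemma normal_invariant1 : normal_invariant 1%:M.
Proof.
move=> d T P X; congr (std_normal_family P _); apply/funext => w; apply/funext => i.
by rewrite (bigD1 i)//= big1 ?addr0 ?mxE ?eqxx ?mul1r// => j /negPf; rewrite mxE eq_sym => ->; rewrite mul0r.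
Qed.

Lemma normal_invariantM M M' :
  normal_invariant M -> normal_invariant M' -> normal_invariant (M *m M').
Proof.
move=> h h' d T P X /h' /h; congr (std_normal_family P _).
apply/funext => w; apply/funext => i.
under eq_bigr do rewrite mulr_sumr.
rewrite exchange_big; apply: eq_bigr => j _; rewrite mxE mulr_suml.
by apply: eq_bigr => l _; rewrite mulrA.
Qed.

Lemma normal_invariant_refl a b c s : a != b -> c ^+ 2 + s ^+ 2 = 1 ->
  normal_invariant (reflmx a b c s).
Proof.
move=> ab cs d T P X nX.
have := std_normal_reflection ab cs nX; congr (std_normal_family P _).
apply/funext => w; apply/funext => i; rewrite -sum_reflmx.
by apply: eq_bigr => j _; rewrite mulrC -[in RHS](reflmx_sym c s ab) [in RHS]mxE.
Qed.

Lemma normal_invariant_flip a : normal_invariant (flipmx a).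
Proof.
move=> d T P X nX.
have := std_normal_opp a nX; congr (std_normal_family P _).
apply/funext => w; apply/funext => i; rewrite -sum_flipmx.
by apply: eq_bigr => j _; rewrite mulrC -[in RHS]flipmx_sym [in RHS]mxE.
Qed.

Lemma orthogonal_mul_sym M S : M *m M^T = 1%:M -> S^T = S -> S *m S = 1%:M ->
  (M *m S) *m (M *m S)^T = 1%:M.
Proof. by move=> MM tS SS; rewrite trmx_mul tS -mulmxA (mulmxA S) SS mul1mx. Qed.

Lemma row_norm M k : M *m M^T = 1%:M -> \sum_j M k j ^+ 2 = 1.
Proof.
move/matrixP/(_ k k); rewrite !mxE eqxx => E.
transitivity (\sum_j M k j * M^T j k); last exact: E.
by apply: eq_bigr => j _; rewrite mxE.
Qed.

(** An orthogonal matrix is a product of plane reflections and sign changes: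
    multiplying it on the right by such matrices turns its rows, one after the
    other, into those of the identity. *)
Lemma orthogonal_normal_invariant M : M *m M^T = 1%:M -> normal_invariant M.
Proof.
(* The first [k] rows are those of the identity. *)
pose std k M := forall i j : 'I_m, (i < k)%N -> M i j = (i == j)%:R.
suff main k : (k <= m)%N -> forall M, M *m M^T = 1%:M -> std (m - k)%N M ->
    normal_invariant M.
  by move=> MM; apply: (main m) => //; rewrite subnn.
elim: k => [_ {}M MM|k IH km].
  rewrite subn0 => stdM; rewrite (_ : M = 1%:M); first exact: normal_invariant1.
  by apply/matrixP => i j; rewrite mxE stdM.
have lt_k : (m - k.+1 < m)%N by rewrite ltn_subrL (leq_ltn_trans _ km).
have sk : (m - k.+1).+1 = (m - k)%N by rewrite -subSn// subSS.
set r := (m - k.+1)%N in lt_k sk *; pose a : 'I_m := Ordinal lt_k.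
(* Row [a] is cleared from the right: its entries in the columns from [t] on
   beyond [a] vanish already. *)
suff sub t : (t <= m)%N -> forall M, M *m M^T = 1%:M -> std r M ->
    (forall j : 'I_m, (r < j)%N -> (t <= j)%N -> M a j = 0) -> normal_invariant M.
  move=> {}M MM stdM; apply: (sub m) => // j _; by rewrite leqNgt ltn_ord.
have col0 (M0 : 'M[R]_m) : M0 *m M0^T = 1%:M -> std r M0 -> forall i : 'I_m, (i < r)%N -> M0 a i = 0.
  move=> MM stdM i ir; have /matrixP/(_ a i) := MM; rewrite !mxE (bigD1 i)//=.
  rewrite mxE (stdM i i ir) eqxx mulr1 big1 ?addr0 => [->|j /negPf ji].
    by case: eqP => // ai; rewrite -ai ltnn in ir.
  by rewrite mxE (stdM i j ir) eq_sym ji mulr0.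
have base (M0 : 'M[R]_m) : M0 *m M0^T = 1%:M -> std r M0 -> M0 a a = 1 -> 
    (forall j : 'I_m, (r < j)%N -> M0 a j = 0) -> normal_invariant M0.
  move=> MM stdM Maa Ma0; apply: (IH (ltnW km)) => // i j.
  rewrite -sk ltnS leq_eqVlt => /orP[/eqP ir|]; last exact: stdM.
  have -> : i = a by exact: val_inj.
  have [ja|ja|/val_inj ->] := ltngtP j a; last by rewrite Maa eqxx.
    by rewrite (col0 M0 MM stdM j ja) -val_eqE/= gtn_eqF.
  by rewrite (Ma0 j ja) -val_eqE/= ltn_eqF.
elim: t => [_|t IHt tm] {}M MM stdM Ma0.
  have Ma j : j != a -> M a j = 0.
    rewrite -val_eqE /= neq_ltn => /orP[ja|ja]; first exact: col0.
    exact: Ma0.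
  (* Once the row is diagonal, orthogonality leaves only a sign to correct. *)
  have : M a a ^+ 2 = 1.
    by rewrite -(row_norm a MM) (bigD1 a)//= big1 ?addr0// => j /Ma ->; rewrite expr0n.
  move/eqP; rewrite sqrf_eq1 => /orP[/eqP Maa|/eqP Maa].
    by apply: base => // j rj; apply: Ma0.
  have -> : M = (M *m flipmx a) *m flipmx a by rewrite -mulmxA flipmxK mulmx1.
  apply: normal_invariantM; last exact: normal_invariant_flip.
  apply: base.
  - by apply: orthogonal_mul_sym; rewrite ?flipmx_sym ?flipmxK.
  - move=> i j ir; rewrite mxE sum_flipmx stdM//; case: eqP => // ->.
    case: eqP => [ia|_]; last by rewrite oppr0.
    by rewrite ia ltnn in ir.
  - by rewrite mxE sum_flipmx eqxx Maa opprK.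
  - move=> j rj; rewrite mxE sum_flipmx; rewrite Ma0//; case: ifP => // _.
    by rewrite oppr0.
have [rt|tr] := ltnP r t; last first.
  apply: IHt => //; first exact: ltnW.
  move=> j rj tj; apply: Ma0 => //; exact: leq_ltn_trans rj.
pose b := Ordinal tm.
have [Mab|Mab] := eqVneq (M a b) 0.
  apply: IHt => //; first exact: ltnW.
  move=> j rj; rewrite leq_eqVlt => /orP[/eqP tj|]; last exact: Ma0.
  by rewrite (_ : j = b)//; exact: val_inj.
have ab : a != b by rewrite -val_eqE/= ltn_eqF.
(* Applied on the right, the reflection with this cosine and sine sends the
   entries (M a a, M a b) to (q, 0). *)
pose q := Num.sqrt (M a a ^+ 2 + M a b ^+ 2).
have q2 : q ^+ 2 = M a a ^+ 2 + M a b ^+ 2 by rewrite sqr_sqrtr// addr_ge0// sqr_ge0.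
have q0 : q != 0.
  by rewrite -sqrf_eq0 q2 paddr_eq0 ?sqr_ge0// !sqrf_eq0 (negPf Mab) andbF.
have cs : (M a a / q) ^+ 2 + (M a b / q) ^+ 2 = 1.
  by rewrite !expr_div_n -mulrDl -q2 divff// sqrf_eq0.
set S := reflmx a b (M a a / q) (M a b / q).
have -> : M = (M *m S) *m S by rewrite -mulmxA reflmxK// mulmx1.
apply: normal_invariantM; last exact: normal_invariant_refl.
apply: IHt; first exact: ltnW.
- by apply: orthogonal_mul_sym; rewrite ?reflmx_sym ?reflmxK.
- move=> i j ir; rewrite mxE sum_reflmx.
  have ia : i != a by rewrite -val_eqE/= ltn_eqF.
  have ib : i != b by rewrite -val_eqE/= ltn_eqF// (ltn_trans ir).
  rewrite (stdM i a ir) (stdM i b ir) (negPf ia) (negPf ib) !mulr0 addr0 subr0 (stdM i j ir).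
  case: eqP => [->|_]; first by rewrite (negPf ia).
  by case: eqP => [->|_] //; rewrite (negPf ib).
- move=> j rj tj; rewrite mxE sum_reflmx.
  case: eqP => [ja|_]; first by rewrite ja ltnn in rj.
  case: eqP => [_|jb]; first by ring.
  apply: Ma0 => //; rewrite ltn_neqAle tj andbT; apply/eqP => tj'.
  by apply: jb; exact: val_inj.
Qed.
End orthogonal_group.

(** * Measurable complex-valued and matrix-valued maps *)

Section complex_measurability.
Context (R : realType) d (T : measurableType d).
Implicit Types f g : T -> R[i].

Definition cmeasurable f := forall b, measurable_fun setT (fun w => re_im b (f w)).

Lemma cmeasurableP f : random_element (@complex_borel R) f <-> cmeasurable f.
Proof.
split=> [/random_element_initial rf b _ B mB|mf].
  by rewrite setTI; exact: (rf b).
apply/random_element_initial => b _ B mB.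
by rewrite -[X in measurable X]setTI; exact: mf.
Qed.

Lemma cmeasurable_cst (c : R[i]) : cmeasurable (fun=> c).
Proof. by move=> b. Qed.

Lemma cmeasurableD f g : cmeasurable f -> cmeasurable g ->
  cmeasurable (fun w => f w + g w).
Proof.
move=> mf mg b.
have -> : (fun w => re_im b (f w + g w)) = (fun w => re_im b (f w) + re_im b (g w)).
  by apply/funext => w; case: (f w) (g w) b => [? ?] [? ?] [].
exact: measurable_funD.
Qed.

Lemma cmeasurableM f g : cmeasurable f -> cmeasurable g ->
  cmeasurable (fun w => f w * g w).
Proof.
move=> mf mg [].
  have -> : (fun w => re_im true (f w * g w)) =
     (fun w => re_im true (f w) * re_im true (g w) - re_im false (f w) * re_im false (g w)).
    by apply/funext => w; case: (f w) (g w) => [? ?] [? ?].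
  by apply: measurable_funB; apply: measurable_funM.
have -> : (fun w => re_im false (f w * g w)) =
   (fun w => re_im true (f w) * re_im false (g w) + re_im false (f w) * re_im true (g w)).
  by apply/funext => w; case: (f w) (g w) => [? ?] [? ?].
by apply: measurable_funD; apply: measurable_funM.
Qed.

Lemma cmeasurable_conj f : cmeasurable f -> cmeasurable (fun w => Num.conj (f w)).
Proof.
move=> mf [].
  have -> : (fun w => re_im true (Num.conj (f w))) = (fun w => re_im true (f w)).
    by apply/funext => w; case: (f w).
  exact: mf.
have -> : (fun w => re_im false (Num.conj (f w))) = (fun w => - re_im false (f w)).
  by apply/funext => w; case: (f w).
by apply: measurableT_comp => //; exact: mf.
Qed.

Lemma cmeasurable_sum (I : Type) (r : seq I) (Q : pred I) (F : I -> T -> R[i]) :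
  (forall i, Q i -> cmeasurable (F i)) -> cmeasurable (fun w => \sum_(i <- r | Q i) F i w).
Proof.
move=> mF; elim: r => [|i r IH].
  by under eq_fun do rewrite big_nil; exact: cmeasurable_cst.
case Qi: (Q i); under eq_fun do rewrite big_cons Qi; last exact: IH.
by apply: cmeasurableD => //; exact: mF.
Qed.

Definition mxmeasurable m n (H : T -> 'M[R[i]]_(m, n)) :=
  forall i j, cmeasurable (fun w => H w i j).

Lemma mxmeasurableP m n (H : T -> 'M[R[i]]_(m, n)) :
  random_element (@mx_borel R m n) H <-> mxmeasurable H.
Proof.
split=> [/random_element_initial rH i j|mH].
  by apply/cmeasurableP; exact: (rH (i, j)).
by apply/random_element_initial => ij _; apply/cmeasurableP; exact: mH.
Qed.

Lemma mxmeasurable_cst m n (A : 'M[R[i]]_(m, n)) : mxmeasurable (fun=> A).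
Proof. by move=> i j; exact: cmeasurable_cst. Qed.

Lemma mxmeasurableD m n (H K : T -> 'M[R[i]]_(m, n)) : mxmeasurable H ->
  mxmeasurable K -> mxmeasurable (fun w => H w + K w).
Proof.
by move=> mH mK i j; under eq_fun do rewrite mxE; apply: cmeasurableD.
Qed.

Lemma mxmeasurableM m n q (H : T -> 'M[R[i]]_(m, n)) (K : T -> 'M[R[i]]_(n, q)) :
  mxmeasurable H -> mxmeasurable K -> mxmeasurable (fun w => H w *m K w).
Proof.
move=> mH mK i j; under eq_fun do rewrite mxE.
by apply: cmeasurable_sum => k _; apply: cmeasurableM.
Qed.

Lemma mxmeasurableZ m n (c : T -> R[i]) (H : T -> 'M[R[i]]_(m, n)) :
  cmeasurable c -> mxmeasurable H -> mxmeasurable (fun w => c w *: H w).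
Proof.
by move=> mc mH i j; under eq_fun do rewrite mxE; apply: cmeasurableM.
Qed.

Lemma mxmeasurable_adj m n (H : T -> 'M[R[i]]_(m, n)) :
  mxmeasurable H -> mxmeasurable (fun w => (H w)^t*).
Proof.
by move=> mH i j; under eq_fun do rewrite !mxE; apply: cmeasurable_conj.
Qed.

End complex_measurability.

HB.instance Definition _ (R : realType) := isPointed.Build R[i] 0.

(** Measurability of a map defined on this space is Borel measurability as a
    function of the matrix, so the lemmas above apply to its identity map. *)
Definition mx_space (R : realType) m n := g_sigma_algebraType
  [set A : set 'M[R[i]]_(m, n) | exists ij B, [/\ [set: 'I_m * 'I_n] ij,
     @complex_borel R B & A = (fun M : 'M[R[i]]_(m, n) => M ij.1 ij.2) @^-1` B]].
HB.instance Definition _ (R : realType) m n := Measurable.on (mx_space R m n).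

Lemma mxmeasurable_id (R : realType) m n :
  mxmeasurable (T := mx_space R m n) (fun H => H : 'M[R[i]]_(m, n)).
Proof. by apply/mxmeasurableP => A. Qed.

Lemma mxmeasurable_comp (R : realType) d d' (T : measurableType d)
  (T' : measurableType d') m n (g : T' -> T) (H : T -> 'M[R[i]]_(m, n)) :
  measurable_fun setT g -> mxmeasurable H -> mxmeasurable (H \o g).
Proof. by move=> mg mH i j b; exact: (measurableT_comp (mH i j b) mg). Qed.

(** * Gaussian matrices in real coordinates *)

Section real_coordinates.
Variable R : realType.
Local Notation nu := (@normal_prob R 0 1).

Lemma normal_pdf_scale (s x : R) : 0 < s ->
  normal_pdf 0 s x = s^-1 * normal_pdf 0 1 (s^-1 * x).
Proof.
move=> s0; rewrite !normal_pdfE ?oner_eq0 ?gt_eqF// /normal_fun !subr0 mulrA.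
congr (_ * _).
  rewrite /normal_peak expr1n mul1r -mulrnAr sqrtrM ?sqr_ge0// sqrtr_sqr gtr0_norm//.
  by rewrite invfM.
by congr expR; field; rewrite gt_eqF.
Qed.

Lemma normal_prob_scale (s : R) (B : set R) : 0 < s -> measurable B ->
  normal_prob 0 s [set x | B (s^-1 * x)] = nu B.
Proof.
move=> s0 mB.
have ms : measurable_fun [set: R] (fun x => s^-1 * x : R) by exact: measurable_funM.
have mB' : measurable [set x : R | B (s^-1 * x)].
  by rewrite -[X in measurable X]setTI; exact: ms.
have si0 : s^-1 != 0 by rewrite invr_eq0 gt_eqF.
have mphi : measurable_fun [set: R] (normal_pdf 0 1 : R -> R) by exact: measurable_normal_pdf.
rewrite /normal_prob integral_mkcond [RHS]integral_mkcond.
have mf : measurable_fun [set: R] (((fun x => (normal_pdf 0 1 x)%:E) \_ B)%E : R -> \bar R).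
  apply/(measurable_restrictT _ _).1 => //.
  by apply/measurable_EFinP; exact: measurable_funTS.
have f0 x : (0 <= ((fun x : R => (normal_pdf 0 1 x)%:E) \_ B)%E x)%E.
  by rewrite patchE; case: ifP => // _; rewrite lee_fin normal_pdf_ge0.
have E := ge0_integral_affine 0 si0 mf f0.
rewrite normfV invrK (gtr0_norm s0) in E.
have -> : (\int[lebesgue_measure]_x ((fun x : R => (normal_pdf 0 1 x)%:E) \_ B) x =
  s^-1%:E * (s%:E * \int[lebesgue_measure]_x ((fun x : R => (normal_pdf 0 1 x)%:E) \_ B) x))%E.
  by rewrite muleA -EFinM mulVf ?gt_eqF// mul1e.
rewrite -E -ge0_integralZl//=; first last.
- by rewrite lee_fin invr_ge0 ltW.
- by apply: (measurableT_comp mf); apply: measurable_funD.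
apply: eq_integral => x _; rewrite !patchE addr0.
have -> : (x \in [set x | B (s^-1 * x)]) = ((s^-1 * x) \in B).
  by apply/idP/idP; rewrite !inE.
by case: ifP => _; rewrite ?mule0// normal_pdf_scale// EFinM.
Qed.

Section one_variable.
Context d (T : measurableType d) (P : probability T R).

(** The real and imaginary parts have variance 1/2, whence the factor
    [Num.sqrt 2]. *)
Lemma std_complex_normal_coords (Z : T -> R[i]) : std_complex_normal P Z ->
  forall B B', measurable B -> measurable B' ->
  P [set w | B (Num.sqrt 2 * complex.Re (Z w)) /\ B' (Num.sqrt 2 * complex.Im (Z w))] =
  (nu B * nu B')%E.
Proof.
move=> [indep lawZ] B B' mB mB'.
pose A b := [set x : R | (if b then B else B') (Num.sqrt 2 * x)].
have mA b : measurable (A b).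
  have m : measurable_fun [set: R] (fun x => Num.sqrt 2 * x : R) by exact: measurable_funM.
  by rewrite -[X in measurable X]setTI /A; case: b; apply: m.
have := indep [set: bool]%SET A (fun b _ => mA b).
rewrite (_ : \bigcap_(i in _) _ = [set w | B (Num.sqrt 2 * complex.Re (Z w)) /\ B' (Num.sqrt 2 * complex.Im (Z w))]); last first.
  apply/seteqP; split => w /=.
    by move=> h; split; [apply: (h true)|apply: (h false)]; rewrite /= inE.
  by move=> [h h'] [] _.
move=> ->; rewrite (eq_bigl predT); last by move=> b; rewrite inE.
rewrite big_bool.
have s2 : Num.sqrt 2 = (Num.sqrt 2^-1)^-1 :> R by rewrite sqrtrV ?invrK.
have s2_gt0 : 0 < Num.sqrt 2^-1 :> R by rewrite sqrtr_gt0 invr_gt0.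
congr (_ * _)%E.
  by have [_ ->] := lawZ true; [rewrite /A s2 (normal_prob_scale s2_gt0 mB)|exact: mA].
by have [_ ->] := lawZ false; [rewrite /A s2 (normal_prob_scale s2_gt0 mB')|exact: mA].
Qed.

(** Each entry [Z u] produces the coordinates [k] with [t k = u]; the product
    over all coordinates splits along the fibres of [t], one factor for each of
    the independent entries. *)
Lemma grouped_std_normal (U K : finType) (t : K -> U) (Z : U -> T -> R[i])
  (c : K -> R[i] -> R) :
  independent P (@complex_borel R) Z ->
  (forall u, random_element (@complex_borel R) (Z u)) ->
  (forall k B, measurable B -> @complex_borel R (c k @^-1` B)) ->
  (forall u (B : K -> set R), (forall k, measurable (B k)) ->
     P [set w | forall k, t k = u -> B k (c k (Z u w))] =
     (\prod_(k | t k == u) nu (B k))%E) ->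
  std_normal_family P (fun w k => c k (Z (t k) w)).
Proof.
move=> indep rZ mc group; split.
  by move=> k B mB; exact: (rZ (t k) _ (mc k B mB)).
move=> B mB.
pose A u := [set z : R[i] | forall k, t k = u -> B k (c k z)].
have mA u : @complex_borel R (A u).
  have -> : A u = \bigcap_(k in [set k | t k = u]) (c k @^-1` B k).
    by apply/seteqP; split=> z h k; exact: h.
  apply: (@fin_bigcap_measurable _ (g_sigma_algebraType [set A : set R[i] | exists b B0,
    [/\ [set: bool] b, measurable B0 & A = re_im b @^-1` B0]])).
    exact: finite_finset.
  by move=> k _; apply: mc; exact: mB.
have := indep [set: U]%SET A (fun u _ => mA u).
rewrite (_ : \bigcap_(i in _) _ = [set w | forall k, B k (c k (Z (t k) w))]); last first.
  apply/seteqP; split => w /=.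
    by move=> h k; apply: (h (t k)) => //=; rewrite inE.
  by move=> h u _ k <-; exact: h.
move=> ->; rewrite (eq_bigl predT); last by move=> b; rewrite inE.
rewrite [RHS](partition_big t predT)//=; apply: eq_bigr => u _.
by rewrite -group.
Qed.

End one_variable.
End real_coordinates.

Lemma hermP (R : realType) n (H : 'M[R[i]]_n) : H \is hermsymmx <-> H^t* = H.
Proof.
split=> [/is_hermitianmxP|] e; first by rewrite [RHS]e expr0 scale1r.
by apply/is_hermitianmxP; rewrite expr0 scale1r e.
Qed.

Lemma conj_rect (R : realType) (a b : R) : Num.conj (a +i* b) = a +i* - b :> R[i].
Proof. by []. Qed.

Section hermitian_coordinates.
Variables (R : realType) (N : nat).
Implicit Types (H K : 'M[R[i]]_N) (f h : 'I_N * 'I_N -> R).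
Local Notation s2 := (Num.sqrt 2 : R).

Definition upper_pair (ij : 'I_N * 'I_N) :=
  if (ij.1 <= ij.2)%N then ij else (ij.2, ij.1).

Lemma upper_pairP ij : ((upper_pair ij).1 <= (upper_pair ij).2)%N.
Proof. by rewrite /upper_pair; case: ifP => //= /negbT; rewrite -ltnNge => /ltnW. Qed.

(** Real coordinates on Hermitian matrices, indexed by all pairs (i, j): the
    diagonal entry for i = j, the real part of entry (i, j) for i < j and the
    imaginary part of entry (j, i) for i > j. The factor [Num.sqrt 2] makes them
    orthonormal for the trace inner product and, on a GUE matrix, gives them
    variance 1. *)
Definition herm_coord (ij : 'I_N * 'I_N) (z : R[i]) : R :=
  if ij.1 == ij.2 then complex.Re z
  else s2 * (if (ij.1 < ij.2)%N then complex.Re z else complex.Im z).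

Definition herm_coords H : 'I_N * 'I_N -> R :=
  fun ij => herm_coord ij (H (upper_pair ij).1 (upper_pair ij).2).

Definition herm_of f : 'M[R[i]]_N := \matrix_(i, j)
  if i == j then (f (i, j))%:C
  else if (i < j)%N then (s2^-1 * f (i, j)) +i* (s2^-1 * f (j, i))
  else (s2^-1 * f (j, i)) +i* - (s2^-1 * f (i, j)).

Lemma s2_neq0 : s2 != 0. Proof. by rewrite gt_eqF// sqrtr_gt0. Qed.

Lemma s2V2 : s2^-1 * s2^-1 = 2^-1.
Proof. by rewrite -invfM -expr2 sqr_sqrtr. Qed.

Lemma herm_coordsK H : H \is hermsymmx -> herm_of (herm_coords H) = H.
Proof.
move=> /hermP /matrixP hH; apply/matrixP => i j; rewrite mxE /herm_coords /herm_coord /upper_pair /=.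
have := hH i j; rewrite !mxE => Hij.
have [ij|ij|/val_inj ij] := ltngtP i j.
- have -> : (i == j) = false by rewrite -val_eqE/= ltn_eqF.
  have -> : (j == i) = false by rewrite -val_eqE/= gtn_eqF.
  by rewrite !mulKf ?s2_neq0//=; case: (H i j).
- have -> : (i == j) = false by rewrite -val_eqE/= gtn_eqF.
  have -> : (j == i) = false by rewrite -val_eqE/= ltn_eqF.
  by rewrite -Hij !mulKf ?s2_neq0//=; case: (H j i).
rewrite ij eqxx; move: Hij; rewrite ij; case: (H j j) => a b /= [e].
have -> // : b = 0; by lra.
Qed.

Lemma herm_of_herm f : herm_of f \is hermsymmx.
Proof.
apply/hermP/matrixP => i j; rewrite !mxE.
have [ij|ij|/val_inj ->] := ltngtP i j.
- have -> : (i == j) = false by rewrite -val_eqE/= ltn_eqF.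
  have -> : (j == i) = false by rewrite -val_eqE/= gtn_eqF.
  by rewrite conj_rect opprK.
- have -> : (i == j) = false by rewrite -val_eqE/= gtn_eqF.
  have -> : (j == i) = false by rewrite -val_eqE/= ltn_eqF.
  by [].
by rewrite eqxx conj_rect oppr0.
Qed.

(** Each off-diagonal coordinate occurs in two conjugate entries of the trace,
    each time with weight 1/2. *)
Lemma herm_of_dot f h :
  complex.Re (\tr (herm_of f *m (herm_of h)^t*)) = \sum_ij f ij * h ij.
Proof.
pose e i j := 2^-1 * (f (i, j) * h (i, j)).
transitivity (\sum_i \sum_j (e i j + e j i)).
  rewrite raddf_sum; apply: eq_bigr => i _; rewrite mxE raddf_sum/=.
  apply: eq_bigr => j _; rewrite !mxE /e -s2V2.
  have [ij|ij|/val_inj ->] := ltngtP i j.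
  - have -> : (i == j) = false by rewrite -val_eqE/= ltn_eqF.
    by rewrite /=; ring.
  - have -> : (i == j) = false by rewrite -val_eqE/= gtn_eqF.
    by rewrite /=; ring.
  rewrite eqxx /= s2V2 oppr0 mulr0 subr0; by field.
under eq_bigr do rewrite big_split/=.
rewrite big_split/= [X in _ + X]exchange_big/= !pair_bigA/= -big_split/=.
apply: eq_bigr => -[i j] _ /=.
by rewrite /e; field.
Qed.

Lemma herm_coords_dot H K : H \is hermsymmx -> K \is hermsymmx ->
  \sum_ij herm_coords H ij * herm_coords K ij = complex.Re (\tr (H *m K^t*)).
Proof. by move=> hH hK; rewrite -herm_of_dot (herm_coordsK hH) (herm_coordsK hK). Qed.

Lemma herm_of_measurable d (T : measurableType d) (g : T -> 'I_N * 'I_N -> R) :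
  (forall ij, measurable_fun setT (g ^~ ij)) ->
  mxmeasurable (fun w => herm_of (g w)).
Proof.
move=> mg i j b; under eq_fun do rewrite mxE.
case: (i == j); first by case: b; [exact: mg|exact: measurable_cst].
by case: (i < j)%N; case: b => /=; do ?apply: measurableT_comp => //; apply: measurable_funM.
Qed.

Lemma herm_coord_borel ij B : measurable B -> @complex_borel R (herm_coord ij @^-1` B).
Proof.
move=> mB.
have m : cmeasurable (T := g_sigma_algebraType [set A : set R[i] | exists b B0,
    [/\ [set: bool] b, measurable B0 & A = re_im b @^-1` B0]]) (fun z => z : R[i]).
  by apply/cmeasurableP.
rewrite -[X in complex_borel X]setTI.
suff mc : measurable_fun setT (herm_coord ij : g_sigma_algebraType
   [set A : set R[i] | exists b B0, [/\ [set: bool] b, measurable B0 & A = re_im b @^-1` B0]] -> R).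
  exact: mc.
rewrite /herm_coord; case: (_ == _); first exact: (m true).
apply: measurable_funM => //.
by case: (_ < _)%N; [exact: (m true)|exact: (m false)].
Qed.

End hermitian_coordinates.

Section gue_coordinates.
Variables (R : realType) (N : nat).
Context d (T : measurableType d) (P : probability T R).
Variable X : T -> 'M[R[i]]_N.
Hypothesis GX : is_GUE P X.
Local Notation nu := (@normal_prob R 0 1).

(** The independent entries on and above the diagonal give one coordinate each
    on the diagonal and two above it. *)
Lemma gue_coords_std_normal : std_normal_family P (fun w => herm_coords (X w)).
Proof.
have [rX hX indep diagX offX] := GX.
pose U := {ij : 'I_N * 'I_N | (ij.1 <= ij.2)%N}.
pose t (ij : 'I_N * 'I_N) : U := exist _ (upper_pair ij) (upper_pairP ij).
apply: (grouped_std_normal (t := t) (c := @herm_coord R N) indep).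
- by move=> [ij ?]; move/random_element_initial : rX => /(_ ij); exact.
- exact: herm_coord_borel.
move=> [[i j] /= ij] B mB.
have tE k : (t k == exist _ (i, j) ij) = (k == (i, j)) || (k == (j, i)).
  rewrite -val_eqE /= /upper_pair; case: k => a b /=.
  have [ab|ab] := leqP a b; rewrite !xpair_eqE.
    apply/idP/idP => [->//|/orP[//|/andP[/eqP e1 /eqP e2]]].
    by move: ab ij; rewrite e1 e2 => h1 h2; rewrite -!val_eqE/= !eqn_leq h1 h2.
  apply/idP/idP => [/=|/orP[/andP[/eqP e1 /eqP e2]|]].
  - by rewrite andbC => ->; rewrite orbT.
  - by move: ab; rewrite e1 e2 ltnNge ij.
  - by rewrite andbC.
have tP k (u : U) : t k = u <-> t k == u by split => /eqP.
under eq_bigl do rewrite tE.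
have /predU1P[/val_inj eij|lt_ij] : (i == j :> nat) || (i < j)%N by rewrite -leq_eqVlt.
  subst j; rewrite (eq_bigl (pred1 (i, i))); last by move=> k; rewrite orbb.
  rewrite big_pred1_eq.
  have [_] := diagX i; rewrite sqrtr1 => <-; last exact: mB.
  congr (P _); apply/seteqP; split => w /=.
    by move=> /(_ (i, i)); rewrite /herm_coord eqxx; apply; apply/tP; rewrite tE eqxx.
  by move=> h k /tP; rewrite tE orbb => /eqP ->; rewrite /herm_coord eqxx.
have nij : (i == j) = false by rewrite -val_eqE/= ltn_eqF.
have nji : (j == i) = false by rewrite -val_eqE/= gtn_eqF.
rewrite (bigD1 (i, j))/= ?eqxx// (big_pred1 (j, i)); last first.
  move=> k /=; case: eqP => [->|_] /=; last by rewrite andbT.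
  by rewrite xpair_eqE nij.
rewrite -(std_complex_normal_coords (offX _ _ lt_ij)); [|exact: mB|exact: mB].
congr (P _); apply/seteqP; split => w /=.
  move=> h; split.
    have := h (i, j); rewrite /herm_coord/= nij lt_ij; apply.
    by apply/tP; rewrite tE eqxx.
  have := h (j, i); rewrite /herm_coord/= nji ltnNge (ltnW lt_ij); apply.
  by apply/tP; rewrite tE eqxx orbT.
move=> [h1 h2] k /tP; rewrite tE => /orP[] /eqP ->.
  by rewrite /herm_coord/= nij lt_ij.
by rewrite /herm_coord/= nji ltnNge (ltnW lt_ij).
Qed.

End gue_coordinates.

Section orthogonal_families.
Variables (R : realType) (I : finType).

(** Enumerating [I] reduces this to matrices; [mulmx1C] exchanges orthonormality
    of the columns and of the rows. *)
Lemma std_normal_orthogonal (O : I -> I -> R) d (T : measurableType d)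
  (P : probability T R) (g : T -> I -> R) :
  (forall a b, \sum_k O k a * O k b = (a == b)%:R) ->
  std_normal_family P g -> std_normal_family P (fun w a => \sum_b O a b * g w b).
Proof.
move=> OO ng.
pose ev : 'I_#|I| -> I := enum_val.
have evb : bijective ev by exact: enum_val_bij.
pose M : 'M[R]_#|I| := \matrix_(i, j) O (ev i) (ev j).
have MM : M *m M^T = 1%:M.
  apply: mulmx1C; apply/matrixP => i j; rewrite !mxE.
  rewrite -(inj_eq (bij_inj evb)) -OO.
  rewrite [RHS](reindex ev)/=; last exact/onW_bij/evb.
  by apply: eq_bigr => k _; rewrite !mxE.
have := std_normal_sub enum_rank_inj
  (orthogonal_normal_invariant MM (std_normal_sub (bij_inj evb) ng)).
congr (std_normal_family P _); apply/funext => w; apply/funext => a.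
rewrite [RHS](reindex ev)/=; last exact/onW_bij/evb.
by apply: eq_bigr => k _; rewrite mxE /ev enum_rankK.
Qed.

End orthogonal_families.

Section gue_law.
Variable R : realType.

Lemma mxmeasurable_preimage d (T : measurableType d) m n (H : T -> 'M[R[i]]_(m, n)) :
  mxmeasurable H -> forall B, @mx_borel R m n B -> measurable (H @^-1` B).
Proof. by move=> /mxmeasurableP. Qed.

Lemma std_normal_same_law (I : finType) m n (psi : (I -> R) -> 'M[R[i]]_(m, n))
  d d' (T : measurableType d) (T' : measurableType d') (P : probability T R)
  (P' : probability T' R) (g : T -> I -> R) (g' : T' -> I -> R) :
  mxmeasurable (T := rfamily R I) psi ->
  std_normal_family P g -> std_normal_family P' g' ->
  same_law P P' (@mx_borel R m n) (fun w => psi (g w)) (fun w => psi (g' w)).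
Proof.
move=> mpsi ng ng'; apply: (same_law_comp (std_normal_unique ng ng')).
exact: (mxmeasurable_preimage mpsi).
Qed.

Lemma herm_of_same_law N d d' (T : measurableType d) (T' : measurableType d')
  (P : probability T R) (P' : probability T' R)
  (X : T -> 'M[R[i]]_N) (X' : T' -> 'M[R[i]]_N) :
  (forall w, X w \is hermsymmx) -> (forall w, X' w \is hermsymmx) ->
  std_normal_family P (fun w => herm_coords (X w)) ->
  std_normal_family P' (fun w => herm_coords (X' w)) ->
  same_law P P' (@mx_borel R N N) X X'.
Proof.
move=> hX hX' nX nX'.
have -> : X = (fun w => herm_of (herm_coords (X w))).
  by apply/funext => w; rewrite herm_coordsK.
have -> : X' = (fun w => herm_of (herm_coords (X' w))).
  by apply/funext => w; rewrite herm_coordsK.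
apply: (std_normal_same_law (psi := @herm_of R N)) => //.
apply: (herm_of_measurable (T := rfamily R ('I_N * 'I_N)%type) (g := fun f => f)) => ij.
exact: measurable_coord.
Qed.

Definition unit_family N (b : 'I_N * 'I_N) : 'I_N * 'I_N -> R := fun k => (k == b)%:R.

Lemma Re_scale (r : R) (z : R[i]) : complex.Re (r%:C * z) = r * complex.Re z.
Proof. by case: z => a b /=; rewrite mul0r subr0. Qed.

Lemma Im_scale (r : R) (z : R[i]) : complex.Im (r%:C * z) = r * complex.Im z.
Proof. by case: z => a b /=; rewrite mul0r addr0. Qed.

Lemma herm_of_sum N (f : 'I_N * 'I_N -> R) :
  herm_of f = \sum_b (f b)%:C *: herm_of (unit_family b).
Proof.
have S k : \sum_b f b * (k == b)%:R = f k.
  rewrite (bigD1 k)//= eqxx mulr1 big1 ?addr0// => b /negPf.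
  by rewrite eq_sym => ->; rewrite mulr0.
have S' (c : R) k : \sum_b f b * (c * (k == b)%:R) = c * f k.
  by under eq_bigr do rewrite mulrCA; rewrite -mulr_sumr S.
apply/matrixP => i j; rewrite summxE mxE.
under eq_bigr do rewrite !mxE /unit_family.
apply/eqP; case: (i == j); last case: (i < j)%N.
- rewrite eq_complex/= !raddf_sum/=; under eq_bigr do rewrite mul0r subr0.
  by rewrite S big1 ?eqxx// => b _; rewrite mul0r mulr0 addr0.
- rewrite eq_complex/= !raddf_sum/=; under eq_bigr do rewrite mul0r subr0.
  by under [X in _ && (_ == X)]eq_bigr do rewrite mul0r addr0; rewrite !S' !eqxx.
- rewrite eq_complex/= !raddf_sum/=; under eq_bigr do rewrite mul0r subr0.
  under [X in _ && (_ == X)]eq_bigr do rewrite mul0r addr0 mulrN.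
  by rewrite sumrN !S' !eqxx.
Qed.

Lemma herm_coords_sum N (I : finType) (r : I -> R) (M : I -> 'M[R[i]]_N) k :
  herm_coords (\sum_b (r b)%:C *: M b) k = \sum_b r b * herm_coords (M b) k.
Proof.
rewrite /herm_coords /herm_coord summxE.
case: (k.1 == k.2); last case: (k.1 < k.2)%N.
- by rewrite raddf_sum/=; apply: eq_bigr => b _; rewrite mxE Re_scale.
- rewrite raddf_sum/= mulr_sumr; apply: eq_bigr => b _.
  by rewrite mxE Re_scale mulrCA.
- rewrite raddf_sum/= mulr_sumr; apply: eq_bigr => b _.
  by rewrite mxE Im_scale mulrCA.
Qed.

(** Conjugation by a unitary matrix preserves the trace inner product, so in real
    coordinates it acts on the Gaussian family as an orthogonal matrix. *)
Lemma gue_unitary N d (T : measurableType d) (P : probability T R)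
  (X : T -> 'M[R[i]]_N) (U : 'M[R[i]]_N) : is_GUE P X -> U \is unitarymx ->
  same_law P P (@mx_borel R N N) (fun w => U *m X w *m U^t*) X.
Proof.
move=> GX uU; have [_ hX _ _ _] := GX.
have nX := gue_coords_std_normal GX.
have hU (A : 'M[R[i]]_N) : A \is hermsymmx -> U *m A *m U^t* \is hermsymmx.
  by move=> /hermP hA; apply/hermP; rewrite !trmx_mul !map_mxM trmxCK hA mulmxA.
pose L (f : 'I_N * 'I_N -> R) := herm_coords (U *m herm_of f *m U^t*).
have Lsum f a : L f a = \sum_b L (unit_family b) a * f b.
  rewrite /L [in LHS]herm_of_sum mulmx_sumr mulmx_suml.
  under eq_bigr do rewrite -scalemxAr -scalemxAl.
  by rewrite herm_coords_sum; apply: eq_bigr => b _; rewrite mulrC.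
have Lorth a b : \sum_k L (unit_family a) k * L (unit_family b) k = (a == b)%:R.
  have hL c := hU _ (herm_of_herm (unit_family c)).
  rewrite [LHS](herm_coords_dot (hL a) (hL b)).
  have /hermP e := hL b.
  have U1 : U^t* *m U = 1%:M by apply: mulmx1C; exact/unitarymxP.
  rewrite e (_ : \tr _ = \tr (herm_of (unit_family a) *m herm_of (unit_family b))); last first.
    rewrite !mulmxA -(mulmxA (U *m _) (U^t*) U) U1 mulmx1.
    by rewrite mxtrace_mulC !mulmxA U1 mul1mx.
  have /hermP <- := herm_of_herm (unit_family b).
  rewrite herm_of_dot (bigD1 a)//= /unit_family eqxx mul1r big1 ?addr0// => k /negPf ->.
  by rewrite mul0r.
apply: herm_of_same_law => [w|||]; [exact/hU/hX|exact: hX| |exact: nX].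
have := std_normal_orthogonal (O := fun a b => L (unit_family b) a) Lorth nX.
congr (std_normal_family P _); apply/funext => w; apply/funext => a.
by rewrite -Lsum /L (herm_coordsK (hX w)).
Qed.

Definition mixmx m n (E : 'I_m -> 'I_n -> bool) (A B : 'M[R[i]]_(m, n)) :=
  \matrix_(i, j) if E i j then A i j else B i j.

Lemma mixmx_herm N (E : rel 'I_N) (A B : 'M[R[i]]_N) : symmetric E ->
  A \is hermsymmx -> B \is hermsymmx -> mixmx E A B \is hermsymmx.
Proof.
move=> sE /hermP/matrixP hA /hermP/matrixP hB; apply/hermP/matrixP => i j.
by rewrite !mxE sE; case: ifP => _; [rewrite -[RHS]hA|rewrite -[RHS]hB]; rewrite !mxE.
Qed.

(** For a symmetric mask both real coordinates of an entry are taken from the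
    same matrix, so this is resampling in coordinates. *)
Lemma gue_mix N (E : rel 'I_N) d d' (T : measurableType d) (T' : measurableType d')
  (P : probability T R) (P' : probability T' R)
  (X : T -> 'M[R[i]]_N) (X' : T' -> 'M[R[i]]_N) : symmetric E ->
  is_GUE P X -> is_GUE P' X' ->
  same_law (P \x P')%E P (@mx_borel R N N) (fun w => mixmx E (X w.1) (X' w.2)) X.
Proof.
move=> sE GX GX'; have [_ hX _ _ _] := GX; have [_ hX' _ _ _] := GX'.
apply: herm_of_same_law.
- by move=> w; exact: mixmx_herm.
- exact: hX.
- have := std_normal_mix (fun ij : 'I_N * 'I_N => E ij.1 ij.2)
    (gue_coords_std_normal GX) (gue_coords_std_normal GX').
  congr (std_normal_family _ _); apply/funext => w; apply/funext => -[i j].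
  rewrite /herm_coords mxE /upper_pair/=; case: (leqP i j) => _ //=; last rewrite sE.
    by case: ifP.
  by case: ifP.
- exact: gue_coords_std_normal.
Qed.

(** An increasing [h] maps the coordinates of the block injectively to
    coordinates of the whole matrix, which are a subfamily. *)
Lemma gue_block p N (h : 'I_p -> 'I_N) d d' (T : measurableType d) (T' : measurableType d')
  (P : probability T R) (P' : probability T' R)
  (X : T -> 'M[R[i]]_N) (D : T' -> 'M[R[i]]_p) :
  (forall i j, (h i < h j)%N = (i < j)%N) ->
  is_GUE P X -> is_GUE P' D ->
  same_law P P' (@mx_borel R p p) (fun w => mxsub h h (X w)) D.
Proof.
move=> mh GX GD; have [_ hX _ _ _] := GX; have [_ hD _ _ _] := GD.
have mh' i j : (h i <= h j)%N = (i <= j)%N by rewrite leqNgt mh -leqNgt.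
have ih : injective h.
  by move=> i j e; apply/val_inj/eqP; rewrite eqn_leq -(mh' i j) -(mh' j i) e leqnn.
apply: herm_of_same_law.
- move=> w; apply/hermP/matrixP => i j; have /hermP/matrixP/(_ (h i) (h j)) := hX w.
  by rewrite !mxE.
- exact: hD.
- have ihh : injective (fun ij : 'I_p * 'I_p => (h ij.1, h ij.2)).
    by move=> [i j] [i' j'] /= [/ih -> /ih ->].
  have := std_normal_sub ihh (gue_coords_std_normal GX).
  congr (std_normal_family _ _); apply/funext => w; apply/funext => -[i j].
  rewrite /herm_coords /herm_coord !mxE /upper_pair/= (inj_eq ih) mh mh'.
  by case: (i <= j)%N.
- exact: gue_coords_std_normal.
Qed.

Definition gin_of m n (f : 'I_m * 'I_n * bool -> R) : 'M[R[i]]_(m, n) :=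
  \matrix_(i, j) ((Num.sqrt 2)^-1 * f (i, j, true) +i* ((Num.sqrt 2)^-1 * f (i, j, false))).

Lemma gin_of_measurable m n :
  mxmeasurable (T := rfamily R ('I_m * 'I_n * bool)%type) (@gin_of m n).
Proof.
move=> i j b.
rewrite (_ : (fun w => _) = (fun w => (Num.sqrt 2)^-1 * w (i, j, b))).
  by apply: measurable_funM => //; exact: measurable_coord.
by apply/funext => w; rewrite mxE; case: b.
Qed.

Definition gin_coords m n (G : 'M[R[i]]_(m, n)) : 'I_m * 'I_n * bool -> R :=
  fun k => Num.sqrt 2 * re_im k.2 (G k.1.1 k.1.2).

Lemma gin_coordsK m n (G : 'M[R[i]]_(m, n)) : gin_of (gin_coords G) = G.
Proof.
apply/matrixP => i j; rewrite mxE /gin_coords/= !mulKf ?s2_neq0//.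
by case: (G i j).
Qed.

Lemma ginibre_coords_std_normal m n d (T : measurableType d)
  (P : probability T R) (G : T -> 'M[R[i]]_(m, n)) : is_ginibre P G ->
  std_normal_family P (fun w => gin_coords (G w)).
Proof.
move=> [rG indep nG].
apply: (grouped_std_normal (t := fst) (c := fun k z => Num.sqrt 2 * re_im k.2 z) indep).
- by move=> ij; move/random_element_initial : rG => /(_ ij); exact.
- move=> [u b] B mB /=.
  have mf : measurable_fun [set: R] (fun x => Num.sqrt 2 * x : R) by exact: measurable_funM.
  apply: sub_sigma_algebra; exists b, [set x | B (Num.sqrt 2 * x)]; split => //.
  by rewrite -[X in measurable X]setTI; exact: mf.
move=> [i j] B mB.
rewrite (eq_bigl (fun k => (k == ((i, j), true)) || (k == ((i, j), false)))); last first.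
  by move=> [u []] /=; rewrite !xpair_eqE/= ?andbT ?andbF ?orbF.
rewrite (bigD1 ((i, j), true)) ?eqxx//= (big_pred1 ((i, j), false)); last first.
  move=> [u []] /=; rewrite !xpair_eqE ?eqb_id; case: eqP => //= _; by rewrite ?andbF.
rewrite -(std_complex_normal_coords (nG i j)); [|exact: mB|exact: mB].
congr (P _); apply/seteqP; split => w /=.
  by move=> h; split; [exact: (h ((i, j), true))|exact: (h ((i, j), false))].
by move=> [h1 h2] [u []] /= ->.
Qed.

(** Above the diagonal the real and imaginary parts of the entries are distinct
    coordinates of the whole matrix. *)
Lemma gue_offblock m n N (h : 'I_m -> 'I_N) (h' : 'I_n -> 'I_N) d d'
  (T : measurableType d) (T' : measurableType d')
  (P : probability T R) (P' : probability T' R)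
  (X : T -> 'M[R[i]]_N) (G : T' -> 'M[R[i]]_(m, n)) :
  injective h -> injective h' -> (forall i j, (h i < h' j)%N) ->
  is_GUE P X -> is_ginibre P' G ->
  same_law P P' (@mx_borel R m n) (fun w => mxsub h h' (X w)) G.
Proof.
move=> ih ih' lt_hh GX GG.
pose hh (k : 'I_m * 'I_n * bool) :=
  if k.2 then (h k.1.1, h' k.1.2) else (h' k.1.2, h k.1.1).
have ihh : injective hh.
  move=> [[i j] []] [[i' j'] []]; rewrite /hh/= => -[].
  - by move=> /ih -> /ih' ->.
  - by move=> e1 e2; have := lt_hh i j; rewrite e1 e2 ltnNge ltnW.
  - by move=> e1 e2; have := lt_hh i j; rewrite e1 e2 ltnNge ltnW.
  - by move=> /ih' -> /ih ->.
have -> : (fun w => mxsub h h' (X w)) =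
    (fun w => gin_of (fun k => herm_coords (X w) (hh k))).
  apply/funext => w; rewrite -[LHS]gin_coordsK; congr gin_of; apply/funext => -[[i j] b].
  rewrite /gin_coords /herm_coords /herm_coord /hh /upper_pair/= mxE.
  have lt := lt_hh i j.
  by case: b => /=; rewrite -val_eqE/= ?(ltn_eqF lt) ?(gtn_eqF lt)
    ?lt ?(ltnW lt) ?[(h' j <= _)%N]leqNgt ?[(h' j < _)%N]ltnNge ?lt ?(ltnW lt).
have -> : G = (fun w => gin_of (gin_coords (G w))).
  by apply/funext => w; rewrite gin_coordsK.
apply: (std_normal_same_law (psi := @gin_of m n)); first exact: gin_of_measurable.
  exact: (std_normal_sub ihh (gue_coords_std_normal GX)).
exact: ginibre_coords_std_normal.
Qed.

End gue_law.

(** * Functional calculus of Hermitian matrices *)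

Section functional_calculus.
Variables (R : realType) (n : nat).
Implicit Types (X : 'M[R[i]]_n) (f g : R -> R).

Definition cdiag (v : 'I_n -> R) : 'M[R[i]]_n := diag_mx (\row_l (v l)%:C).

Definition eigenvals X (l : 'I_n) : R := complex.Re (spectral_diag X 0 l).

(** The functional calculus f(X), computed in the diagonalisation provided by
    [spectralmx]. *)
Definition hfun f X : 'M[R[i]]_n :=
  (spectralmx X)^t* *m cdiag (f \o eigenvals X) *m spectralmx X.

Lemma unitary_adjl (V : 'M[R[i]]_n) : V \is unitarymx -> V^t* *m V = 1%:M.
Proof. by move=> /unitarymxP VV; exact: mulmx1C. Qed.

Lemma unitary_adjr (V : 'M[R[i]]_n) : V \is unitarymx -> V *m V^t* = 1%:M.
Proof. by move=> /unitarymxP. Qed.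

Lemma hfun_id X : X \is hermsymmx -> hfun idfun X = X.
Proof.
move=> hX; have /orthomx_spectralP e := hermitian_normalmx hX.
rewrite (invmx_unitary (spectral_unitarymx X)) in e.
rewrite [RHS]e /hfun (_ : cdiag _ = diag_mx (spectral_diag X)) //.
have /mxOverP h := hermitian_spectral_diag_real hX.
rewrite /cdiag; apply: f_equal; apply/rowP => l; rewrite mxE /eigenvals/=.
exact: RRe_real (h 0 l).
Qed.

Lemma cdiag_mulmx (v : 'I_n -> R) (A : 'M[R[i]]_n) i j : (cdiag v *m A) i j = (v i)%:C * A i j.
Proof. by rewrite mul_diag_mx !mxE. Qed.

Lemma mulmx_cdiag (v : 'I_n -> R) (A : 'M[R[i]]_n) i j : (A *m cdiag v) i j = A i j * (v j)%:C.
Proof. by rewrite mul_mx_diag !mxE. Qed.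

Lemma cdiagM (u v : 'I_n -> R) : cdiag u *m cdiag v = cdiag (fun l => u l * v l).
Proof.
by apply/matrixP => i j; rewrite cdiag_mulmx !mxE rmorphM/= mulrnAr.
Qed.

Lemma cdiagD (u v : 'I_n -> R) : cdiag u + cdiag v = cdiag (fun l => u l + v l).
Proof. by apply/matrixP => i j; rewrite !mxE rmorphD/= mulrnDl. Qed.

Lemma cdiag_adj (v : 'I_n -> R) : (cdiag v)^t* = cdiag v.
Proof.
apply/matrixP => i j; rewrite !mxE eq_sym; case: eqP => [->|_].
  by rewrite !mulr1n -[LHS]/(_ +i* - 0) oppr0.
by rewrite !mulr0n rmorph0.
Qed.

(** Independence of the diagonalisation: a matrix intertwining two diagonal
    matrices has a zero entry wherever the eigenvalues differ, hence it
    intertwines their images under [f] as well. *)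
Lemma hfun_unitary f (V : 'M[R[i]]_n) (mu : 'I_n -> R) : V \is unitarymx ->
  V^t* *m cdiag mu *m V \is hermsymmx ->
  hfun f (V^t* *m cdiag mu *m V) = V^t* *m cdiag (f \o mu) *m V.
Proof.
move=> uV; set X := _ *m V => hX.
have uU := spectral_unitarymx X; set U := spectralmx X in uU.
have XE : X = U^t* *m cdiag (eigenvals X) *m U by rewrite -[LHS](hfun_id hX).
have E : cdiag mu *m (V *m U^t*) = (V *m U^t*) *m cdiag (eigenvals X).
  have : V *m X *m U^t* = V *m X *m U^t* by [].
  rewrite {1}/X [in RHS]XE !mulmxA (unitary_adjr uV) mul1mx => ->.
  by rewrite -!mulmxA (unitary_adjr uU) mulmx1.
have E' : cdiag (f \o mu) *m (V *m U^t*) = (V *m U^t*) *m cdiag (f \o eigenvals X).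
  apply/matrixP => i j; have /matrixP/(_ i j) := E.
  rewrite !cdiag_mulmx !mulmx_cdiag [RHS]mulrC; set w := (V *m _) i j.
  have [->|w0] := eqVneq w 0; first by move=> _; rewrite mulr0 mul0r.
  by move=> /(mulIf w0)[e]; rewrite /= e mulrC.
have E2 : cdiag (f \o mu) *m V = V *m hfun f X.
  by rewrite /hfun -/U !mulmxA -E' -!mulmxA (unitary_adjl uU) mulmx1.
by rewrite -[RHS]mulmxA E2 mulmxA (unitary_adjl uV) [RHS]mul1mx.
Qed.

Lemma hfunM f g X : hfun f X *m hfun g X = hfun (fun x => f x * g x) X.
Proof.
rewrite /hfun; have := spectral_unitarymx X.
move: (spectralmx X) (eigenvals X) => U ev uU.
rewrite !mulmxA -[_ *m U *m U^t*]mulmxA (unitary_adjr uU) mulmx1.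
by rewrite -[_ *m cdiag (f \o ev) *m _]mulmxA cdiagM.
Qed.

Lemma hfunD f g X : hfun f X + hfun g X = hfun (fun x => f x + g x) X.
Proof.
rewrite /hfun; move: (spectralmx X) (eigenvals X) => U ev.
by rewrite -mulmxDl -mulmxDr cdiagD.
Qed.

Lemma hfun_cst c X : hfun (fun=> c) X = (c%:C)%:M.
Proof.
rewrite /hfun; have := spectral_unitarymx X.
move: (spectralmx X) (eigenvals X) => U ev uU.
rewrite (_ : cdiag _ = (c%:C)%:M); last by apply/matrixP => i j; rewrite !mxE.
by rewrite scalar_mxC -mulmxA (unitary_adjl uU) mulmx1.
Qed.

Lemma hfun_exp k X : X \is hermsymmx -> hfun (fun x => x ^+ k) X = X ^+ k.
Proof.
move=> hX; elim: k => [|k IH].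
  by rewrite -[X ^+ 0]/1%:M -[RHS](hfun_cst 1 X).
transitivity (hfun idfun X *m hfun (fun x => x ^+ k) X).
  by rewrite hfunM; congr hfun; apply/funext => x; rewrite exprS.
by rewrite (hfun_id hX) IH exprS.
Qed.

(** For a fixed matrix the entries are linear in the values of [f] on the
    eigenvalues; this is what passes to pointwise limits. *)
Lemma hfun_entry f X i j b : re_im b (hfun f X i j) =
  \sum_l re_im b (Num.conj (spectralmx X l i) * spectralmx X l j) * f (eigenvals X l).
Proof.
rewrite mxE; have -> (F : 'I_n -> R[i]) : re_im b (\sum_l F l) = \sum_l re_im b (F l).
  by case: b; rewrite /= raddf_sum.
apply: eq_bigr => l _; rewrite mulmx_cdiag !mxE mulrAC mulrC.
by case: b; [rewrite [LHS]Re_scale mulrC|rewrite [LHS]Im_scale mulrC].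
Qed.

Lemma eq_hfun f g X : (forall l, f (eigenvals X l) = g (eigenvals X l)) ->
  hfun f X = hfun g X.
Proof.
move=> E; rewrite /hfun (_ : f \o eigenvals X = g \o eigenvals X)//.
by apply/funext => l; exact: E.
Qed.

Lemma hfun_herm f X : hfun f X \is hermsymmx.
Proof.
rewrite /hfun; move: (spectralmx X) (eigenvals X) => U ev.
by apply/hermP; rewrite !trmx_mul !map_mxM trmxCK cdiag_adj mulmxA.
Qed.

End functional_calculus.

Section functional_calculus_measurability.
Context (R : realType) (n : nat) d (T : measurableType d) (H : T -> 'M[R[i]]_n).
Hypotheses (mH : mxmeasurable H) (hH : forall w, H w \is hermsymmx).

(** The eigenvectors are not chosen measurably in the matrix, so measurability
    of the functional calculus cannot be read off its definition. It is
    established for larger and larger classes of functions instead. *)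
Definition fmeasurable (f : R -> R) := mxmeasurable (fun w => hfun f (H w)).

Lemma fmeasurable_id : fmeasurable idfun.
Proof.
by rewrite /fmeasurable (_ : (fun w => _) = H)//; apply/funext => w; exact: hfun_id.
Qed.

Lemma fmeasurable_cst c : fmeasurable (fun=> c).
Proof. by move=> i j; under eq_fun do rewrite hfun_cst; exact: cmeasurable_cst. Qed.

Lemma fmeasurableD f g : fmeasurable f -> fmeasurable g ->
  fmeasurable (fun x => f x + g x).
Proof.
move=> mf mg; rewrite /fmeasurable.
rewrite (_ : (fun w => _) = fun w => hfun f (H w) + hfun g (H w)); last first.
  by apply/funext => w; rewrite hfunD.
exact: (mxmeasurableD mf mg).
Qed.

Lemma fmeasurableM f g : fmeasurable f -> fmeasurable g ->
  fmeasurable (fun x => f x * g x).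
Proof.
move=> mf mg; rewrite /fmeasurable.
rewrite (_ : (fun w => _) = fun w => hfun f (H w) *m hfun g (H w)); last first.
  by apply/funext => w; rewrite hfunM.
exact: (mxmeasurableM mf mg).
Qed.

Lemma fmeasurableN f : fmeasurable f -> fmeasurable (fun x => - f x).
Proof.
move=> mf; rewrite (_ : (fun x => _) = fun x => (-1) * f x).
  exact: (fmeasurableM (fmeasurable_cst (-1)) mf).
by apply/funext => x; rewrite mulN1r.
Qed.

Lemma fmeasurableX f k : fmeasurable f -> fmeasurable (fun x => f x ^+ k).
Proof.
move=> mf; elim: k => [|k IH]; first exact: fmeasurable_cst.
rewrite (_ : (fun x => _) = fun x => f x * f x ^+ k); first exact: (fmeasurableM mf IH).
by apply/funext => x; rewrite exprS.
Qed.

Lemma fmeasurable_sum (I : Type) (r : seq I) (F : I -> R -> R) :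
  (forall i, fmeasurable (F i)) -> fmeasurable (fun x => \sum_(i <- r) F i x).
Proof.
move=> mF; elim: r => [|a r IH].
  under eq_fun do rewrite big_nil; exact: fmeasurable_cst.
under eq_fun do rewrite big_cons; exact: (fmeasurableD (mF a) IH).
Qed.

Lemma fmeasurable_prod (I : Type) (r : seq I) (F : I -> R -> R) :
  (forall i, fmeasurable (F i)) -> fmeasurable (fun x => \prod_(i <- r) F i x).
Proof.
move=> mF; elim: r => [|a r IH].
  under eq_fun do rewrite big_nil; exact: fmeasurable_cst.
under eq_fun do rewrite big_cons; exact: (fmeasurableM (mF a) IH).
Qed.

Lemma fmeasurable_cvg (F : nat -> R -> R) f : (forall m, fmeasurable (F m)) ->
  (forall x, (fun m => F m x) @ \oo --> f x) -> fmeasurable f.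
Proof.
move=> mF cF i j b.
apply: (@measurable_fun_cvg _ _ _ _ (fun m w => re_im b (hfun (F m) (H w) i j))).
  by move=> m; exact: mF.
move=> w _; rewrite [X in _ --> X](hfun_entry f).
rewrite (_ : (fun m => _) = fun m => \sum_l re_im b
  (Num.conj (spectralmx (H w) l i) * spectralmx (H w) l j) * F m (eigenvals (H w) l)); last first.
  by apply/funext => m; exact: hfun_entry.
apply: cvg_big => [|l _]; first exact: add_continuous.
by apply: cvgM; [exact: cvg_cst|exact: cF].
Qed.

Lemma fmeasurable_expR f : fmeasurable f -> fmeasurable (fun x => expR (f x)).
Proof.
move=> mf; apply: (fmeasurable_cvg (F := fun m x => series (exp_coeff (f x)) m)).
  move=> m; rewrite /series/=; apply: fmeasurable_sum => k.
  by apply: fmeasurableM; [exact: fmeasurableX|exact: fmeasurable_cst].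
by move=> x; exact: is_cvg_series_exp_coeff.
Qed.

(** The functions exp(- exp(k (x - a))) of x tend to the indicator of the ray,
    except at [a], where they equal 1/e; powers of their limit correct this
    value. *)
Lemma fmeasurable_ray (a : R) : fmeasurable \1_`]-oo, a[%classic.
Proof.
have e1 : `|expR (-1) : R| < 1 by rewrite ger0_norm ?expR_ge0// -expR0 ltr_expR oppr_lt0.
pose h (x : R) : R := if x < a then 1 else if x == a then expR (-1) else 0.
have mh : fmeasurable h.
  apply: (fmeasurable_cvg (F := fun k x => expR (- (expR (x - a) ^+ k)))).
    move=> k; apply: fmeasurable_expR; apply: fmeasurableN; apply: fmeasurableX.
    apply: fmeasurable_expR; apply: fmeasurableD; [exact: fmeasurable_id|exact: fmeasurable_cst].
  move=> x; rewrite /h; have [xa|ax|->] := ltgtP x a.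
  - have : (fun k => - expR (x - a) ^+ k) @ \oo --> - (0 : R).
      apply: cvgN; apply: cvg_expr.
      by rewrite ger0_norm ?expR_ge0// -expR0 ltr_expR subr_lt0.
    rewrite oppr0 -[X in _ -> _ --> X]expR0 => hc.
    by apply: (cvg_comp _ expR hc); exact: continuous_expR.
  - apply: (@squeeze_cvgr _ _ _ _ (fun=> 0) (fun k => (expR (x - a))^-1 ^+ k)).
    + apply: nearW => k; rewrite expR_ge0/= expRN exprVn lef_pV2 ?posrE ?expR_gt0 ?exprn_gt0 ?expR_gt0//.
      by apply: le_trans (expR_ge1Dx _); rewrite lerDr.
    + exact: cvg_cst.
    + apply: cvg_expr; rewrite ger0_norm ?invr_ge0 ?expR_ge0// invf_lt1 ?expR_gt0//.
      by rewrite -expR0 ltr_expR subr_gt0.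
  - by under eq_fun do rewrite subrr expR0 expr1n; exact: cvg_cst.
apply: (fmeasurable_cvg (F := fun k x => h x ^+ k)); first by move=> k; exact: fmeasurableX.
move=> x; rewrite /h indicE.
have -> : (x \in `]-oo, a[%classic) = (x < a) by apply/idP/idP; rewrite inE /= in_itv.
have [xa|ax|_] := ltgtP x a.
- by under eq_fun do rewrite expr1n; exact: cvg_cst.
- by apply: cvg_near_cst; exists 1%N => // -[//|m] _; rewrite expr0n.
- exact: cvg_expr.
Qed.

(** The sets with a good indicator form a sigma-algebra containing the rays: a
    countable union is the limit of 1 - (1 - 1_(A 0)) ... (1 - 1_(A m)). *)
Lemma fmeasurable_indic (B : set R) : measurable B -> fmeasurable \1_B.
Proof.
move=> mB; have {mB} : (@RGenInftyO.G R).-sigma.-measurable B.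
  by rewrite -RGenInftyO.measurableE.
suff : (@RGenInftyO.G R).-sigma.-measurable `<=` [set B : set R | fmeasurable \1_B].
  by apply.
apply: smallest_sub; last first.
  by move=> _ [a ->]; exact: fmeasurable_ray.
have mC (A : set R) : fmeasurable \1_A -> fmeasurable (fun x => 1 - \1_A x).
  by move=> mA; apply: fmeasurableD; [exact: fmeasurable_cst|exact: fmeasurableN].
split=> /= [|A mA|A mA].
- by rewrite indic0; exact: fmeasurable_cst.
- rewrite (_ : \1_ _ = fun x => 1 - \1_A x); first exact: mC.
  by apply/funext => x; rewrite setTD !indicE in_setC; case: (_ \in _); rewrite ?subrr ?subr0.
apply: (fmeasurable_cvg (F := fun m x => 1 - \prod_(i < m) (1 - \1_(A i) x))).
  move=> m; apply: fmeasurableD; first exact: fmeasurable_cst.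
  by apply: fmeasurableN; apply: fmeasurable_prod => i; exact: mC.
move=> x; rewrite indicE.
have [[k _ Akx]|nA] := pselect ((\bigcup_k A k) x).
  rewrite mem_set; last by exists k.
  apply: cvg_near_cst; exists k.+1 => //= m km.
  rewrite (bigD1 (Ordinal km))//= indicE mem_set//.
  by rewrite subrr mul0r subr0.
rewrite memNset//; apply: cvg_near_cst; apply: nearW => m.
rewrite big1 ?subrr// => i _; rewrite indicE memNset ?subr0// => Aix.
by apply: nA; exists i.
Qed.

Import HBNNSimple.

(** Nonnegative simple functions are combinations of Borel indicators and
    approximate [f] pointwise. *)
Lemma fmeasurable_ge0 (f : R -> R) : measurable_fun setT f -> (forall x, 0 <= f x) ->
  fmeasurable f.
Proof.
move=> mf f0.
have mEf : measurable_fun [set: R] (EFin \o f) by exact/measurable_EFinP.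
pose g := nnsfun_approx measurableT mEf.
have gE m : exists k (c : 'I_k -> R), forall x : R,
    g m x = \sum_(i < k) (c i * \1_(g m @^-1` [set c i]) x).
  by do 2 eexists; move=> x; exact: fimfunEord.
apply: (fmeasurable_cvg (F := fun m x => g m x)).
  move=> m; have [k [c cE]] := gE m; under eq_fun do rewrite cE.
  apply: fmeasurable_sum => i; apply: fmeasurableM; first exact: fmeasurable_cst.
  apply: fmeasurable_indic; rewrite -[X in measurable X]setTI.
  exact: (measurable_funP (g m)).
move=> x; have Ef0 y : [set: R] y -> (0 <= (EFin \o f) y)%E by rewrite lee_fin.
by have /fine_cvgP[_] := cvg_nnsfun_approx measurableT mEf Ef0 (Logic.I : [set: R] x).
Qed.

End functional_calculus_measurability.

(** * The spectral measure as a function of the matrix *)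

Section spectral_measure_facts.
Variables (R : realType) (p N : nat) (le_pN : (p <= N)%N).
Notation TR := (measurableTypeR R).
Local Notation w := (widen_ord le_pN).
Implicit Types (X V : 'M[R[i]]_N).

(** The entries of [hfun \1_B X] define finitely supported charges with the
    moments of the spectral measure, and the moments determine such a charge. *)
Lemma spectral_measure_indic X (B : set TR) i j : X \is hermsymmx -> measurable B ->
  mxm_val B (spectral_measure le_pN X) i j = hfun \1_B X (w i) (w j).
Proof.
move=> hX mB; have [_ supp mom] := spectral_measureP le_pN hX.
set S := spectral_measure le_pN X in supp mom *.
have [s0 us0 s0E] := spectrum_seq X.
(* The two charges are known to live on the spectrum and on the list of
   eigenvalues respectively; [s] contains both. *)
pose s := undup (s0 ++ [seq eigenvals X l | l <- enum 'I_N]).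
have us : uniq s by exact: undup_uniq.
have s0s x : x \notin s -> x \notin s0 by rewrite mem_undup mem_cat negb_or => /andP[].
have evs l : eigenvals X l \in s.
  by rewrite mem_undup mem_cat; apply/orP; right; apply: map_f; rewrite mem_enum.
pose nu b := if b then mxm_re S i j else mxm_im S i j.
have nu0 b (A : set TR) : measurable A -> (forall x, A x -> x \notin s) -> nu b A = 0%E.
  move=> mA As; have [] := @mxm_re0 R p S A i j mA; last by case: b.
  by apply: supp => // x /As /s0s; rewrite s0E.
pose c b l := re_im b (Num.conj (spectralmx X l (w i)) * spectralmx X l (w j)).
have key b : exists nu' : {charge set TR -> \bar R}, forall A : set TR, measurable A ->
    nu b A = nu' A /\ nu' A = (re_im b (hfun \1_A X (w i) (w j)))%:E.
  have [nu' nu'E] := discrete_charge (index_enum 'I_N) (c b) (eigenvals X).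
  exists nu' => A mA; split; last by rewrite nu'E// hfun_entry.
  have nu'0 (A' : set TR) : measurable A' -> (forall x, A' x -> x \notin s) -> nu' A' = 0%E.
    move=> mA' As; rewrite nu'E// big1// => l _; rewrite indicE memNset ?mulr0//.
    by move=> /As; rewrite evs.
  apply: (charge_uniqB us) => //; first exact: nu0.
  apply: (charge_uniq us) => //; first exact: nu0.
  move=> k; have mX : measurable_fun [set: R] (fun x : R => x ^+ k) by exact: measurable_funX.
  rewrite [RHS](charge_integral_finsupp us mX nu'0).
  transitivity (re_im b ((X ^+ k) (w i) (w j))).
    by rewrite mom mxE /nu; case b.
  rewrite -hfun_exp// hfun_entry.
  under [RHS]eq_bigr => z _ do rewrite nu'E ?mulr_sumr//=.
  rewrite exchange_big/=; apply: eq_bigr => l _.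
  rewrite (bigD1_seq (eigenvals X l))//= indicE mem_set// mulr1 mulrC.
  rewrite big1 ?addr0// => z /negPf zx.
  by rewrite indicE memNset ?mulr0// => /= e; rewrite e eqxx in zx.
rewrite mxE; case E : (hfun _ _ _ _) => [a b].
have [nu1 /(_ B mB)[e1 e1']] := key true; have [nu2 /(_ B mB)[e2 e2']] := key false.
by rewrite -/(nu true) -/(nu false) e1 e1' e2 e2' E.
Qed.

Definition fixes_first V := forall (i : 'I_p) (j : 'I_N), V (w i) j = (w i == j)%:R.

Lemma eigenvalue_unitary X V a : V \is unitarymx -> eigenvalue X a ->
  eigenvalue (V *m X *m V^t*) a.
Proof.
move=> uV /eigenvalueP[v vX v0]; apply/eigenvalueP; exists (v *m V^t*).
  rewrite -!mulmxA (mulmxA (V^t*)) (unitary_adjl uV) mul1mx (mulmxA v) vX.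
  by rewrite scalemxAl.
apply: contra_neq v0 => e.
by rewrite -[v]mulmx1 -(unitary_adjl uV) mulmxA e mul0mx.
Qed.

Lemma expr_unitary X V k : V \is unitarymx ->
  (V *m X *m V^t*) ^+ k = V *m X ^+ k *m V^t*.
Proof.
move=> uV; elim: k => [|k IH]; first by rewrite !expr0 mulmx1 unitary_adjr.
rewrite !exprS IH -[LHS]/(_ *m _) -!mulmxA (mulmxA (V^t*)) (unitary_adjl uV) mul1mx.
by rewrite (mulmxA X).
Qed.

(** The spectral measure is characterised by the eigenvalues and by the corner
    entries of the powers of [X]; the conjugation preserves both. *)
Lemma spectral_measure_unitary X V : V \is unitarymx -> fixes_first V ->
  spectral_measure le_pN (V *m X *m V^t*) = spectral_measure le_pN X.
Proof.
move=> uV fV; rewrite /spectral_measure; congr (get _).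
have XE : X = V^t* *m (V *m X *m V^t*) *m (V^t*)^t*.
  by rewrite trmxCK !mulmxA (unitary_adjl uV) mul1mx -mulmxA (unitary_adjl uV) mulmx1.
have eigE a : eigenvalue (V *m X *m V^t*) a = eigenvalue X a.
  apply/idP/idP => [|]; last exact: (eigenvalue_unitary uV).
  have uV' : V^t* \is unitarymx by rewrite trmxC_unitary.
  by move=> /(eigenvalue_unitary uV'); rewrite -XE.
have entE k i j : ((V *m X *m V^t*) ^+ k) (w i) (w j) = (X ^+ k) (w i) (w j).
  rewrite expr_unitary// mxE (bigD1 (w j))//= !mxE fV eqxx rmorph1 mulr1.
  rewrite [X in _ + X]big1 ?addr0 => [|l /negPf lj]; last first.
    by rewrite !mxE fV eq_sym lj rmorph0 mulr0.
  rewrite (bigD1 (w i))//= fV eqxx mul1r big1 ?addr0// => l /negPf li.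
  by rewrite fV eq_sym li mul0r.
have half X1 X2 S : (forall a, eigenvalue X1 a = eigenvalue X2 a) ->
    (forall k i j, (X1 ^+ k) (w i) (w j) = (X2 ^+ k) (w i) (w j)) ->
    is_spectral_measure le_pN X1 S -> is_spectral_measure le_pN X2 S.
  move=> eE kE [s1 s2 s3]; split; first exact: s1.
  - by move=> B mB nB; apply: (s2 _ mB) => x /nB; rewrite eE.
  - by move=> k i j; rewrite -kE; exact: s3.
apply/seteqP; split => S; apply: half; [exact: eigE|exact: entE|..].
  by move=> a; rewrite eigE.
by move=> k i j; rewrite entE.
Qed.

(** The projection onto Hermitian matrices: composing with it extends maps that
    are only meaningful on Hermitian matrices to Borel maps of all matrices. *)
Definition hermpart (n : nat) (H : 'M[R[i]]_n) : 'M[R[i]]_n := (2^-1)%:C *: (H + H^t*).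

Lemma hermpart_herm n (H : 'M[R[i]]_n) : hermpart H \is hermsymmx.
Proof.
apply/hermP; rewrite /hermpart; apply/matrixP => i j; rewrite !mxE.
rewrite rmorphM/= rmorphD/= conjCK addrC; congr (_ * _).
by rewrite -[LHS]/(_ +i* - 0) oppr0.
Qed.

Lemma hermpart_id n (H : 'M[R[i]]_n) : H \is hermsymmx -> hermpart H = H.
Proof.
move=> /hermP hH; rewrite /hermpart hH; apply/matrixP => i j; rewrite !mxE.
case: (H i j) => a b; apply/eqP; rewrite eq_complex/= !mul0r subr0 addr0.
by apply/andP; split; apply/eqP; field.
Qed.

Lemma hermpart_unitary n (V H : 'M[R[i]]_n) :
  hermpart (V *m H *m V^t*) = V *m hermpart H *m V^t*.
Proof.
rewrite /hermpart -scalemxAr -scalemxAl; congr (_ *: _).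
by rewrite mulmxDr mulmxDl !trmx_mul !map_mxM trmxCK mulmxA.
Qed.

Lemma hermpart_measurable d (T : measurableType d) n (H : T -> 'M[R[i]]_n) :
  mxmeasurable H -> mxmeasurable (fun w => hermpart (H w)).
Proof.
move=> mH; apply: mxmeasurableZ; first exact: cmeasurable_cst.
by apply: mxmeasurableD => //; exact: mxmeasurable_adj.
Qed.

Definition hspectral_measure (H : 'M[R[i]]_N) : mxmeasure R p :=
  spectral_measure le_pN (hermpart H).

Lemma hspectral_measure_measurable A : @mxm_sigma R p A ->
  @mx_borel R N N (hspectral_measure @^-1` A).
Proof.
move: A.
suff : random_element (T := mx_space R N N) (@mxm_sigma R p) hspectral_measure by [].
apply/random_element_initial => B mB; apply/mxmeasurableP => i j.
have -> : (fun H => (mxm_val B \o hspectral_measure) H i j) =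
    (fun H : mx_space R N N => hfun \1_B (hermpart H) (w i) (w j)).
  by apply/funext => H; rewrite /= spectral_measure_indic//; exact: hermpart_herm.
have mh : mxmeasurable (fun H : mx_space R N N => hermpart H).
  by apply: hermpart_measurable; exact: mxmeasurable_id.
exact: (fmeasurable_indic mh (@hermpart_herm N) mB).
Qed.

End spectral_measure_facts.

(** * Extension of isometries *)

Section witt_extension.
Variable R : realType.
Local Notation C := R[i].

Lemma mulmx_adj_eq0 m n (B : 'M[C]_(m, n)) : B *m B^t* = 0 -> B = 0.
Proof.
move=> BB; apply/matrixP => i j; rewrite mxE.
have /matrixP/(_ i i) := BB; rewrite !mxE.
under eq_bigr do rewrite !mxE.
move=> /eqP; rewrite psumr_eq0; last by move=> k _; exact: mul_conjC_ge0.
by move=> /allP/(_ j (mem_index_enum _)); rewrite /= mul_conjC_eq0 => /eqP.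
Qed.

Lemma gram_mul m n k (A A' : 'M[C]_(m, n)) (u : 'M[C]_(k, m)) :
  A *m A^t* = A' *m A'^t* -> (u *m A) *m (u *m A)^t* = (u *m A') *m (u *m A')^t*.
Proof.
by move=> AA; rewrite !trmx_mul !map_mxM !mulmxA -(mulmxA u) AA !mulmxA.
Qed.

Lemma mulmx1C_eq m n (A : 'M[C]_(m, n)) (B : 'M[C]_(n, m)) : m = n ->
  A *m B = 1%:M -> B *m A = 1%:M.
Proof. by move=> e; subst m; exact: mulmx1C. Qed.

(** Orthonormalise a basis of the orthogonal of the rows of [Q]; together with
    [Q] it forms a square unitary matrix. *)
Lemma unitary_complement r N (Q : 'M[C]_(r, N)) : Q \is unitarymx ->
  exists S : 'M[C]_(N - r, N), [/\ S \is unitarymx, Q *m S^t* = 0,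
    S *m Q^t* = 0 & Q^t* *m Q + S^t* *m S = 1%:M].
Proof.
move=> uQ; have rN : (r <= N)%N by rewrite -(mxrank_unitary uQ) rank_leq_col.
suff [S [uS QS]] : exists S : 'M[C]_(N - r, N), S \is unitarymx /\ S *m Q^t* = 0.
  have SQ : Q *m S^t* = 0.
    have := congr1 (fun M : 'M[C]__ => M^t*) QS.
    by rewrite trmx_mul map_mxM trmxCK trmx0 map_mx0.
  exists S; split => //.
  have : col_mx Q S *m (col_mx Q S)^t* = 1%:M.
    rewrite tr_col_mx map_row_mx mul_col_row SQ QS.
    by rewrite (unitarymxP uQ) (unitarymxP uS) -scalar_mx_block.
  move=> /(mulmx1C_eq (subnKC rN)) <-.
  by rewrite tr_col_mx map_row_mx mul_row_col.
have rK : \rank (kermx (Q^t*)) = (N - r)%N.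
  by rewrite mxrank_ker mxrank_map mxrank_tr mxrank_unitary.
rewrite -rK; exists (schmidt (row_base (kermx (Q^t*)))); split.
  by apply: schmidt_unitarymx; exact: rank_leq_col.
apply/sub_kermxP; rewrite (eqmx_schmidt_free (row_base_free _)).
by rewrite eq_row_base.
Qed.

(** Send [Q] to [Q'] and the complement of the one to the complement of the
    other. *)
Lemma witt_unitary r N (Q Q' : 'M[C]_(r, N)) : Q \is unitarymx -> Q' \is unitarymx ->
  exists2 W : 'M[C]_N, W \is unitarymx & Q *m W = Q'.
Proof.
move=> uQ uQ'.
have [S [uS QS SQ E]] := unitary_complement uQ.
have [S' [uS' QS' SQ' E']] := unitary_complement uQ'.
exists (Q^t* *m Q' + S^t* *m S').
  apply/unitarymxP.
  rewrite linearD/= map_mxD !trmx_mul !map_mxM !trmxCK mulmxDr !mulmxDl.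
  rewrite -!mulmxA !(mulmxA Q') !(mulmxA S') (unitarymxP uQ') (unitarymxP uS') QS' SQ'.
  by rewrite !mul0mx !mul1mx !mulmx0 addr0 add0r.
by rewrite mulmxDr !mulmxA (unitarymxP uQ) QS mul1mx mul0mx addr0.
Qed.

(** Whether [M] orthonormalises the rows of [A] only depends on their Gram
    matrix, so the [M] given by the Schmidt process orthonormalises the rows of
    [A'] too. *)
Lemma witt_free r N (A A' : 'M[C]_(r, N)) : row_free A -> A *m A^t* = A' *m A'^t* ->
  exists2 W : 'M[C]_N, W \is unitarymx & A *m W = A'.
Proof.
move=> fA AA.
have rN : (r <= N)%N by rewrite -(eqP fA) rank_leq_col.
pose Q := schmidt A.
have uQ : Q \is unitarymx by exact: schmidt_unitarymx.
have eQ : (Q :=: A)%MS by exact: eqmx_schmidt_free.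
have [M QE] : exists M, Q = M *m A by apply/submxP; rewrite eQ.
have [L AE] : exists L, A = L *m Q by apply/submxP; rewrite eQ.
have ML : M *m L = 1%:M.
  have e : Q = M *m L *m Q by rewrite -mulmxA -AE.
  by rewrite -(unitarymxP uQ) [X in _ = X *m _]e -mulmxA (unitarymxP uQ) mulmx1.
have uQ' : M *m A' \is unitarymx.
  by apply/unitarymxP; rewrite -(gram_mul M AA) -QE; exact/unitarymxP.
have [W uW QW] := witt_unitary uQ uQ'.
exists W => //; rewrite {1}AE -mulmxA QW mulmxA (mulmx1C ML) mul1mx//.
Qed.

(** Restrict to a basis of the row space of [A]. A linear relation between the
    rows of [A] can be read off the Gram matrix, so the rows of [A'] satisfy it
    as well and [W] is right on all rows. *)
Lemma witt_extension m N (A A' : 'M[C]_(m, N)) : A *m A^t* = A' *m A'^t* ->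
  exists2 W : 'M[C]_N, W \is unitarymx & A *m W = A'.
Proof.
move=> AA.
have [Y YE] : exists Y, row_base A = Y *m A by apply/submxP; rewrite eq_row_base.
have [K KE] : exists K, A = K *m row_base A by apply/submxP; rewrite eq_row_base.
have [W uW YW] : exists2 W : 'M[C]_N, W \is unitarymx & row_base A *m W = Y *m A'.
  by apply: witt_free; [exact: row_base_free|rewrite YE; exact: gram_mul].
exists W => //; rewrite KE -mulmxA YW mulmxA; apply/eqP.
rewrite -subr_eq0 -[X in _ - X]mul1mx -mulmxBl; apply/eqP.
apply: mulmx_adj_eq0; rewrite -(gram_mul _ AA).
suff -> : (K *m Y - 1%:M) *m A = 0 by rewrite mul0mx.
by rewrite mulmxBl mul1mx -mulmxA -YE -KE subrr.
Qed.

End witt_extension.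

(** * Square roots of positive semidefinite matrices *)

Section matrix_sqrt.
Variable R : realType.

(** Evaluate the quadratic form at a unit eigenvector. *)
Lemma psd_eigenvals n (X : 'M[R[i]]_n) l : psdmx X -> 0 <= eigenvals X l.
Proof.
move=> [hX pX]; have uU := spectral_unitarymx X; set U := spectralmx X in uU.
have XE : X = U^t* *m cdiag (eigenvals X) *m U by rewrite -[LHS]hfun_id.
have rX : row l U *m X = (eigenvals X l)%:C *: row l U.
  rewrite -row_mul {1}XE !mulmxA (unitary_adjr uU) mul1mx.
  by apply/rowP => j; rewrite mxE cdiag_mulmx !mxE.
have := pX (row l U); rewrite rX -scalemxAl mxE.
have -> : (row l U *m (row l U)^t*) 0 0 = (U *m U^t*) l l.
  by rewrite !mxE; apply: eq_bigr => j _; rewrite !mxE.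
by rewrite (unitary_adjr uU) mxE eqxx mulr1 lecR.
Qed.

(** Defined on all matrices through the Hermitian part, in order to be a Borel
    map. *)
Definition msqrt n (A : 'M[R[i]]_n) : 'M[R[i]]_n := hfun Num.sqrt (hermpart A).

Lemma msqrt_herm n (A : 'M[R[i]]_n) : msqrt A \is hermsymmx.
Proof. exact: hfun_herm. Qed.

Lemma msqrt_sqr n (A : 'M[R[i]]_n) : psdmx A -> msqrt A *m msqrt A = A.
Proof.
move=> pA; have [hA _] := pA; rewrite /msqrt (hermpart_id hA) hfunM.
rewrite -[RHS](hfun_id hA); apply: eq_hfun => l /=.
by rewrite -expr2 sqr_sqrtr// (psd_eigenvals l pA).
Qed.

(** The functional calculus of [A *m A] may be computed in the diagonalisation
    of [A], by [hfun_unitary]. *)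
Lemma sqr_msqrt n (A : 'M[R[i]]_n) : psdmx A -> msqrt (A *m A) = A.
Proof.
move=> pA; have [hA _] := pA; have uU := spectral_unitarymx A; set U := spectralmx A in uU.
have AE : A = U^t* *m cdiag (eigenvals A) *m U by rewrite -[LHS]hfun_id.
have A2E : A *m A = U^t* *m cdiag (fun l => eigenvals A l ^+ 2) *m U.
  rewrite -[in LHS](hfun_id hA) hfunM /hfun -/U.
  rewrite (_ : _ \o _ = fun l => eigenvals A l ^+ 2)//.
have hA2 : A *m A \is hermsymmx.
  by move/hermP: hA => hA; apply/hermP; rewrite trmx_mul map_mxM hA.
rewrite /msqrt (hermpart_id hA2) A2E.
rewrite A2E in hA2; rewrite (hfun_unitary Num.sqrt uU hA2) [RHS]AE.
rewrite (_ : _ \o _ = eigenvals A)//; apply/funext => l /=.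
by rewrite sqrtr_sqr (ger0_norm (psd_eigenvals l pA)).
Qed.

Lemma psd_gram m n (b : 'M[R[i]]_(m, n)) : psdmx (b *m b^t*).
Proof.
split; first by apply/hermP; rewrite trmx_mul map_mxM trmxCK.
move=> u; have -> : u *m (b *m b^t*) *m u^t* = (u *m b) *m (u *m b)^t*.
  by rewrite trmx_mul map_mxM !mulmxA.
by rewrite mxE sumr_ge0// => l _; rewrite !mxE; exact: mul_conjC_ge0.
Qed.

Lemma msqrt_gram m n (b : 'M[R[i]]_(m, n)) :
  msqrt (b *m b^t*) *m (msqrt (b *m b^t*))^t* = b *m b^t*.
Proof.
have /hermP -> := msqrt_herm (b *m b^t*); exact/msqrt_sqr/psd_gram.
Qed.

(** [Num.sqrt] is a nonnegative Borel function. *)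
Lemma msqrt_measurable d (T : measurableType d) n (H : T -> 'M[R[i]]_n) :
  mxmeasurable H -> mxmeasurable (fun w => msqrt (H w)).
Proof.
move=> mH; apply: (fmeasurable_ge0 (hermpart_measurable mH)).
- by move=> w; exact: hermpart_herm.
- by apply: continuous_measurable_fun; exact: sqrt_continuous.
- by move=> x; exact: sqrtr_ge0.
Qed.

End matrix_sqrt.

(** * Hybrids of a block-tridiagonal and a full matrix *)

Section blocks.
Variables (R : realType) (n p : nat).
Hypothesis p_gt0 : (0 < p)%N.
Local Notation N := (p * n)%N.
Implicit Types (D C : nat -> 'M[R[i]]_p) (X Z : 'M[R[i]]_N).

Definition blk (a : 'I_N) : nat := (a %/ p)%N.
Definition off (a : 'I_N) : 'I_p := Ordinal (ltn_pmod a p_gt0).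

Lemma blk_lt a : (blk a < n)%N.
Proof. by rewrite /blk ltn_divLR// [X in (_ < X)%N]mulnC. Qed.

Lemma blk_off_inj a b : blk a = blk b -> off a = off b -> a = b.
Proof.
move=> e /(congr1 val)/= e'; apply/val_inj; rewrite /= (divn_eq a p) (divn_eq b p) e'.
by rewrite -/(blk a) e.
Qed.

(** The intermediate matrices of the reduction: the blocks with both indices at
    least [k] are those of [X], the others are those of the block-tridiagonal
    matrix. Thus [hybrid 0] is [X], and [hybrid n] does not involve [X]. *)
Definition hybrid k D C X : 'M[R[i]]_N := \matrix_(a, b)
  if (k <= blk a)%N && (k <= blk b)%N then X a b
  else if blk a == blk b then D (blk a) (off a) (off b)
  else if blk b == (blk a).+1 then C (blk a) (off a) (off b)
  else if blk a == (blk b).+1 then C (blk b) (off a) (off b) else 0.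

Lemma hybrid0 D C X : hybrid 0 D C X = X.
Proof. by apply/matrixP => a b; rewrite mxE. Qed.

Lemma eq_hybrid k D C D' C' X : (forall i, (i < n)%N -> D i = D' i) ->
  (forall i, (i.+1 < n)%N -> C i = C' i) -> hybrid k D C X = hybrid k D' C' X.
Proof.
move=> eD eC; apply/matrixP => a b; rewrite !mxE; case: ifP => // _.
rewrite eD ?blk_lt//; case: ifP => // _; case: ifP => [/eqP e|_].
  by rewrite eC// -e blk_lt.
by case: ifP => // /eqP e; rewrite eC// -e blk_lt.
Qed.

Lemma hybrid_herm k D C X : (forall i, (i < n)%N -> D i \is hermsymmx) ->
  (forall i, (i.+1 < n)%N -> C i \is hermsymmx) -> X \is hermsymmx ->
  hybrid k D C X \is hermsymmx.
Proof.
move=> hD hC /hermP/matrixP hX; apply/hermP/matrixP => a b; rewrite !mxE andbC.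
case: ifP => _; first by rewrite -[RHS]hX !mxE.
rewrite [blk b == blk a]eq_sym; case: eqP => [e|_].
  by have /hermP/matrixP/(_ (off a) (off b)) := hD _ (blk_lt a); rewrite !mxE e.
case: (eqVneq (blk b) (blk a).+1) => [e|_].
  have -> : (blk a == (blk b).+1) = false by rewrite e ltn_eqF// ltnW.
  have /hC/hermP/matrixP/(_ (off a) (off b)) : ((blk a).+1 < n)%N by rewrite -e blk_lt.
  by rewrite !mxE.
case: eqP => [e|_]; last by rewrite rmorph0.
have /hC/hermP/matrixP/(_ (off a) (off b)) : ((blk b).+1 < n)%N by rewrite -e blk_lt.
by rewrite !mxE.
Qed.

Lemma hybrid_measurable k d (T : measurableType d) (D C : nat -> T -> 'M[R[i]]_p)
  (X : T -> 'M[R[i]]_N) : (forall i, (i < n)%N -> mxmeasurable (D i)) ->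
  (forall i, (i.+1 < n)%N -> mxmeasurable (C i)) -> mxmeasurable X ->
  mxmeasurable (fun w => hybrid k (fun i => D i w) (fun i => C i w) (X w)).
Proof.
move=> mD mC mX a b; under eq_fun do rewrite mxE.
case: (_ && _); first exact: mX.
case: (_ == _); first exact: (mD _ (blk_lt a)).
case: eqP => [e|_]; first by apply: mC; rewrite -e blk_lt.
case: eqP => [e|_]; first by apply: mC; rewrite -e blk_lt.
exact: cmeasurable_cst.
Qed.

Lemma sum_block_dim : (\sum_(i < n) p = N)%N.
Proof. by rewrite sum_nat_const card_ord mulnC. Qed.

(** Position [a] lies in block [a %/ p] with offset [a %% p], while [\mxblock]
    addresses its blocks through [tagnat]; the block sizes being constant, the
    two numberings agree. *)
Lemma hybrid_block_jacobi D C X :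
  hybrid n D C X = castmx (sum_block_dim, sum_block_dim) (block_jacobi n D C).
Proof.
have sigE (s : 'I_(\sum_(i < n) p)) : (tagnat.sig1 s * p + tagnat.sig2 s = s :> nat)%N.
  rewrite -[in RHS](tagnat.sig2K s) tagnat.RankEsum; congr (_ + _)%N.
  by rewrite -(big_ord_widen n (fun=> p) (ltnW (ltn_ord _))) sum_nat_const card_ord.
have sigE' (a : 'I_N) : (tagnat.sig1 (cast_ord (esym sum_block_dim) a) * p +
    tagnat.sig2 (cast_ord (esym sum_block_dim) a) = a)%N by rewrite sigE.
have blkE (a : 'I_N) : blk a = tagnat.sig1 (cast_ord (esym sum_block_dim) a) :> nat.
  by rewrite /blk -sigE' divnMDl// divn_small// addn0.
have offE (a : 'I_N) : off a = tagnat.sig2 (cast_ord (esym sum_block_dim) a).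
  by apply: val_inj; rewrite /= -sigE' modnMDl modn_small.
apply/matrixP => a b; rewrite castmxE /block_jacobi !mxE.
rewrite leqNgt blk_lt/= !blkE !offE val_eqE.
case: ifP => // _; case: ifP => // _; case: ifP => // _.
by rewrite mxE.
Qed.

End blocks.

(** * One block reduction step *)

Section block_householder.
Variables (R : realType) (n p : nat).
Hypothesis p_gt0 : (0 < p)%N.
Variable k : nat.
Hypothesis lt_kn : (k < n)%N.
Local Notation N := (p * n)%N.
Local Notation off := (off p_gt0).
Implicit Types (X : 'M[R[i]]_N).

Fact block_index_subproof (i : 'I_p) : (k * p + i < N)%N.
Proof.
rewrite -(ltn_add2r (p - i)) -addnA subnKC; last exact: ltnW.
rewrite -mulSnr (@leq_ltn_trans (n * p)) ?leq_mul2r ?lt_kn ?orbT// mulnC.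
by rewrite -[X in (X < _)%N]addn0 ltn_add2l subn_gt0.
Qed.

Definition block_index (i : 'I_p) : 'I_N := Ordinal (block_index_subproof i).

Fact tail_index_subproof (j : 'I_(p * (n - k.+1))) : (k.+1 * p + j < N)%N.
Proof.
have -> : (N = k.+1 * p + p * (n - k.+1))%N by rewrite [(k.+1 * p)%N]mulnC -mulnDr subnKC.
by rewrite ltn_add2l.
Qed.

Definition tail_index (j : 'I_(p * (n - k.+1))) : 'I_N := Ordinal (tail_index_subproof j).

Definition diag_block X : 'M[R[i]]_p := mxsub block_index block_index X.
Definition off_block X : 'M[R[i]]_(p, p * (n - k.+1)) := mxsub block_index tail_index X.
(** The new off-diagonal block (b b^H)^(1/2), where b is the part of block row
    [k] to the right of the diagonal. *)
Definition off_root X : 'M[R[i]]_p := msqrt (off_block X *m (off_block X)^t*).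

Definition set_at (F : nat -> 'M[R[i]]_p) (M : 'M[R[i]]_p) i := if i == k then M else F i.

(** The entries outside the corner of block indices beyond [k], which is the part
    of the matrix that determines the change of basis. *)
Definition upto_mask (a b : 'I_N) := (blk a <= k)%N || (blk b <= k)%N.

Lemma blk_block_index i : blk (block_index i) = k.
Proof. by rewrite /blk /= divnMDl// divn_small ?addn0. Qed.

Lemma off_block_index i : off (block_index i) = i.
Proof. by apply: val_inj; rewrite /= modnMDl modn_small. Qed.

Lemma block_indexK a : blk a = k -> block_index (off a) = a.
Proof.
by move=> e; apply: (@blk_off_inj n p p_gt0); rewrite ?blk_block_index ?off_block_index.
Qed.

Lemma blk_tail_index j : (k < blk (tail_index j))%N.
Proof. by rewrite /blk leq_divRL//= leq_addr. Qed.

Lemma tail_index_inj : injective tail_index.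
Proof. by move=> i j /(congr1 val)/= /addnI /val_inj. Qed.

Lemma tail_indexP a : (k < blk a)%N -> exists j, a = tail_index j.
Proof.
rewrite /blk leq_divRL// => ka.
have lt : (a - k.+1 * p < p * (n - k.+1))%N.
  rewrite mulnBr [(k.+1 * p)%N]mulnC ltn_sub2r//.
  by rewrite mulnC (leq_ltn_trans ka)// mulnC.
by exists (Ordinal lt); apply: val_inj; rewrite /= subnKC.
Qed.

Lemma sum_tail (f : 'I_N -> R[i]) :
  \sum_(a | (k < blk a)%N) f a = \sum_j f (tail_index j).
Proof.
transitivity (\sum_(a <- codom tail_index) f a); last by rewrite big_image.
rewrite [RHS]big_uniq/=; last by rewrite map_inj_uniq ?enum_uniq//; exact: tail_index_inj.
apply: eq_bigl => a; apply/idP/codomP => [/tail_indexP//|[j ->]].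
exact: blk_tail_index.
Qed.

Lemma sum_block (f : 'I_N -> R[i]) :
  \sum_(a | blk a == k) f a = \sum_i f (block_index i).
Proof.
rewrite (reindex_onto block_index off).
  by apply: eq_bigl => i; rewrite blk_block_index off_block_index !eqxx.
by move=> a /eqP; exact: block_indexK.
Qed.

End block_householder.

Section block_step.
Variables (R : realType) (n p : nat).
Hypothesis p_gt0 : (0 < p)%N.
Variable k : nat.
Hypothesis lt_kn : (k < n)%N.
Local Notation N := (p * n)%N.
Local Notation off := (off p_gt0).
Local Notation hybrid := (hybrid p_gt0).
Implicit Types (D C : nat -> 'M[R[i]]_p) (X Z : 'M[R[i]]_N).

(** The case split is on whether there is a block [k.+1] to hold [S]. *)
Lemma root_row_gram (S : 'M[R[i]]_p) :
  let T : 'M[R[i]]_(p, N) := \matrix_(i, b) if blk b == k.+1 then S i (off b) else 0 in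
  T *m T^t* = if (k.+1 < n)%N then S *m S^t* else 0.
Proof.
move=> T; apply/matrixP => i j; rewrite mxE.
transitivity (\sum_(b : 'I_N | blk b == k.+1) S i (off b) * Num.conj (S j (off b))).
  rewrite [RHS]big_mkcond; apply: eq_bigr => b _; rewrite !mxE.
  by case: ifP => _; rewrite ?mul0r.
case: ifP => [lt_k1n|/negbT ge_k1n]; last first.
  rewrite mxE big_pred0// => b; apply/negP => /eqP e.
  by move: ge_k1n; rewrite -e blk_lt.
rewrite (sum_block p_gt0 lt_k1n (fun b => S i (off b) * Num.conj (S j (off b)))) mxE.
by apply: eq_bigr => l _; rewrite !mxE off_block_index.
Qed.

Lemma off_row_gram X :
  let B : 'M[R[i]]_(p, N) := \matrix_(i, b) if (k < blk b)%N then X (block_index lt_kn i) b else 0 in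
  B *m B^t* = off_block lt_kn X *m (off_block lt_kn X)^t*.
Proof.
move=> B; apply/matrixP => i j; rewrite mxE.
transitivity (\sum_(b : 'I_N | (k < blk b)%N)
   X (block_index lt_kn i) b * Num.conj (X (block_index lt_kn j) b)).
  rewrite [RHS]big_mkcond; apply: eq_bigr => b _; rewrite !mxE.
  by case: ifP => _; rewrite ?mul0r.
by rewrite (sum_tail p_gt0 lt_kn) mxE; apply: eq_bigr => l _; rewrite !mxE.
Qed.

(** Both [X]'s off-diagonal block row, extended by zero, and its replacement are
    orthogonal to the basis vectors of the blocks up to [k] and have the same
    Gram matrix; Witt extension applied with these basis vectors adjoined gives
    a [W] that fixes them. *)
Lemma block_unitary X : exists2 W : 'M[R[i]]_N, W \is unitarymx &
  (forall a b, (blk a <= k)%N -> W a b = (a == b)%:R) /\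
  (forall i b, \sum_(d : 'I_N | (k < blk d)%N) X (block_index lt_kn i) d * W d b =
     if blk b == k.+1 then off_root lt_kn X i (off b) else 0).
Proof.
(* The rows of E0 are the basis vectors to be fixed. *)
pose E0 : 'M[R[i]]_N := \matrix_(a, b) ((a == b) && (blk a <= k)%N)%:R.
pose B : 'M[R[i]]_(p, N) := \matrix_(i, b) if (k < blk b)%N then X (block_index lt_kn i) b else 0.
pose T : 'M[R[i]]_(p, N) := \matrix_(i, b) if blk b == k.+1 then off_root lt_kn X i (off b) else 0.
have E0M (M : 'M[R[i]]_(p, N)) : (forall i b, (blk b <= k)%N -> M i b = 0) ->
    M *m E0^t* = 0 /\ E0 *m M^t* = 0.
  move=> M0; have e : M *m E0^t* = 0.
    apply/matrixP => i b; rewrite !mxE big1// => d _; rewrite !mxE.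
    case: eqP => [->|_] /=; last by rewrite rmorph0 mulr0.
    by case: leqP => [/M0 ->|_]; rewrite ?mul0r ?rmorph0 ?mulr0.
  split=> //; have := congr1 (fun M : 'M[R[i]]__ => M^t*) e.
  by rewrite trmx_mul map_mxM trmxCK trmx0 map_mx0.
have [B1 B2] : B *m E0^t* = 0 /\ E0 *m B^t* = 0.
  by apply: E0M => i b; rewrite mxE ltnNge => ->.
have [T1 T2] : T *m E0^t* = 0 /\ E0 *m T^t* = 0.
  by apply: E0M => i b; rewrite mxE; case: eqP => // ->; rewrite ltnn.
have BT : B *m B^t* = T *m T^t*.
  rewrite off_row_gram root_row_gram; case: ifP => [_|/negbT]; first by rewrite msqrt_gram.
  rewrite -leqNgt => nk; apply/matrixP => i j; rewrite !mxE big1// => l.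
  have z : (p * (n - k.+1) = 0)%N by apply/eqP; rewrite muln_eq0 subn_eq0 nk orbT.
  by have := ltn_ord l; rewrite [X in (_ < X)%N]z.
have [W uW WE] : exists2 W : 'M[R[i]]_N, W \is unitarymx & col_mx E0 B *m W = col_mx E0 T.
  apply: witt_extension; rewrite !tr_col_mx !map_row_mx !mul_col_row.
  by rewrite B1 B2 T1 T2 BT.
move: WE; rewrite mul_col_mx => /eq_col_mx[WE0 WB].
exists W => //; split.
  move=> a b ak; have /matrixP/(_ a b) := WE0; rewrite !mxE ak andbT => <-.
  rewrite (bigD1 a)//= big1 ?addr0; first by rewrite mxE eqxx ak mul1r.
  by move=> d /negPf da; rewrite mxE eq_sym da mul0r.
move=> i b; have /matrixP/(_ i b) := WB; rewrite !mxE => <-.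
rewrite big_mkcond; apply: eq_bigr => d _; rewrite mxE.
by case: ifP => _; rewrite ?mul0r.
Qed.

Lemma unitary_fixed_columns (W : 'M[R[i]]_N) : W \is unitarymx ->
  (forall a b, (blk a <= k)%N -> W a b = (a == b)%:R) ->
  forall c a, (blk a <= k)%N -> W c a = (c == a)%:R.
Proof.
move=> uW fW c a ak; have /matrixP/(_ c a) := unitary_adjr uW; rewrite !mxE => <-.
rewrite (bigD1 a)//= !mxE (fW a a ak) eqxx rmorph1 mulr1 big1 ?addr0// => d /negPf da.
by rewrite !mxE (fW a d ak) eq_sym da rmorph0 mulr0.
Qed.

(** The change of basis acts on the rows of block index [k] through
    [block_unitary], on earlier rows trivially because their entries beyond
    block [k] vanish, and on the corner by conjugation. *)
Lemma hybrid_step D C X : (forall i, (i < n)%N -> D i \is hermsymmx) ->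
  (forall i, (i.+1 < n)%N -> C i \is hermsymmx) -> X \is hermsymmx ->
  exists2 V : 'M[R[i]]_N, V \is unitarymx &
  (forall a b, (blk a <= k)%N -> V a b = (a == b)%:R) /\
  forall Z, Z \is hermsymmx ->
  V *m hybrid k D C (mixmx (@upto_mask n p k) X Z) *m V^t* =
  hybrid k.+1 (set_at k D (diag_block lt_kn X)) (set_at k C (off_root lt_kn X)) (V *m Z *m V^t*).
Proof.
move=> hD hC hX; have [W uW [Wrow WX]] := block_unitary X.
have Wcol := unitary_fixed_columns uW Wrow.
pose V := W^t*; have uV : V \is unitarymx by rewrite trmxC_unitary.
have VE a b : V a b = Num.conj (W b a) by rewrite !mxE.
have Vrow a b : (blk a <= k)%N -> V a b = (a == b)%:R.
  by move=> ak; rewrite VE Wcol// rmorph_nat eq_sym.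
have Vcol a b : (blk b <= k)%N -> V a b = (a == b)%:R.
  by move=> bk; rewrite VE Wrow// rmorph_nat eq_sym.
exists V => //; split=> // Z hZ; rewrite [V^t*]trmxCK.
set F := hybrid k D C _; set G := hybrid k.+1 _ _ _.
have hF : F \is hermsymmx.
  apply: (hybrid_herm p_gt0 k hD hC); apply: (mixmx_herm _ hX hZ) => a b.
  by rewrite /upto_mask orbC.
have hG : G \is hermsymmx.
  apply: hybrid_herm.
  - move=> i ilt; rewrite /set_at; case: ifP => _; last exact: hD.
    apply/hermP/matrixP => a b; have /hermP/matrixP/(_ (block_index lt_kn a) (block_index lt_kn b)) := hX.
    by rewrite !mxE.
  - by move=> i ilt; rewrite /set_at; case: ifP => _; [exact: msqrt_herm|exact: hC].
  - by move/hermP: hZ => hZ; apply/hermP; rewrite !trmx_mul !map_mxM trmxCK hZ mulmxA.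
have hL : V *m F *m W \is hermsymmx.
  move/hermP: hF => hF; apply/hermP.
  by rewrite !trmx_mul !map_mxM trmxCK hF mulmxA.
(* By Hermitian symmetry it suffices to treat the rows up to block [k] and the
   corner. *)
have upper a b : (blk a <= k)%N -> (V *m F *m W) a b = G a b.
  move=> ak.
  have -> : (V *m F *m W) a b = \sum_d F a d * W d b.
    rewrite mxE; apply: eq_bigr => d _; congr (_ * _); rewrite mxE (bigD1 a)//=.
    rewrite Vrow// eqxx mul1r big1 ?addr0// => c /negPf ca.
    by rewrite Vrow// eq_sym ca mul0r.
  have [bk|kb] := leqP (blk b) k.
    rewrite (bigD1 b)//= Wcol// eqxx mulr1 big1 ?addr0; last first.
      by move=> d /negPf db; rewrite Wcol// db mulr0.
    rewrite /F /G !mxE /upto_mask ak /= ltnNge ak/=.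
    have [eka|nka] := eqVneq (blk a) k.
      rewrite eka leqnn/=; have [kb|bk'] := leqP k (blk b).
        have ekb : blk b = k by apply/eqP; rewrite eqn_leq bk kb.
        by rewrite ekb eqxx /set_at eqxx mxE !block_indexK.
      rewrite (gtn_eqF bk') /set_at (ltn_eqF (leq_trans bk' (leqnSn k))).
      by rewrite (ltn_eqF bk').
    have ka : (blk a < k)%N by rewrite ltn_neqAle nka.
    rewrite leqNgt ka/= /set_at (negPf nka).
    case: ifP => // _; case: ifP => // _; case: eqP => // e.
    by rewrite ifN// neq_ltn -e (ltnW ka)// ltnS -ltnS -e ka.
  have dW d : (blk d <= k)%N -> W d b = 0.
    move=> dk; rewrite Wrow//; case: eqP => // e.
    by move: kb; rewrite -e ltnNge dk.
  have -> : \sum_d F a d * W d b = \sum_(d : 'I_N | (k < blk d)%N) F a d * W d b.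
    rewrite [RHS]big_mkcond; apply: eq_bigr => d _; case: ltnP => // dk.
    by rewrite dW// mulr0.
  have nab : (blk a == blk b) = false by rewrite ltn_eqF// (leq_ltn_trans ak).
  have nab1 : (blk a == (blk b).+1) = false.
    by rewrite ltn_eqF// (leq_ltn_trans ak)// ltnW.
  rewrite /G mxE ltnNge ak/= nab nab1.
  have [eka|nka] := eqVneq (blk a) k.
    rewrite eka /set_at eqxx -WX; apply: eq_bigr => d kd.
    by rewrite /F !mxE eka leqnn (ltnW kd)/= /upto_mask eka leqnn/= block_indexK.
  have ka : (blk a < k)%N by rewrite ltn_neqAle nka.
  have -> : (blk b == (blk a).+1) = false.
    by rewrite gtn_eqF// (leq_trans _ kb).
  apply: big1 => d kd; rewrite /F mxE leqNgt ka/=.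
  rewrite (ltn_eqF (leq_ltn_trans ak kd)) gtn_eqF ?(leq_trans _ kd)//.
  by rewrite ltn_eqF ?mul0r// (leq_ltn_trans ak)// ltnW.
apply/matrixP => a b; have [ak|ka] := leqP (blk a) k; first exact: upper.
have [bk|kb] := leqP (blk b) k.
  have /hermP/matrixP/(_ a b) := hL; rewrite mxE [_^T _ _]mxE upper// => <-.
  by have /hermP/matrixP/(_ a b) := hG; rewrite mxE [_^T _ _]mxE.
rewrite /G [RHS]mxE ka kb/= [LHS]mxE [RHS]mxE; apply: eq_bigr => d _.
have [dk|kd] := leqP (blk d) k.
  rewrite Wrow//; case: eqP => [e|_]; last by rewrite !mulr0.
  by move: kb; rewrite -e ltnNge dk.
congr (_ * _); rewrite !mxE; apply: eq_bigr => c _.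
have [ck|kc] := leqP (blk c) k.
  rewrite Vcol//; case: eqP => [e|_]; last by rewrite !mul0r.
  by move: ka; rewrite e ltnNge ck.
by rewrite /F !mxE (ltnW kc) (ltnW kd)/= /upto_mask [(blk c <= k)%N]leqNgt [(blk d <= k)%N]leqNgt kc kd.
Qed.

End block_step.

(** * Comparison of probabilities *)

Section telescope.
Variables (R : realType) (n p : nat).
Hypothesis p_gt0 : (0 < p)%N.
Local Notation N := (p * n)%N.
Local Notation hybrid := (hybrid p_gt0).
Context d (T : measurableType d) (P : probability T R).
Context d' (T' : measurableType d') (P' : probability T' R).
Variables (D C : nat -> T -> 'M[R[i]]_p).
Hypothesis D_GUE : forall k, (k < n)%N -> is_GUE P (D k).
Hypothesis C_random : forall k, (k.+1 < n)%N -> random_element (@mx_borel R p p) (C k).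
Hypothesis C_psd : forall k, (k.+1 < n)%N -> forall w, psdmx (C k w).
Hypothesis C_LUE : forall k, (k.+1 < n)%N ->
  is_LUE P (p * (n - k.+1)) (fun w => C k w ^+ 2).
Hypothesis DC_independent : independent P (@mx_borel R p p)
  (fun s : 'I_n + 'I_n.-1 => match s with inl k => D k | inr k => C k end).
Variable X : T' -> 'M[R[i]]_N.
Hypothesis X_GUE : is_GUE P' X.

(* In the application [E] is an event about the spectral measure, which a
   change of basis fixing the first block does not affect. *)
Variable E : set 'M[R[i]]_N.
Hypothesis mE : @mx_borel R N N E.
Hypothesis invE : forall V H, V \is unitarymx ->
  (forall a b, (blk a <= 0)%N -> V a b = (a == b)%:R) ->
  E (V *m H *m V^t*) <-> E H.

Let mD k : (k < n)%N -> mxmeasurable (D k).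
Proof. by move=> /D_GUE[/mxmeasurableP]. Qed.

Let mC k : (k.+1 < n)%N -> mxmeasurable (C k).
Proof. by move=> /C_random/mxmeasurableP. Qed.

Let mX : mxmeasurable X. Proof. by have [/mxmeasurableP] := X_GUE. Qed.

Let hX w : X w \is hermsymmx. Proof. by have [_ h _ _ _] := X_GUE. Qed.

Lemma measurable_event d0 (U : measurableType d0) (H : U -> 'M[R[i]]_N) :
  mxmeasurable H -> measurable [set w | E (H w)].
Proof. by move=> /mxmeasurableP; apply. Qed.

Let DC (w : T) (s : 'I_n + 'I_n.-1) : 'M[R[i]]_p :=
  match s with inl k => D k w | inr k => C k w end.

(* The marginals are those of the given blocks; [diag_block_law] and
   [off_root_law] recognise them in the blocks extracted from [X]. *)
Let mu (s : 'I_n + 'I_n.-1) (A : set 'M[R[i]]_p) : \bar R := P (DC ^~ s @^-1` A).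

Let Dof (f : 'I_n + 'I_n.-1 -> 'M[R[i]]_p) k : 'M[R[i]]_p :=
  if insub k is Some i then f (inl i) else 0.

Let Cof (f : 'I_n + 'I_n.-1 -> 'M[R[i]]_p) k : 'M[R[i]]_p :=
  if insub k is Some i then f (inr i) else 0.

Let DofE f k (lt_kn : (k < n)%N) : Dof f k = f (inl (Ordinal lt_kn)).
Proof. by rewrite /Dof insubT. Qed.

Let CofE f k (lt_kn : (k < n.-1)%N) : Cof f k = f (inr (Ordinal lt_kn)).
Proof. by rewrite /Cof insubT. Qed.

Let mx_borel_algebra m q : sigma_algebra setT (@mx_borel R m q).
Proof. exact: initial_sigma_algebra. Qed.

Let mu1 s : mu s setT = 1%E.
Proof. by rewrite /mu preimage_setT probability_setT. Qed.

Let DC_measurable s : mxmeasurable (DC ^~ s).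
Proof.
by case: s => k; [exact: mD|apply: mC; rewrite -ltn_predRL].
Qed.

Let DC_law : has_product_law (@mx_borel R p p) P mu DC.
Proof.
split; first by move=> s; apply/mxmeasurableP; exact: DC_measurable.
move=> B FB; have := DC_independent (J := [set: _]%SET) (A := B) (fun s _ => FB s).
rewrite (_ : \bigcap_(i in _) _ = [set w | forall s, B s (DC w s)]); last first.
  apply/seteqP; split => w /=.
    by move=> h s; have := h s; rewrite /= inE => /(_ isT); case: s.
  by move=> h s _; have := h s; case: s.
move=> ->; rewrite (eq_bigl predT); last by move=> s; rewrite inE.
by apply: eq_bigr => s _; rewrite /mu; case: s.
Qed.

Section one_step.
Variable k : nat.
Hypothesis lt_kn : (k < n)%N.

Lemma diag_block_law A : @mx_borel R p p A ->
  P' [set w | A (diag_block lt_kn (X w))] = mu (inl (Ordinal lt_kn)) A.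
Proof.
move=> mA; have mono (i j : 'I_p) : (block_index lt_kn i < block_index lt_kn j)%N = (i < j)%N.
  by rewrite /= ltn_add2l.
by have [_ _ /(_ A mA)] := gue_block mono X_GUE (D_GUE lt_kn).
Qed.

(** Here b b^H has the law of [C k ^+ 2], and [C k] is recovered from its square
    by [msqrt] because it is positive semidefinite. *)
Lemma off_root_law (lt_k : (k < n.-1)%N) A : @mx_borel R p p A ->
  P' [set w | A (off_root lt_kn (X w))] = mu (inr (Ordinal lt_k)) A.
Proof.
move=> mA; have lt_k1n : (k.+1 < n)%N by rewrite -ltn_predRL.
have [d0 [T0 [P0 [G [GG lawG]]]]] := C_LUE lt_k1n.
have ib : injective (@block_index n p k lt_kn).
  by move=> i j /(congr1 val)/= /addnI /val_inj.
have lt_bt (i : 'I_p) (j : 'I_(p * (n - k.+1))) : (block_index lt_kn i < tail_index lt_kn j)%N.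
  rewrite /= mulSn [(p + _)%N]addnC -addnA ltn_add2l.
  exact: leq_trans (ltn_ord i) (leq_addr _ _).
have lawX := gue_offblock ib (@tail_index_inj n p k lt_kn) lt_bt X_GUE GG.
have mA' : @mx_borel R p p (@msqrt R p @^-1` A).
  exact: (mxmeasurable_preimage (msqrt_measurable (@mxmeasurable_id R p p)) mA).
have mA2 : @mx_borel R p (p * (n - k.+1)) [set b | A (msqrt (b *m b^t*))].
  have mid := @mxmeasurable_id R p (p * (n - k.+1)).
  exact: (mxmeasurable_preimage
    (msqrt_measurable (mxmeasurableM mid (mxmeasurable_adj mid))) mA).
transitivity (P0 [set w | A (msqrt (G w *m (G w)^t*))]).
  by have [_ _ /(_ _ mA2)] := lawX.
have [_ _ /(_ _ mA') <-] := lawG.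
congr (P _); apply/seteqP; split => w /=; rewrite expr2 -[_ * _]/(_ *m _) sqr_msqrt//; exact: C_psd.
Qed.

Lemma diag_block_measurable d0 (U : measurableType d0) (H : U -> 'M[R[i]]_N) :
  mxmeasurable H -> mxmeasurable (fun w => diag_block lt_kn (H w)).
Proof. by move=> mH i j; under eq_fun do rewrite mxE; exact: mH. Qed.

Lemma off_root_measurable d0 (U : measurableType d0) (H : U -> 'M[R[i]]_N) :
  mxmeasurable H -> mxmeasurable (fun w => off_root lt_kn (H w)).
Proof.
move=> mH; apply: msqrt_measurable.
have mO : mxmeasurable (fun w => off_block lt_kn (H w)).
  by move=> i j; under eq_fun do rewrite mxE; exact: mH.
by apply: mxmeasurableM => //; exact: mxmeasurable_adj.
Qed.

(** The diagonal block may be resampled without affecting the off-diagonal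
    one. *)
Lemma diag_off_indep A A' : @mx_borel R p p A -> @mx_borel R p p A' ->
  P' [set w | A (diag_block lt_kn (X w)) /\ A' (off_root lt_kn (X w))] =
  (P' [set w | A (diag_block lt_kn (X w))] * P' [set w | A' (off_root lt_kn (X w))])%E.
Proof.
move=> mA mA'.
pose mask (a b : 'I_N) := (blk a == k) && (blk b == k).
have sm : symmetric mask by move=> a b; rewrite /mask andbC.
have [_ _ law] := gue_mix sm X_GUE X_GUE.
have mAA : @mx_borel R N N [set H | A (diag_block lt_kn H) /\ A' (off_root lt_kn H)].
  have m1 := mxmeasurable_preimage (diag_block_measurable (@mxmeasurable_id R N N)) mA.
  have m2 := mxmeasurable_preimage (off_root_measurable (@mxmeasurable_id R N N)) mA'.
  exact: (measurableI _ _ m1 m2).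
rewrite -[LHS](law _ mAA).
rewrite (_ : _ @^-1` _ = [set w | A (diag_block lt_kn (X w))] `*`
   [set w | A' (off_root lt_kn (X w))]); last first.
  have e1 (x y : 'M[R[i]]_N) : diag_block lt_kn (mixmx mask x y) = diag_block lt_kn x.
    by apply/matrixP => i j; rewrite !mxE /mask !blk_block_index// eqxx.
  have e2 (x y : 'M[R[i]]_N) : off_root lt_kn (mixmx mask x y) = off_root lt_kn y.
    rewrite /off_root (_ : off_block _ _ = off_block lt_kn y)//; apply/matrixP => i j.
    by rewrite !mxE /mask (gtn_eqF (blk_tail_index p_gt0 lt_kn _)) andbF.
  by apply/seteqP; split => -[x y] /=; rewrite e1 e2.
apply: product_measure1E.
- exact: (mxmeasurable_preimage (diag_block_measurable mX) mA).
- exact: (mxmeasurable_preimage (off_root_measurable mX) mA').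
Qed.

(* Replacing block number [k] of the block-tridiagonal family by the blocks
   extracted from [X] does not change the law of the family. *)
Let kept (s : 'I_n + 'I_n.-1) : bool :=
  match s with inl i => i != k :> nat | inr i => i != k :> nat end.

Let fresh (w : T') (s : 'I_n + 'I_n.-1) : 'M[R[i]]_p :=
  match s with inl _ => diag_block lt_kn (X w) | inr _ => off_root lt_kn (X w) end.

Let DC' (z : T * T') s := if kept s then DC z.1 s else fresh z.2 s.

Let fresh_law (B : 'I_n + 'I_n.-1 -> set 'M[R[i]]_p) :
  (forall s, @mx_borel R p p (B s)) ->
  P' [set w | forall s, ~~ kept s -> B s (fresh w s)] =
  (\prod_(s | ~~ kept s) mu s (B s))%E.
Proof.
move=> FB; pose ok : 'I_n := Ordinal lt_kn.
rewrite (bigD1 (inl ok))/=; last by rewrite negbK.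
have keptl (i : 'I_n) : ~~ kept (inl i) -> i = ok.
  by rewrite /= negbK => /eqP e; exact: val_inj.
have [lt_k|ge_k] := ltnP k n.-1.
  have keptr (i : 'I_n.-1) : ~~ kept (inr i) -> i = Ordinal lt_k.
    by rewrite /= negbK => /eqP e; exact: val_inj.
  rewrite (big_pred1 (inr (Ordinal lt_k))); last first.
    move=> [i|i] /=.
      by apply/negbTE/negP => /andP[/keptl -> ]; rewrite eqxx.
    rewrite andbT; apply/idP/eqP => [/keptr -> //|[->]].
    by rewrite negbK.
  rewrite -diag_block_law// -(off_root_law lt_k)// -diag_off_indep//.
  congr (P' _); apply/seteqP; split => w /=.
    move=> h; split; first by apply: (h (inl ok)); rewrite /= negbK.
    by apply: (h (inr (Ordinal lt_k))); rewrite /= negbK.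
  by move=> [h1 h2] [i /keptl ->|i /keptr ->].
rewrite big1 ?mule1; last first.
  move=> [i|i] /andP[/=].
    by move=> /keptl ->; rewrite eqxx.
  by rewrite negbK => /eqP e; have := ltn_ord i; rewrite e ltnNge ge_k.
rewrite -diag_block_law//; congr (P' _); apply/seteqP; split => w /=.
  by move=> h; apply: (h (inl ok)); rewrite /= negbK.
move=> h [i /keptl -> //|i /=].
by rewrite negbK => /eqP e; have := ltn_ord i; rewrite e ltnNge ge_k.
Qed.

Let DC'_same_law : same_law (P \x P')%E P
  (@family_sigma _ (@mx_borel R p p) ('I_n + 'I_n.-1)%type) DC' DC.
Proof.
apply: (product_law_unique (mx_borel_algebra p p) _ DC_law).
apply: (product_law_replace (mx_borel_algebra p p) mu1 DC_law _ fresh_law).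
by move=> [i|i] _; apply/mxmeasurableP; [exact: diag_block_measurable|exact: off_root_measurable].
Qed.

Let coord_measurable s : mxmeasurable
  (T := family_space (@mx_borel R p p) ('I_n + 'I_n.-1)%type) (fun f => f s).
Proof. by apply/mxmeasurableP => A mA; apply: sub_sigma_algebra; exists s, A. Qed.

Let Dof_measurable i : mxmeasurable
  (T := family_space (@mx_borel R p p) ('I_n + 'I_n.-1)%type) (Dof ^~ i).
Proof.
rewrite /Dof; case: insubP => [u _ _|_]; first exact: coord_measurable.
exact: mxmeasurable_cst.
Qed.

Let Cof_measurable i : mxmeasurable
  (T := family_space (@mx_borel R p p) ('I_n + 'I_n.-1)%type) (Cof ^~ i).
Proof.
rewrite /Cof; case: insubP => [u _ _|_]; first exact: coord_measurable.
exact: mxmeasurable_cst.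
Qed.

Let replace_law (x : 'M[R[i]]_N) :
  (P \x P')%E [set z | E (hybrid k.+1
     (set_at k (fun i => D i z.1) (diag_block lt_kn (X z.2)))
     (set_at k (fun i => C i z.1) (off_root lt_kn (X z.2))) x)] =
  P [set w | E (hybrid k.+1 (fun i => D i w) (fun i => C i w) x)].
Proof.
have [_ _ law] := DC'_same_law.
have mH : mxmeasurable (T := family_space (@mx_borel R p p) ('I_n + 'I_n.-1)%type)
    (fun f => hybrid k.+1 (Dof f) (Cof f) x).
  apply: (hybrid_measurable p_gt0 k.+1 (fun i _ => Dof_measurable i) (fun i _ => Cof_measurable i)).
  exact: mxmeasurable_cst.
have := law _ (measurable_event mH).
rewrite (_ : DC' @^-1` _ = [set z | E (hybrid k.+1
     (set_at k (fun i => D i z.1) (diag_block lt_kn (X z.2)))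
     (set_at k (fun i => C i z.1) (off_root lt_kn (X z.2))) x)]); last first.
  apply/funext => z /=; congr (E _); apply: eq_hybrid => i lt_i.
    by rewrite DofE /DC' /set_at /=; case: (i == k).
  have lt_i' : (i < n.-1)%N by rewrite ltn_predRL.
  by rewrite CofE /DC' /set_at /=; case: (i == k).
move=> ->; congr (P _); apply/funext => w /=; congr (E _); apply: eq_hybrid => i lt_i.
  by rewrite DofE.
have lt_i' : (i < n.-1)%N by rewrite ltn_predRL.
by rewrite CofE.
Qed.

(** For frozen blocks [D] and [C], resample the corner of [X]; then the outer
    part [x] can be frozen as well, and with it the unitary [V] of
    [hybrid_step], which acts on a corner of unitarily invariant law. *)
Let householder_law (w : T) :
  P' [set w' | E (hybrid k (fun i => D i w) (fun i => C i w) (X w'))] =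
  (P' \x P')%E [set z | E (hybrid k.+1
     (set_at k (fun i => D i w) (diag_block lt_kn (X z.1)))
     (set_at k (fun i => C i w) (off_root lt_kn (X z.1))) (X z.2))].
Proof.
pose D0 i := D i w; pose C0 i := C i w.
have hD i : (i < n)%N -> D0 i \is hermsymmx by move=> /D_GUE[_ h _ _ _]; exact: h.
have hC i : (i.+1 < n)%N -> C0 i \is hermsymmx by move=> /C_psd/(_ w)[].
have sm : symmetric (@upto_mask n p k) by move=> a b; rewrite /upto_mask orbC.
have [_ _ law] := gue_mix sm X_GUE X_GUE.
have mEj j (D1 C1 : nat -> 'M[R[i]]_p) :
    @mx_borel R N N [set H | E (hybrid j D1 C1 H)].
  apply: (@measurable_event _ (mx_space R N N)).
  apply: (hybrid_measurable p_gt0 j (D := fun i (_ : mx_space R N N) => D1 i)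
    (C := fun i (_ : mx_space R N N) => C1 i)).
  - by move=> i _; exact: mxmeasurable_cst.
  - by move=> i _; exact: mxmeasurable_cst.
  - exact: mxmeasurable_id.
rewrite -[LHS](law _ (mEj _ _ _)); apply: prod_probability_eq1 => x.
have [V uV [fV VE]] := hybrid_step p_gt0 lt_kn hD hC (hX x).
have [_ _ lawV] := gue_unitary X_GUE uV.
pose D1 := set_at k D0 (diag_block lt_kn (X x)).
pose C1 := set_at k C0 (off_root lt_kn (X x)).
transitivity (P' [set w' | E (hybrid k.+1 D1 C1 (V *m X w' *m V^t*))]).
  congr (P' _); apply/funext => y; apply/propext; rewrite xsectionE /=.
  rewrite -VE//; apply: iff_sym; apply: invE => // a b a0.
  by apply: fV; rewrite (leq_trans a0).
transitivity (P' [set w' | E (hybrid k.+1 D1 C1 (X w'))]); first exact: (lawV _ (mEj _ _ _)).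
by congr (P' _); apply/funext => y; apply/propext; rewrite xsectionE.
Qed.

Let hybrid_DC_measurable d0 (U : measurableType d0) j (f : U -> T) (g : U -> T') :
  measurable_fun setT f -> measurable_fun setT g ->
  measurable [set u | E (hybrid j (fun i => D i (f u)) (fun i => C i (f u)) (X (g u)))].
Proof.
move=> mf mg; apply: measurable_event.
apply: (hybrid_measurable p_gt0 j (D := fun i u => D i (f u)) (C := fun i u => C i (f u))).
- by move=> i /mD; exact: mxmeasurable_comp.
- by move=> i /mC; exact: mxmeasurable_comp.
- exact: (mxmeasurable_comp mg mX).
Qed.

(** First [householder_law] for frozen [D] and [C]; then, for a frozen corner,
    the extracted blocks are absorbed into the independent family by
    [replace_law]. *)
Lemma hybrid_probability_step :
  (P \x P')%E [set z | E (hybrid k (fun i => D i z.1) (fun i => C i z.1) (X z.2))] =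
  (P \x P')%E [set z | E (hybrid k.+1 (fun i => D i z.1) (fun i => C i z.1) (X z.2))].
Proof.
pose B : set (T * (T' * T')) := [set z | E (hybrid k.+1
     (set_at k (fun i => D i z.1) (diag_block lt_kn (X z.2.1)))
     (set_at k (fun i => C i z.1) (off_root lt_kn (X z.2.1))) (X z.2.2))].
have m21 : measurable_fun setT (fun z : T * (T' * T') => z.2.1).
  exact: (measurableT_comp measurable_fst measurable_snd).
have m22 : measurable_fun setT (fun z : T * (T' * T') => z.2.2).
  exact: (measurableT_comp measurable_snd measurable_snd).
have mB : measurable B.
  apply: measurable_event; apply: (hybrid_measurable p_gt0 k.+1
    (D := fun i z => set_at k (fun i => D i z.1) (diag_block lt_kn (X z.2.1)) i)
    (C := fun i z => set_at k (fun i => C i z.1) (off_root lt_kn (X z.2.1)) i)).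
  - move=> i lt_i; rewrite /set_at; case: (i == k).
      exact: (diag_block_measurable (mxmeasurable_comp m21 mX)).
    exact: (mxmeasurable_comp measurable_fst (mD lt_i)).
  - move=> i lt_i; rewrite /set_at; case: (i == k).
      exact: (off_root_measurable (mxmeasurable_comp m21 mX)).
    exact: (mxmeasurable_comp measurable_fst (mC lt_i)).
  - exact: (mxmeasurable_comp m22 mX).
transitivity ((P \x (P' \x P'))%E B).
  apply: prod_probability_eq1 => w.
  transitivity (P' [set w' | E (hybrid k (fun i => D i w) (fun i => C i w) (X w'))]).
    by congr (P' _); apply/funext => y; apply/propext; rewrite xsectionE.
  rewrite householder_law; congr (_ _).
  by apply/funext => y; apply/propext; rewrite xsectionE.
rewrite prod_probabilityA//; apply: prod_probability_eq2.
- rewrite -[X in measurable X]setTI.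
  have mt : measurable_fun setT (fun u : T * T' * T' => (u.1.1, (u.1.2, u.2))).
    apply/measurable_fun_pairP; split => /=.
      exact: (measurableT_comp measurable_fst measurable_fst).
    apply/measurable_fun_pairP; split; last exact: measurable_snd.
    exact: (measurableT_comp measurable_snd measurable_fst).
  exact: (mt measurableT _ mB).
- exact: (hybrid_DC_measurable k.+1 measurable_fst measurable_snd).
move=> y; transitivity (P [set w | E (hybrid k.+1 (fun i => D i w) (fun i => C i w) (X y))]).
  rewrite -replace_law; congr (_ _).
  by apply/funext => z; apply/propext; rewrite ysectionE.
by congr (P _); apply/funext => z; apply/propext; rewrite ysectionE.
Qed.

End one_step.

Lemma hybrid_probability k : (k <= n)%N ->
  (P \x P')%E [set z | E (hybrid k (fun i => D i z.1) (fun i => C i z.1) (X z.2))] =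
  P' [set w | E (X w)].
Proof.
elim: k => [_|k IH lt_kn]; last by rewrite -hybrid_probability_step// IH// ltnW.
under eq_set do rewrite hybrid0.
transitivity ((P \x P')%E (setT `*` [set w | E (X w)])).
  by congr (_ _); apply/seteqP; split => z //= -[].
transitivity (P setT * P' [set w | E (X w)])%E.
  by apply: product_measure1E => //; exact: measurable_event.
by rewrite probability_setT mul1e.
Qed.

Lemma block_jacobi_probability :
  P [set w | E (castmx (sum_block_dim n p, sum_block_dim n p)
     (block_jacobi n (fun k => D k w) (fun k => C k w)))] = P' [set w | E (X w)].
Proof.
rewrite -(hybrid_probability (leqnn n)).
under [in RHS]eq_set do rewrite hybrid_block_jacobi.
set A := [set w | _].
have mA : measurable A.
  have mH : mxmeasurable (fun w => hybrid n (D^~ w) (C^~ w) (0 : 'M[R[i]]_N)).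
    exact: (hybrid_measurable p_gt0 n mD mC (@mxmeasurable_cst R _ T _ _ 0)).
  have := measurable_event mH; congr (measurable _); apply/funext => w.
  by rewrite /= hybrid_block_jacobi.
transitivity ((P \x P')%E (A `*` setT)); last first.
  by congr (_ _); apply/seteqP; split => z //= -[].
transitivity (P A * P' setT)%E; last first.
  by apply/esym; exact: product_measure1E.
by rewrite probability_setT mule1.
Qed.

End telescope.

Lemma spectral_measure_castmx (R : realType) p N N' (e : N = N') (le_pN : (p <= N)%N)
  (le_pN' : (p <= N')%N) (H : 'M[R[i]]_N) :
  spectral_measure le_pN' (castmx (e, e) H) = spectral_measure le_pN H.
Proof. by subst N'; rewrite castmx_id (bool_irrelevance le_pN le_pN'). Qed.

Theorem lemma6p1 (R : realType) (n p : nat) (n_gt0 : (0 < n)%N) (p_gt0 : (0 < p)%N)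
    (d : measure_display) (T : measurableType d) (P : probability T R)
    (D C : nat -> T -> 'M[R[i]]_p)
    (D_GUE : forall k, (k < n)%N -> is_GUE P (D k))
    (C_random : forall k, (k.+1 < n)%N -> random_element (@mx_borel R p p) (C k))
    (C_psd : forall k, (k.+1 < n)%N -> forall w, psdmx (C k w))
    (C_LUE : forall k, (k.+1 < n)%N ->
       is_LUE P (p * (n - k.+1)) (fun w => C k w ^+ 2))
    (DC_independent : independent P (@mx_borel R p p)
       (fun s : 'I_n + 'I_n.-1 => match s with inl k => D k | inr k => C k end))
    (d' : measure_display) (T' : measurableType d') (P' : probability T' R)
    (X : T' -> 'M[R[i]]_(p * n)) (X_GUE : is_GUE P' X) :
  same_law P P' (@mxm_sigma R p)
    (fun w => spectral_measure (leq_block_dim p n_gt0)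
       (block_jacobi n (fun k => D k w) (fun k => C k w)))
    (fun w => spectral_measure (leq_pmulr p n_gt0) (X w)).
Proof.
have mD k : (k < n)%N -> mxmeasurable (D k) by move=> /D_GUE[/mxmeasurableP].
have mC k : (k.+1 < n)%N -> mxmeasurable (C k) by move=> /C_random/mxmeasurableP.
have [/mxmeasurableP mX hX _ _ _] := X_GUE.
pose J w := castmx (sum_block_dim n p, sum_block_dim n p)
  (block_jacobi n (fun k => D k w) (fun k => C k w)).
have JE w : J w = hybrid p_gt0 n (fun k => D k w) (fun k => C k w) 0.
  by rewrite hybrid_block_jacobi.
have hJ w : J w \is hermsymmx.
  rewrite JE; apply: hybrid_herm.
  - by move=> i /D_GUE[_ h _ _ _]; exact: h.
  - by move=> i /C_psd/(_ w)[].
  - by apply/hermP; rewrite trmx0 map_mx0.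
have mJ : mxmeasurable J.
  rewrite (_ : J = fun w => hybrid p_gt0 n (fun k => D k w) (fun k => C k w) 0).
    exact: (hybrid_measurable p_gt0 n mD mC (@mxmeasurable_cst R _ T _ _ 0)).
  by apply/funext => w.
pose Phi := @hspectral_measure R p (p * n) (leq_pmulr p n_gt0).
have -> : (fun w => spectral_measure (leq_block_dim p n_gt0)
    (block_jacobi n (fun k => D k w) (fun k => C k w))) = Phi \o J.
  apply/funext => w; rewrite /= /Phi /hspectral_measure hermpart_id//.
  exact/esym/spectral_measure_castmx.
have -> : (fun w => spectral_measure (leq_pmulr p n_gt0) (X w)) = Phi \o X.
  by apply/funext => w; rewrite /= /Phi /hspectral_measure hermpart_id.
have mPhi A : @mxm_sigma R p A -> @mx_borel R (p * n) (p * n) (Phi @^-1` A).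
  exact: hspectral_measure_measurable.
split.
- by move=> A /mPhi; move/mxmeasurableP: mJ; apply.
- by move=> A /mPhi; move/mxmeasurableP: mX; apply.
move=> A mA; apply: (block_jacobi_probability p_gt0 D_GUE C_random C_psd C_LUE
  DC_independent X_GUE (mPhi A mA)) => V H uV fV.
rewrite /= /Phi /hspectral_measure hermpart_unitary spectral_measure_unitary//.
by move=> i j; apply: fV; rewrite /blk /= divn_small.
Qed.
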